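(* Let $\phi:\mathcal H\to\mathcal G$ be a continuous functor between étale groupoids which is a homeomorphism on objects and surjective on morphisms. Then $\phi$ induces isomorphisms $H_n(\mathcal H;A)\to H_n(\mathcal G;A)$ and $H^n(\mathcal G;A)\to H^n(\mathcal H;A)$ for every abelian group $A$ and every $n\ge0$.
   Context: Topological groupoid: spaces $\mathcal G_0,\mathcal G_1$, continuous $\mathrm{dom},\mathrm{cod}$, units, composition, inverse, $\mathrm{dom}$ open; étale if $\mathrm{dom}$ is a local homeomorphism. A principal $\mathcal G$-bundle over a space $X$: a space $E$ with continuous $p:E\to\mathcal G_0$, $w:E\to X$ and a left $\mathcal G$-action w.r.t. $p$ preserving $w$, with $w$ an open surjection and $(g,e)\mapsto(g\cdot e,e)$ a homeomorphism $\mathcal G_1\times_{\mathcal G_0}E\to E\times_XE$; pullbacks along continuous maps are $E\times_XY$. $\mathfrak S_n(\mathcal G)$ is the free abelian group on isomorphism classes of principal $\mathcal G$-bundles over the standard simplex $\Delta^n$, with boundary $\partial u=\sum_i(-1)^id_i^*u$ ($d_i$ the face maps); $H_n(\mathcal G;A)=H_n(\mathfrak S(\mathcal G)\otimes A)$, $H^n(\mathcal G;A)=H^n(\mathrm{Hom}(\mathfrak S(\mathcal G),A))$. A continuous functor $\phi:\mathcal H\to\mathcal G$ induces a chain map by sending a principal $\mathcal H$-bundle $F$ to $\langle\phi\rangle\otimes F$, where $\langle\phi\rangle=\{(g,b):\mathrm{dom}\,g=\phi_0(b)\}$ and $\langle\phi\rangle\otimes F=(\langle\phi\rangle\times_{\mathcal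 H_0}F)/((x,f)\sim(x\cdot h,h^{-1}\cdot f))$ with $(g,b)\cdot h=(g\phi(h),\mathrm{dom}\,h)$; this gives the induced maps on homology and cohomology. *)

(* Defs.v *)
From HB Require Import structures.
From mathcomp Require Import all_boot all_order all_algebra.
From mathcomp Require Import all_classical all_reals all_analysis.

Set Implicit Arguments.
Unset Strict Implicit.
Unset Printing Implicit Defensive.

Import Order.TTheory GRing.Theory Num.Theory.
Import numFieldNormedType.Exports.
Local Open Scope classical_set_scope.
Local Open Scope ring_scope.

(* gcomp g h is the composite "g after h", meaningful when gdom g = gcod h. *)
Record topGpd := TopGpd {
  ob : topologicalType;
  mor : topologicalType;
  gdom : mor -> ob;
  gcod : mor -> ob;
  gid : ob -> mor;
  gcomp : mor -> mor -> mor;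
  ginv : mor -> mor }.
Arguments gdom : clear implicits.
Arguments gcod : clear implicits.
Arguments gid : clear implicits.
Arguments gcomp : clear implicits.
Arguments ginv : clear implicits.

Definition composable (G : topGpd) : set (mor G * mor G) :=
  [set p | gdom G p.1 = gcod G p.2].
Arguments composable : clear implicits.

Definition topological_groupoid (G : topGpd) : Prop :=
  (forall x, gdom G (gid G x) = x /\ gcod G (gid G x) = x) /\
  (forall g h, gdom G g = gcod G h ->
     gdom G (gcomp G g h) = gdom G h /\ gcod G (gcomp G g h) = gcod G g) /\
  (forall f g h, gdom G f = gcod G g -> gdom G g = gcod G h ->
     gcomp G f (gcomp G g h) = gcomp G (gcomp G f g) h) /\
  (forall g, gcomp G g (gid G (gdom G g)) = g /\ gcomp G (gid G (gcod G g)) g = g) /\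
  (forall g, gdom G (ginv G g) = gcod G g /\ gcod G (ginv G g) = gdom G g /\
     gcomp G (ginv G g) g = gid G (gdom G g) /\ gcomp G g (ginv G g) = gid G (gcod G g)) /\
  continuous (gdom G) /\ continuous (gcod G) /\ continuous (gid G) /\
  continuous (ginv G) /\
  {within composable G, continuous (fun p => gcomp G p.1 p.2)} /\
  (forall U : set (mor G), open U -> open (gdom G @` U)).

Definition local_homeomorphism (S T : topologicalType) (f : S -> T) : Prop :=
  continuous f /\
  forall x, exists U : set S,
    open U /\ U x /\ open (f @` U) /\
    (forall y z, U y -> U z -> f y = f z -> y = z) /\
    (forall V, open V -> V `<=` U -> open (f @` V)).

Definition etale_groupoid (G : topGpd) : Prop :=
  topological_groupoid G /\ local_homeomorphism (gdom G).

Definition homeomorphism (S T : topologicalType) (f : S -> T) : Prop :=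
  continuous f /\ exists g : T -> S, cancel f g /\ cancel g f /\ continuous g.

Record gfunctor (H G : topGpd) := GFunctor {
  fob : ob H -> ob G;
  fmor : mor H -> mor G }.
Arguments fob {H G} g _ : rename.
Arguments fmor {H G} g _ : rename.

Definition continuous_functor (H G : topGpd) (phi : gfunctor H G) : Prop :=
  continuous (fob phi) /\ continuous (fmor phi) /\
  (forall h, gdom G (fmor phi h) = fob phi (gdom H h)) /\
  (forall h, gcod G (fmor phi h) = fob phi (gcod H h)) /\
  (forall x, fmor phi (gid H x) = gid G (fob phi x)) /\
  (forall g h, gdom H g = gcod H h ->
     fmor phi (gcomp H g h) = gcomp G (fmor phi g) (fmor phi h)).

(* Principal bundles.  A bundle is given by an ambient space [tot]     *)
(* together with the subset [carr] which is the actual total space E   *)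
(* (with the subspace topology); the base is a subset B of an ambient  *)
(* space X (again with the subspace topology).                         *)

Record pbundle (G : topGpd) (X : topologicalType) := PBundle {
  tot : topologicalType;
  carr : set tot;
  bproj : tot -> ob G;
  bmap : tot -> X;
  bact : mor G -> tot -> tot }.
Arguments tot {G X} E : rename.
Arguments carr {G X} E _ : rename.
Arguments bproj {G X} E _ : rename.
Arguments bmap {G X} E _ : rename.
Arguments bact {G X} E _ _ : rename.

Definition act_dom (G : topGpd) (X : topologicalType) (E : pbundle G X) :
  set (mor G * tot E) :=
  [set q | carr E q.2 /\ gdom G q.1 = bproj E q.2].
Arguments act_dom {G X} E.

Definition is_pbundle (G : topGpd) (X : topologicalType) (B : set X)
    (E : pbundle G X) : Prop :=
  {within carr E, continuous (bproj E)} /\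
  {within carr E, continuous (bmap E)} /\
  (forall e, carr E e -> B (bmap E e)) /\
  (forall g e, carr E e -> gdom G g = bproj E e ->
     carr E (bact E g e) /\ bproj E (bact E g e) = gcod G g /\
     bmap E (bact E g e) = bmap E e) /\
  (forall e, carr E e -> bact E (gid G (bproj E e)) e = e) /\
  (forall g h e, carr E e -> gdom G h = bproj E e -> gdom G g = gcod G h ->
     bact E (gcomp G g h) e = bact E g (bact E h e)) /\
  {within act_dom E, continuous (fun q => bact E q.1 q.2)} /\
  (forall x, B x -> exists e, carr E e /\ bmap E e = x) /\
  (forall U : set (tot E), open U ->
     exists V : set X, open V /\ bmap E @` (U `&` carr E) = V `&` B) /\
  (let Phi := fun q : mor G * tot E => (bact E q.1 q.2, q.2) in
   let T := [set r : tot E * tot E |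
              carr E r.1 /\ carr E r.2 /\ bmap E r.1 = bmap E r.2] in
   (forall q, act_dom E q -> T (Phi q)) /\
   {within act_dom E, continuous Phi} /\
   exists Psi : tot E * tot E -> mor G * tot E,
     (forall r, T r -> act_dom E (Psi r)) /\
     (forall q, act_dom E q -> Psi (Phi q) = q) /\
     (forall r, T r -> Phi (Psi r) = r) /\
     {within T, continuous Psi}).

Definition pb_iso (G : topGpd) (X : topologicalType) (E F : pbundle G X) : Prop :=
  exists (f : tot E -> tot F) (g : tot F -> tot E),
    (forall e, carr E e -> carr F (f e)) /\
    (forall e, carr F e -> carr E (g e)) /\
    (forall e, carr E e -> g (f e) = e) /\
    (forall e, carr F e -> f (g e) = e) /\
    {within carr E, continuous f} /\ {within carr F, continuous g} /\
    (forall e, carr E e -> bproj F (f e) = bproj E e /\ bmap F (f e) = bmap E e) /\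
    (forall h e, carr E e -> gdom G h = bproj E e ->
       f (bact E h e) = bact F h (f e)).

Definition pullback (G : topGpd) (X Y : topologicalType) (f : Y -> X)
    (BY : set Y) (E : pbundle G X) : pbundle G Y :=
  @PBundle G Y (tot E * Y)%type
    [set z | carr E z.1 /\ BY z.2 /\ bmap E z.1 = f z.2]
    (fun z => bproj E z.1) (fun z => z.2) (fun g z => (bact E g z.1, z.2)).

Definition simp (R : realType) (n : nat) : topologicalType := 'rV[R]_(n.+1).

Definition Delta (R : realType) (n : nat) : set (simp R n) :=
  [set x | (forall i, 0 <= x ord0 i) /\ \sum_i x ord0 i = 1].
Arguments Delta : clear implicits.

Definition face (R : realType) (n : nat) (i : 'I_(n.+2)) : simp R n -> simp R n.+1 :=
  fun x => \row_j (if unlift i j is Some k then x ord0 k else 0).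

Section Induced.
Variables (H G : topGpd) (phi : gfunctor H G) (X : topologicalType)
          (F : pbundle H X).

(* elements ((g, b), f) of <phi> x_{H0} F *)
Definition indP : Type := ((mor G * ob H) * tot F)%type.

Definition indS : set indP :=
  [set x | gdom G x.1.1 = fob phi x.1.2 /\ carr F x.2 /\ x.1.2 = bproj F x.2].

Definition indrel (x y : indP) : Prop :=
  indS x /\ indS y /\ exists h, gcod H h = x.1.2 /\
    y = ((gcomp G x.1.1 (fmor phi h), gdom H h), bact F (ginv H h) x.2).

Definition indcls (x : indP) : set indP := [set y | indrel x y \/ (indS x /\ y = x)].

Definition qtot : Type := {q : set indP | exists x, q = indcls x}.

Definition mkQ (x : indP) : qtot := exist _ (indcls x) (ex_intro _ x erefl).

Definition qrep (q : qtot) : indP := projT1 (cid (proj2_sig q)).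

Definition qopen (V : set qtot) : Prop :=
  exists U : set indP, open U /\ [set x | indS x /\ V (mkQ x)] = U `&` indS.

Lemma qopenT : qopen setT.
Proof.
exists setT; split; first exact: openT.
by apply/seteqP; split=> x /=; [case=> ? _| case=> _ ?].
Qed.

Lemma qopenI : setI_closed qopen.
Proof.
move=> A B [U1 [oU1 e1]] [U2 [oU2 e2]]; exists (U1 `&` U2); split.
  exact: openI.
apply/seteqP; split=> x /=.
- case=> Sx [Ax Bx].
  have : [set x | indS x /\ A (mkQ x)] x by [].
  have : [set x | indS x /\ B (mkQ x)] x by [].
  by rewrite e1 e2 => -[? _] [? _].
- case=> -[u1 u2] Sx.
  have : (U1 `&` indS) x by [].
  have : (U2 `&` indS) x by [].
  by rewrite -e1 -e2 => -[_ ?] [_ ?].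
Qed.

Lemma qopen_bigU (I : Type) (f : I -> set qtot) :
  (forall i, qopen (f i)) -> qopen (\bigcup_i f i).
Proof.
move=> hf; pose U i := projT1 (cid (hf i)).
have hU i : open (U i) /\ [set x | indS x /\ f i (mkQ x)] = U i `&` indS.
  exact: (projT2 (cid (hf i))).
exists (\bigcup_i U i); split.
  by apply: bigcup_open => i _; case: (hU i).
apply/seteqP; split=> x /=.
- case=> Sx [i _ fxi]; split=> //; exists i => //.
  have : [set x | indS x /\ f i (mkQ x)] x by [].
  by case: (hU i) => _ ->; case.
- case=> -[i _ Uix] Sx; split=> //; exists i => //.
  have : (U i `&` indS) x by [].
  by case: (hU i) => _ <-; case.
Qed.

HB.instance Definition _ := gen_eqMixin qtot.
HB.instance Definition _ := gen_choiceMixin qtot.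
HB.instance Definition _ := isOpenTopological.Build qtot qopenT qopenI qopen_bigU.

Definition induced : pbundle G X :=
  @PBundle G X qtot
    (mkQ @` indS)
    (fun q => gcod G (qrep q).1.1)
    (fun q => bmap F (qrep q).2)
    (fun g q => mkQ ((gcomp G g (qrep q).1.1, (qrep q).1.2), (qrep q).2)).

End Induced.

Section Chains.
Variables (R : realType) (A : zmodType).

(* a chain is a formal A-linear combination of principal G-bundles over Delta^n *)
Definition chain (G : topGpd) (n : nat) := seq (pbundle G (simp R n) * A).

Definition valid_chain (G : topGpd) (n : nat) (c : chain G n) : Prop :=
  foldr (fun p P => is_pbundle (Delta R n) p.1 /\ P) True c.

Definition chain_coef (G : topGpd) (n : nat) (c : chain G n)
    (E : pbundle G (simp R n)) : A :=
  \sum_(p <- c | `[< pb_iso p.1 E >]) p.2.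

(* equality in S_n(G) (x) A *)
Definition chain_eq (G : topGpd) (n : nat) (c1 c2 : chain G n) : Prop :=
  forall E, is_pbundle (Delta R n) E -> chain_coef c1 E = chain_coef c2 E.

Definition chain_sub (G : topGpd) (n : nat) (c1 c2 : chain G n) : chain G n :=
  c1 ++ [seq (p.1, - p.2) | p <- c2].

Definition bdry (G : topGpd) (n : nat) (c : chain G n.+1) : chain G n :=
  flatten [seq [seq (pullback (@face R n i) (Delta R n) p.1, p.2 *~ ((-1) ^+ i))
               | i <- enum 'I_(n.+2)] | p <- c].

Definition is_cycle (G : topGpd) (n : nat) : chain G n -> Prop :=
  match n return chain G n -> Prop with
  | 0 => fun _ => True
  | n'.+1 => fun c => chain_eq (bdry c) [::]
  end.

Definition is_boundary (G : topGpd) (n : nat) (c : chain G n) : Prop :=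
  exists b : chain G n.+1, valid_chain b /\ chain_eq c (bdry b).

Definition chain_ind (H G : topGpd) (phi : gfunctor H G) (n : nat)
    (c : chain H n) : chain G n :=
  [seq (induced phi p.1, p.2) | p <- c].

(* cochains: A-valued functions on isomorphism classes of bundles over Delta^n *)
Definition cochain (G : topGpd) (n : nat) := pbundle G (simp R n) -> A.

Definition valid_cochain (G : topGpd) (n : nat) (f : cochain G n) : Prop :=
  forall E F, is_pbundle (Delta R n) E -> is_pbundle (Delta R n) F ->
    pb_iso E F -> f E = f F.

Definition cochain_eq (G : topGpd) (n : nat) (f g : cochain G n) : Prop :=
  forall E, is_pbundle (Delta R n) E -> f E = g E.

Definition cobdry (G : topGpd) (n : nat) (f : cochain G n) : cochain G n.+1 :=
  fun E => \sum_(i < n.+2) f (pullback (@face R n i) (Delta R n) E) *~ ((-1) ^+ i).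

Definition is_cocycle (G : topGpd) (n : nat) (f : cochain G n) : Prop :=
  cochain_eq (cobdry f) (fun _ => 0).

Definition is_coboundary (G : topGpd) (n : nat) : cochain G n -> Prop :=
  match n return cochain G n -> Prop with
  | 0 => fun f => cochain_eq f (fun _ => 0)
  | n'.+1 => fun f => exists g : cochain G n', valid_cochain g /\ cochain_eq f (cobdry g)
  end.

Definition cochain_ind (H G : topGpd) (phi : gfunctor H G) (n : nat)
    (f : cochain G n) : cochain H n :=
  fun F => f (induced phi F).

Definition homology_iso (H G : topGpd) (phi : gfunctor H G) (n : nat) : Prop :=
  (forall z : chain G n, valid_chain z -> is_cycle z ->
     exists w : chain H n, valid_chain w /\ is_cycle w /\
       is_boundary (chain_sub (chain_ind phi w) z)) /\
  (forall w : chain H n, valid_chain w -> is_cycle w ->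
     is_boundary (chain_ind phi w) -> is_boundary w).

Definition cohomology_iso (H G : topGpd) (phi : gfunctor H G) (n : nat) : Prop :=
  (forall f : cochain H n, valid_cochain f -> is_cocycle f ->
     exists f' : cochain G n, valid_cochain f' /\ is_cocycle f' /\
       is_coboundary (fun F => cochain_ind phi f' F - f F)) /\
  (forall f' : cochain G n, valid_cochain f' -> is_cocycle f' ->
     is_coboundary (cochain_ind phi f') -> is_coboundary f').

End Chains.

(* Main.v *)
Require Import Defs.
From HB Require Import structures.
From mathcomp Require Import all_boot all_order all_algebra.
From mathcomp Require Import all_classical all_reals all_analysis.
From Stdlib Require List ClassicalEpsilon ProofIrrelevance.

Set Implicit Arguments.
Unset Strict Implicit.
Unset Printing Implicit Defensive.

Import Order.TTheory GRing.Theory Num.Theory.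
Import Defs.
Import numFieldNormedType.Exports.
Local Open Scope classical_set_scope.
Local Open Scope ring_scope.

(** The functor [phi] does not induce a bijection on isomorphism classes of
    bundles over a simplex, but it does so "after subdivision".  Barycentric
    subdivision acts on the complexes of both groupoids, is chain homotopic to
    the identity and commutes with [phi].  Since the groupoids are étale, every
    bundle has local sections, so a sufficiently fine subdivision of it consists
    of bundles with a global section.  A [G]-bundle with a section is determined
    by a map to [ob G = ob H], hence is induced from an [H]-bundle with a
    section; and if two [H]-bundles with sections induce isomorphic [G]-bundles,
    the isomorphism is a map to [mor G], which lifts locally to [mor H] because
    [fmor phi] is a surjective local homeomorphism, so the two bundles become
    isomorphic after subdividing.  This makes the mapping cone of [phi] acyclic.
    The cone is free and bounded below, hence contractible, and a contraction
    yields homology and cohomology with arbitrary coefficients. *)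

(** * Formal chains and their evaluation *)

(** How fine a subdivision must be depends on the bundle, so no single power of subdivision inverts
    [phi], and a cochain, which sees infinitely many bundles at once, cannot be treated directly. A
    chain has finitely many terms, and one power serves them all. Topology is therefore used only to
    prove the cone acyclic over the integers; everything about the coefficients [A] is formal from
    the contraction.

    A cycle of the cone is a pair [(x, y)] with [d x = 0] and [phi x + d y = 0]. Two subdivisions
    are involved: one after which [y] lifts to a chain [u] of bundles with sections, and a further
    one that kills [x' + d u], where [x'] is the subdivided [x]; the image of this chain is zero,
    but it need not be zero itself. The chain homotopies make up for the difference, so they too
    must commute with [phi]. They do because all operators are pullbacks along affine maps of
    operators on linear chains, and passing to induced bundles commutes with pullback. *)

Definition on_terms (X B : Type) (P : X -> Prop) (c : seq (X * B)) : Prop :=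
  foldr (fun p Q => P p.1 /\ Q) True c.

Section Call.
Context {X B : Type}.
Implicit Types (P Q : X -> Prop) (c : seq (X * B)).

Lemma on_terms_cat P c d : on_terms P (c ++ d) <-> on_terms P c /\ on_terms P d.
Proof. by elim: c => [|p c IH] /=; [split=> [|[]]|rewrite IH; tauto]. Qed.

Lemma on_terms_imp P Q c : (forall x, P x -> Q x) -> on_terms P c -> on_terms Q c.
Proof. by move=> PQ; elim: c => [|p c IH] //= [/PQ ? /IH]. Qed.

Lemma on_terms_and P Q c : on_terms P c -> on_terms Q c -> on_terms (fun x => P x /\ Q x) c.
Proof. by elim: c => [|p c IH] //= [? /IH{}IH] [? /IH]. Qed.

Lemma on_terms_In P c : on_terms P c <-> forall p, List.In p c -> P p.1.
Proof.
elim: c => [|p c IH] /=; first by split.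
rewrite IH; split=> [[Pp h] q [<-//|]|h]; first exact: h.
by split=> [|q qc]; apply: h; [left|right].
Qed.

Lemma on_terms_map (Y C : Type) (f : X -> Y) (h : X * B -> C) (P : Y -> Prop) c :
  on_terms (P \o f) c -> on_terms P [seq (f p.1, h p) | p <- c].
Proof. by elim: c => [|p c IH] //= [? /IH]. Qed.

(** The maximum of finitely many thresholds. Every passage from a bound for each simplex to a bound
    for a whole chain goes through this. *)
Lemma on_terms_eventually (Q : nat -> X -> Prop) c :
  on_terms (fun x => exists k, forall l, (k <= l)%N -> Q l x) c ->
  exists k, forall l, (k <= l)%N -> on_terms (Q l) c.
Proof.
elim: c => [|p c IH] /=; first by exists 0%N.
move=> [[k1 h1] /IH[k2 h2]]; exists (maxn k1 k2) => l.
by rewrite geq_max => /andP[/h1 ? /h2].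
Qed.

End Call.

(** When each [f x] is additive, this is the homomorphism to [M] that the family [f] defines on the
    free abelian group on [X] tensored with [A]. Identities between chains are proved after
    evaluation, so that they become identities in [M]. *)
Definition ev (X : Type) (A M : zmodType) (f : X -> A -> M) (c : seq (X * A)) : M :=
  \sum_(p <- c) f p.1 p.2.

Definition ez (X : Type) (M : zmodType) (g : X -> M) (c : seq (X * int)) : M :=
  ev (fun x m => g x *~ m) c.

Definition amap (X Y : Type) (A : zmodType) (L : X -> seq (Y * int))
    (c : seq (X * A)) : seq (Y * A) :=
  flatten [seq [seq (q.1, p.2 *~ q.2) | q <- L p.1] | p <- c].

(** The case [A = int] of [amap], with the ring product in place of [*~]. *)
Definition zmap (X Y : Type) (L : X -> seq (Y * int)) (c : seq (X * int)) : seq (Y * int) :=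
  flatten [seq [seq (q.1, p.2 * q.2) | q <- L p.1] | p <- c].

Definition zopp (X : Type) (c : seq (X * int)) := [seq (p.1, - p.2) | p <- c].

Definition bmapc (X Y B : Type) (f : X -> Y) (c : seq (X * B)) :=
  [seq (f p.1, p.2) | p <- c].

Definition chopp (X : Type) (A : zmodType) (c : seq (X * A)) := [seq (p.1, - p.2) | p <- c].

Section Ev.
Context {X : Type} {A M : zmodType}.
Implicit Types (f : X -> A -> M) (c : seq (X * A)).

Lemma ev_nil f : ev f [::] = 0. Proof. exact: big_nil. Qed.

Lemma ev_cons f p c : ev f (p :: c) = f p.1 p.2 + ev f c.
Proof. exact: big_cons. Qed.

Lemma ev_cat f c d : ev f (c ++ d) = ev f c + ev f d.
Proof. exact: big_cat. Qed.


Lemma ev_ext f f' c : (forall x a, f x a = f' x a) -> ev f c = ev f' c.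
Proof. by move=> ff; apply: eq_bigr => p _; exact: ff. Qed.

Lemma ev_call f f' c (P : X -> Prop) :
  on_terms P c -> (forall x a, P x -> f x a = f' x a) -> ev f c = ev f' c.
Proof.
move=> + ff; rewrite /ev; elim: c => [|p c IH] /=; first by rewrite !big_nil.
by move=> [Pp /IH]; rewrite !big_cons => ->; rewrite ff.
Qed.

Lemma ev_add f f' c : ev (fun x a => f x a + f' x a) c = ev f c + ev f' c.
Proof. exact: big_split. Qed.

Lemma ev_neg f c : ev (fun x a => - f x a) c = - ev f c.
Proof. by rewrite /ev sumrN. Qed.

Lemma ev_zero c : ev (fun _ _ => 0) c = 0 :> M.
Proof. by rewrite /ev big1. Qed.

End Ev.

Lemma ev_map (X Y : Type) (A M : zmodType) (h : Y -> A -> M) (k : X -> Y) (c : seq (X * A)) : ev h (bmapc k c) = ev (h \o k) c.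
Proof. by rewrite /ev big_map. Qed.

Section Ez.
Context {X : Type} {M : zmodType}.
Implicit Types (z : seq (X * int)).

Lemma ez_nil (g : X -> M) : ez g [::] = 0. Proof. exact: big_nil. Qed.

Lemma ez_cons (g : X -> M) p z : ez g (p :: z) = g p.1 *~ p.2 + ez g z.
Proof. exact: big_cons. Qed.

Lemma ez1 (g : X -> M) x : ez g [:: (x, 1)] = g x.
Proof. by rewrite /ez /ev big_seq1. Qed.

Lemma ez_cat (g : X -> M) z z' : ez g (z ++ z') = ez g z + ez g z'.
Proof. exact: big_cat. Qed.


Lemma ez_opp (g : X -> M) z : ez g (zopp z) = - ez g z.
Proof. by rewrite /ez /ev big_map -sumrN; apply: eq_bigr => p _ /=; rewrite mulrNz. Qed.

Lemma ez_ext (g g' : X -> M) z : (forall x, g x = g' x) -> ez g z = ez g' z.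
Proof. by move=> gg; apply: ev_ext => x a; rewrite gg. Qed.

Lemma ez_call (g g' : X -> M) z (P : X -> Prop) :
  on_terms P z -> (forall x, P x -> g x = g' x) -> ez g z = ez g' z.
Proof. by move=> cP gg; apply: ev_call cP _ => x a /gg ->. Qed.

Lemma ez_add (g g' : X -> M) z : ez (fun x => g x + g' x) z = ez g z + ez g' z.
Proof. by rewrite /ez -ev_add; apply: ev_ext => x a; rewrite mulrzDl. Qed.

Lemma ez_neg (g : X -> M) z : ez (fun x => - g x) z = - ez g z.
Proof. by rewrite /ez -ev_neg; apply: ev_ext => x a; rewrite mulNrz. Qed.

Lemma ez_zero z : ez (fun _ => 0) z = 0 :> M.
Proof. by rewrite /ez /ev big1 // => p _; rewrite mul0rz. Qed.

Lemma ez_mulz (g : X -> M) z (m : int) : ez (fun x => g x *~ m) z = ez g z *~ m.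
Proof.
rewrite /ez /ev; elim: z => [|p z IH]; first by rewrite !big_nil mul0rz.
by rewrite !big_cons IH mulrzDl -!mulrzA mulrC.
Qed.

End Ez.

Lemma ez_map (X Y : Type) (M : zmodType) (g : Y -> M) (k : X -> Y) (z : seq (X * int)) : ez g (bmapc k z) = ez (g \o k) z.
Proof. exact: big_map. Qed.

(** Pulls a functional back along an operator. Rewriting with it turns composites of operators into
    nested functionals, so that no list ever has to be normalised. *)
Lemma ez_zmap (X Y : Type) (M : zmodType) (g : Y -> M) (L : X -> seq (Y * int)) (z : seq (X * int)) :
  ez g (zmap L z) = ez (fun x => ez g (L x)) z.
Proof.
rewrite /zmap; elim: z => [|p z IH] /=; first by rewrite !ez_nil.

rewrite ez_cat IH ez_cons. congr (_ + _).
rewrite -ez_mulz /ez /ev big_map; apply: eq_bigr => q _ /=.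
by rewrite -mulrzA mulrC.
Qed.

Section Additive.
Context {A M : zmodType} (f : A -> M).
Hypothesis fD : {morph f : a b / a + b}.

Lemma madd0 : f 0 = 0.
Proof. by apply: (addrI (f 0)); rewrite -fD !addr0. Qed.

Lemma maddN a : f (- a) = - f a.
Proof. by apply: (addrI (f a)); rewrite -fD !subrr madd0. Qed.

Lemma maddz a m : f (a *~ m) = f a *~ m.
Proof.
have h n : f (a *+ n) = f a *+ n.
  by elim: n => [|n IH]; [rewrite !mulr0n madd0|rewrite !mulrS fD IH].
by case: m => n; rewrite ?NegzE ?mulrNz ?maddN -?pmulrn h.
Qed.

Lemma madd_sum (I : Type) (r : seq I) (P : pred I) (F : I -> A) :
  f (\sum_(i <- r | P i) F i) = \sum_(i <- r | P i) f (F i).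
Proof. exact: (big_morph f fD madd0). Qed.
End Additive.

Lemma ev_amap (X Y : Type) (A M : zmodType) (f : Y -> A -> M) (L : X -> seq (Y * int))
    (c : seq (X * A)) :
  (forall y, {morph f y : a b / a + b}) ->
  ev f (amap L c) = ev (fun x a => ez (f^~ a) (L x)) c.
Proof.
move=> fD; rewrite /amap; elim: c => [|p c IH] /=; first by rewrite /ev !big_nil.
rewrite ev_cat IH ev_cons; congr (_ + _).
rewrite /ez /ev big_map; apply: eq_bigr => q _ /=; exact: maddz.
Qed.

Lemma ev_opp (X : Type) (A M : zmodType) (f : X -> A -> M) (c : seq (X * A)) :
  (forall y, {morph f y : a b / a + b}) -> ev f (chopp c) = - ev f c.
Proof.
move=> fD; rewrite /ev big_map -sumrN; apply: eq_bigr => p _ /=; exact: maddN.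
Qed.

Lemma on_terms_amap (X Y : Type) (A : zmodType) (P : X -> Prop) (Q : Y -> Prop)
    (L : X -> seq (Y * int)) (c : seq (X * A)) :
  on_terms P c -> (forall x, P x -> on_terms Q (L x)) -> on_terms Q (amap L c).
Proof.
move=> + PQ; rewrite /amap; elim: c => [|p c IH] //= [/PQ Pp /IH{}IH].
by apply/on_terms_cat; split=> //; exact: (@on_terms_map _ _ _ _ id).
Qed.

Lemma on_terms_zmap (X Y : Type) (P : X -> Prop) (Q : Y -> Prop)
    (L : X -> seq (Y * int)) (c : seq (X * int)) :
  on_terms P c -> (forall x, P x -> on_terms Q (L x)) -> on_terms Q (zmap L c).
Proof.
move=> + PQ; rewrite /zmap; elim: c => [|p c IH] //= [/PQ Pp /IH{}IH].
by apply/on_terms_cat; split=> //; exact: (@on_terms_map _ _ _ _ id).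
Qed.

Lemma on_terms_zopp (X : Type) (P : X -> Prop) (c : seq (X * int)) : on_terms P c -> on_terms P (zopp c).
Proof. exact: (@on_terms_map _ _ _ _ id). Qed.

Lemma on_terms_chopp (X : Type) (A : zmodType) (P : X -> Prop) (c : seq (X * A)) :
  on_terms P c -> on_terms P (chopp c).
Proof. exact: (@on_terms_map _ _ _ _ id). Qed.

Lemma on_terms_bmapc (X Y B : Type) (P : Y -> Prop) (f : X -> Y) (c : seq (X * B)) :
  on_terms (P \o f) c -> on_terms P (bmapc f c).
Proof. exact: on_terms_map. Qed.

(** Induction on the length. The terms equivalent to the head together contribute [f x] of their
    total coefficient, which is 0; removing them empties one class and leaves the sums over all
    other classes unchanged. *)
Lemma ev_coef0 (X : Type) (A M : zmodType) (V : X -> Prop) (r : X -> X -> Prop)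
    (f : X -> A -> M) (c : seq (X * A)) :
  (forall x, r x x) -> (forall x y, r x y -> r y x) ->
  (forall x y z, r x y -> r y z -> r x z) ->
  (forall x, {morph f x : a b / a + b}) ->
  (forall x y a, V x -> V y -> r x y -> f x a = f y a) ->
  on_terms V c -> (forall x, V x -> \sum_(p <- c | `[< r p.1 x >]) p.2 = 0) ->
  ev f c = 0.
Proof.
move=> rr rs rt fD fr; have [m] := ubnP (size c).
elim: m c => // m IH [|[x a] c] /=; first by rewrite ev_nil.
rewrite ltnS => sz Vc c0; set d := (x, a) :: c.
have Vx : V x by case: Vc.
rewrite /ev -/d (bigID (fun p => `[< r p.1 x >])) /=.
rewrite (_ : \sum_(p <- d | _) _ = f x (\sum_(p <- d | `[< r p.1 x >]) p.2)); last first.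
  rewrite madd_sum //.
  have: on_terms V d by []. 
  elim: (d) => [|p e IHe]; first by rewrite !big_nil.
  move=> /= [Vp /IHe{}IHe]; rewrite !big_cons; case: asboolP => // rpx.
  by congr (_ + _) => //; apply: fr => //; apply/asboolP.
rewrite c0 // madd0 // add0r -big_filter -/(ev f _); apply: IH.
- rewrite /= asboolT //=; apply: leq_ltn_trans sz.
  by rewrite size_filter count_size.
- have: on_terms V d by []. 
  elim: (d) => [|p e IHe] //= [Vp /IHe{}IHe].
  by case: ifP.
- move=> y Vy; rewrite big_filter_cond.
  have [ryx|ryx] := asboolP (r y x).
    rewrite big1 // => p /andP[/asboolPn npx /asboolP rpy].
    by case: npx; exact: rt rpy ryx.
  rewrite -[RHS](c0 _ Vy) -/d; apply: eq_bigl => p.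
  apply/andP/idP=> [[]//|rpy]; split=> //; apply/asboolPn => rpx; apply: ryx.
  by apply: rt rpx; apply: rs; apply/asboolP.
Qed.

(** * Generators up to equivalence, and chain complexes on them *)

Record sset := SSet {
  st :> Type;
  sv : st -> Prop;
  se : st -> st -> Prop;
  se_refl : forall x, se x x;
  se_sym : forall x y, se x y -> se y x;
  se_trans : forall x y z, se x y -> se y z -> se x z }.
Arguments sv {s} _.
Arguments se {s} _ _.

Definition einv (X : sset) (T : Type) (g : X -> T) : Prop :=
  forall x y, sv x -> sv y -> se x y -> g x = g y.

(* Bundles live in a universe too large for a free [zmodType] on them, so chains
   are lists, compared through all functions that are constant on classes. *)
Definition zeq (X : sset) (c d : seq (X * int)) : Prop :=
  forall (M : zmodType) (g : X -> M), einv g -> ez g c = ez g d.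

Definition aeq (X : sset) (A : zmodType) (c d : seq (X * A)) : Prop :=
  forall (M : zmodType) (f : X -> A -> M),
    (forall x, {morph f x : a b / a + b}) -> (forall a, einv (f^~ a)) -> ev f c = ev f d.

Definition coef (X : sset) (A : zmodType) (c : seq (X * A)) (x : X) : A :=
  \sum_(p <- c | `[< se p.1 x >]) p.2.

(** What makes [L] descend to a homomorphism between the free abelian groups on classes of valid
    elements. *)
Definition goodop (X Y : sset) (L : X -> seq (Y * int)) : Prop :=
  (forall x, sv x -> on_terms sv (L x)) /\
  (forall x y, sv x -> sv y -> se x y -> zeq (L x) (L y)).

Lemma goodop_inv (X Y : sset) (L : X -> seq (Y * int)) (M : zmodType) (g : Y -> M) :
  goodop L -> einv g -> einv (fun x => ez g (L x)).
Proof. by move=> [_ Lr] gi x y vx vy exy; exact: Lr. Qed.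

Lemma zeq_zmap (X Y : sset) (L : X -> seq (Y * int)) c d :
  goodop L -> zeq c d -> zeq (zmap L c) (zmap L d).
Proof. by move=> gL cd M g gi; rewrite !ez_zmap; apply: cd; exact: goodop_inv. Qed.

Lemma inv_indic (X : sset) (A : zmodType) (x : X) :
  forall a : A, einv (fun y : X => if `[< se y x >] then a else 0).
Proof.
move=> a y z _ _ yz; congr (if _ then _ else _); apply/asboolP/asboolP => h.
  by apply: se_trans h; exact: se_sym.
exact: se_trans yz h.
Qed.

Lemma coef_ev (X : sset) (A : zmodType) (c : seq (X * A)) x :
  coef c x = ev (fun y a => if `[< se y x >] then a else 0) c.
Proof. by rewrite /coef big_mkcond. Qed.

(** The indicator of a class is an invariant functional that reads off a coefficient; conversely
    [ev_coef0] applies to the difference of the two chains. This links [aeq] with the equality of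
    coefficients used in [chain_eq]. *)
Lemma coef_aeq (X : sset) (A : zmodType) (c d : seq (X * A)) :
  on_terms sv c -> on_terms sv d ->
  (forall x, sv x -> coef c x = coef d x) <-> aeq c d.
Proof.
move=> vc vd; split=> [cd M f fD fi|cd x vx]; last first.
  rewrite !coef_ev; apply: cd => [y a b /=|]; last exact: inv_indic.
  by case: ifP => // _; rewrite addr0.
apply/eqP; rewrite -subr_eq0 -ev_opp // -ev_cat; apply/eqP.
apply: (@ev_coef0 _ _ _ sv se) => //; [exact: se_refl|exact: se_sym|exact: se_trans|by move=> x y a; exact: fi| |].
  by apply/on_terms_cat; split=> //; exact: on_terms_chopp.
move=> x vx; rewrite -/(coef _ x) coef_ev ev_cat ev_opp; last first.
  by move=> y a b /=; case: ifP => // _; rewrite addr0.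
by rewrite -!coef_ev cd // subrr.
Qed.

Record bcx := Bcx {
  bc :> nat -> sset;
  bd : forall n, bc n.+1 -> seq (bc n * int);
  bd_good : forall n, goodop (@bd n);
  bd_bd : forall n (x : bc n.+2), sv x -> zeq (zmap (@bd n) (bd x)) [::] }.
Arguments bd {b n} _.

Definition zcycle (Z : bcx) n : seq (Z n * int) -> Prop :=
  match n with 0 => fun _ => True | m.+1 => fun c => zeq (zmap bd c) [::] end.

(** Degree 0 is included, and there every chain counts as a cycle: all homology of the cone has to
    vanish. *)
Definition acyclic (Z : bcx) : Prop :=
  forall n (c : seq (Z n * int)), on_terms sv c -> zcycle c ->
    exists b : seq (Z n.+1 * int), on_terms sv b /\ zeq c (zmap bd b).

(* The operator is chosen on a representative of each class, hence is invariant. *)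
Lemma goodop_choice (X Y : sset) (Q : X -> seq (Y * int) -> Prop) :
  (forall x, sv x -> exists c, on_terms sv c /\ Q x c) ->
  (forall x y c, sv x -> sv y -> se x y -> Q x c -> Q y c) ->
  exists L : X -> seq (Y * int), goodop L /\ forall x, sv x -> Q x (L x).
Proof.
move=> hex hinv.
pose rp (x : X) := ClassicalEpsilon.epsilon (inhabits x) (fun y => se x y /\ sv y).
have rpP x : sv x -> se x (rp x) /\ sv (rp x).
  move=> vx; apply: (ClassicalEpsilon.epsilon_spec (inhabits x) (fun y => se x y /\ sv y)).
  by exists x; split=> //; exact: se_refl.
have rpE x y : se x y -> rp x = rp y.
  move=> xy; rewrite /rp (ProofIrrelevance.proof_irrelevance _ (inhabits x) (inhabits y)); congr ClassicalEpsilon.epsilon.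
  apply/funext => z; apply/propext; split=> -[h vz]; split=> //; apply: se_trans h => //.
  exact: se_sym.
pose L (x : X) := ClassicalEpsilon.epsilon (inhabits [::]) (fun c => on_terms sv c /\ Q (rp x) c).
have LP x : sv x -> on_terms sv (L x) /\ Q (rp x) (L x).
  move=> /rpP[_ vx].
  apply: (ClassicalEpsilon.epsilon_spec (inhabits [::]) (fun c => on_terms sv c /\ Q (rp x) c)).
  exact: hex.
exists L; split; first split.
- by move=> x /LP[].
- by move=> x y _ _ xy; rewrite /L (rpE _ _ xy).
- move=> x vx; have [h1 h2] := rpP _ vx; have [_ h3] := LP _ vx.
  by apply: hinv h3 => //; exact: se_sym.
Qed.

(** * Contracting homotopies of acyclic complexes, and coefficients *)

Section Contraction.
Variable Z : bcx.
Hypothesis Zac : acyclic Z.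

(** The invariant of the induction on the degree: [s] inverts the boundary on cycles. The homotopy
    identity one degree higher uses just this about [s]. *)
Let contr n (s : Z n -> seq (Z n.+1 * int)) : Prop :=
  goodop s /\ forall c, on_terms sv c -> zcycle c -> zeq (zmap bd (zmap s c)) c.

Let contr0 : exists s : Z 0 -> seq (Z 1 * int), contr s /\
  forall x, sv x -> zeq (zmap bd (s x)) [:: (x, 1)].
Proof.
have [||s [gs sP]] := @goodop_choice (Z 0) (Z 1) (fun x c => zeq (zmap bd c) [:: (x, 1)]).
- move=> x vx; have [|//|b [vb hb]] := Zac (c := [:: (x, 1)]); first by split.
  by exists b; split=> // M g gi; rewrite (hb _ g gi).
- by move=> x y c vx vy xy h M g gi; rewrite (h _ g gi) !ez1; exact: gi.
exists s; split=> //; split=> // c vc _ M g gi.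
rewrite !ez_zmap; apply: ez_call vc _ => x vx.
by rewrite -ez_zmap (sP _ vx _ g gi) ez1.
Qed.

(** Since [bd x] is a cycle, [bd (s (bd x)) = bd x]; hence [x - s (bd x)] is a cycle, and [s' x] is
    chosen among the chains that it bounds. *)
Let contrS n (s : Z n -> seq (Z n.+1 * int)) : contr s ->
  exists s' : Z n.+1 -> seq (Z n.+2 * int), contr s' /\
  forall x, sv x -> zeq (zmap bd (s' x) ++ zmap s (bd x)) [:: (x, 1)].
Proof.
move=> [gs sP].
have [||s' [gs' s'P]] := @goodop_choice (Z n.+1) (Z n.+2)
  (fun x c => zeq (zmap bd c ++ zmap s (bd x)) [:: (x, 1)]).
- move=> x vx.
  have vb : on_terms sv (bd x) by exact: (bd_good Z n).1.
  have cb : zcycle (bd x) by case: (n) x vx {vb} => [//|m] x vx; exact: bd_bd.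
  have vs : on_terms sv (zmap s (bd x)) by exact: on_terms_zmap vb gs.1.
  have [||b [vb' hb]] := Zac (c := [:: (x, 1)] ++ zopp (zmap s (bd x))).
  + by apply/on_terms_cat; split; [split|exact: on_terms_zopp].
  + move=> M g gi; rewrite ez_zmap ez_cat ez1 ez_opp -ez_zmap (sP _ vb cb _ g gi).
    by rewrite subrr ez_nil.
  exists b; split=> // M g gi; rewrite ez_cat -(hb _ g gi) ez_cat ez_opp.
  by rewrite subrK.
- move=> x y c vx vy xy h M g gi; move: (h _ g gi).
  rewrite !ez_cat !ez1 (gi _ _ vx vy xy) => <-; congr (_ + _).
  rewrite !ez_zmap; symmetry; apply: (bd_good Z n).2 => //; exact: goodop_inv.
exists s'; split=> //; split=> // c vc cc M g gi.
(* On a cycle the term [s (bd c)] vanishes, so [s'] again inverts the boundary there. *)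
have := zeq_zmap gs cc gi; rewrite ez_nil => h0.
rewrite -[LHS]addr0 -h0 !ez_zmap -ez_add.
apply: ez_call vc _ => x vx; move: (s'P _ vx _ g gi).
by rewrite ez_cat ez1 !ez_zmap => <-.
Qed.

Let contr_ex n : exists s : Z n -> seq (Z n.+1 * int), contr s.
Proof.
by elim: n => [|n [s /contrS[s' [? _]]]]; [have [s []] := contr0; exists s|exists s'].
Qed.

Lemma contraction0 : exists s : Z 0 -> seq (Z 1 * int),
  goodop s /\ forall x, sv x -> zeq (zmap bd (s x)) [:: (x, 1)].
Proof. by have [s [[]]] := contr0; exists s. Qed.

Lemma contractionS n : exists (s : Z n -> seq (Z n.+1 * int))
    (s' : Z n.+1 -> seq (Z n.+2 * int)), goodop s /\ goodop s' /\
  forall x, sv x -> zeq (zmap bd (s' x) ++ zmap s (bd x)) [:: (x, 1)].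
Proof.
have [s cs] := contr_ex n; have [s' [cs' h]] := contrS cs.
by exists s, s'; split; [case: cs|split=> //; case: cs'].
Qed.

Definition acycle (A : zmodType) n : seq (Z n * A) -> Prop :=
  match n with 0 => fun _ => True | m.+1 => fun c => aeq (amap bd c) [::] end.

(** The identity [bd s' + s bd = 1] has integer coefficients and so survives tensoring with [A]; on
    a cycle its second term vanishes, which leaves [c = bd (s' c)]. *)
Lemma acyclic_coef (A : zmodType) n (c : seq (Z n * A)) : on_terms sv c -> acycle c ->
  exists b : seq (Z n.+1 * A), on_terms sv b /\ aeq c (amap bd b).
Proof.
case: n c => [|n] c vc; [have [s [gs sP]] := contraction0 => _|
  have [s [s' [gs [gs' sP]]]] := contractionS n => cc].
  exists (amap s c); split; first exact: on_terms_amap vc gs.1.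
  move=> M f fD fi; rewrite !ev_amap //=; last first.
    move=> y a b; rewrite -ez_add; apply: ez_ext => z; exact: fD.
  apply: ev_call vc _ => x a vx.
  by rewrite -ez_zmap (sP _ vx _ _ (fi a)) ez1.
exists (amap s' c); split; first exact: on_terms_amap vc gs'.1.
move=> M f fD fi.
have fD' (m p : nat) (t : Z m -> seq (Z p * int)) (f' : Z p -> A -> M) :
    (forall x, {morph f' x : a b / a + b}) ->
    forall x, {morph (fun a => ez (f'^~ a) (t x)) : a b / a + b}.
  by move=> f'D x a b; rewrite -ez_add; apply: ez_ext => z; exact: f'D.
(* The cycle condition is tested on the functional [f] pulled back along [s]. *)
have /= := cc _ (fun x a => ez (f^~ a) (s x)) (fD' _ _ s _ fD) (fun a => goodop_inv gs (fi a)).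
rewrite ev_nil ev_amap; last exact: fD'.
move=> h0.
rewrite !ev_amap //; last exact: fD'.
rewrite -[RHS]addr0 -h0 -ev_add; apply: ev_call vc _ => x a vx.
by move: (sP _ vx _ _ (fi a)); rewrite ez_cat ez1 !ez_zmap => <-.
Qed.

Lemma acyclic_cochain0 (A : zmodType) (f : Z 0 -> A) : einv f ->
  (forall x : Z 1, sv x -> ez f (bd x) = 0) -> forall x, sv x -> f x = 0.
Proof.
move=> fi fc x vx; have [s [gs sP]] := contraction0.
rewrite -(ez1 f) -(sP _ vx _ _ fi) ez_zmap.
by rewrite (ez_call (gs.1 x vx) fc) ez_zero.
Qed.

(** A cocycle kills [bd (s' x)], so the homotopy identity leaves [f x = f (s (bd x))]: the primitive
    is the transpose of [s] applied to [f]. *)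
Lemma acyclic_cochainS (A : zmodType) n (f : Z n.+1 -> A) : einv f ->
  (forall x : Z n.+2, sv x -> ez f (bd x) = 0) ->
  exists k : Z n -> A, einv k /\ forall x, sv x -> f x = ez k (bd x).
Proof.
move=> fi fc; have [s [s' [gs [gs' sP]]]] := contractionS n.
exists (fun x => ez f (s x)); split; first exact: goodop_inv.
move=> x vx; rewrite -(ez1 f) -(sP _ vx _ _ fi) ez_cat !ez_zmap.
by rewrite (ez_call (gs'.1 x vx) fc) ez_zero add0r.
Qed.

End Contraction.

(** * Mapping cones *)

Definition lefts (X Y B : Type) (c : seq ((X + Y) * B)) : seq (X * B) :=
  pmap (fun p => if p.1 is inl x then Some (x, p.2) else None) c.

Definition rights (X Y B : Type) (c : seq ((X + Y) * B)) : seq (Y * B) :=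
  pmap (fun p => if p.1 is inr y then Some (y, p.2) else None) c.

Lemma ev_sum (X Y : Type) (A M : zmodType) (f : X + Y -> A -> M) (c : seq ((X + Y) * A)) :
  ev f c = ev (f \o inl) (lefts c) + ev (f \o inr) (rights c).
Proof.
elim: c => [|[[x|y] a] c IH]; first by rewrite !ev_nil addr0.
  by rewrite /= !ev_cons /= IH addrA.
by rewrite /= !ev_cons /= IH addrCA.
Qed.

Lemma on_terms_lefts (X Y B : Type) (P : X + Y -> Prop) (c : seq ((X + Y) * B)) :
  on_terms P c -> on_terms (P \o inl) (lefts c).
Proof. by elim: c => [|[[x|y] a] c IH] //= [? /IH]. Qed.

Lemma on_terms_rights (X Y B : Type) (P : X + Y -> Prop) (c : seq ((X + Y) * B)) :
  on_terms P c -> on_terms (P \o inr) (rights c).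
Proof. by elim: c => [|[[x|y] a] c IH] //= [? /IH]. Qed.

Definition void_sset : sset.
Proof. by refine (@SSet Empty_set (fun _ => True) (fun _ _ => True) _ _ _). Defined.

Definition sum_sset (X Y : sset) : sset.
Proof.
refine (@SSet (X + Y)%type (fun z => match z with inl x => sv x | inr y => sv y end)
  (fun z w => match z, w with
     | inl x, inl x' => se x x' | inr y, inr y' => se y y' | _, _ => False end) _ _ _).
- by case=> ?; exact: se_refl.
- by case=> ? [] ? //; exact: se_sym.
- by case=> ? [] ? [] ? //; exact: se_trans.
Defined.

Lemma inv_sum (X Y : sset) (T : Type) (g : sum_sset X Y -> T) :
  einv g <-> einv (g \o inl) /\ einv (g \o inr).
Proof.
split=> [gi|[gl gr] [x|y] [x'|y'] //=]; [|exact: gl|exact: gr].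
by split=> x y vx vy xy; exact: gi.
Qed.

(** The generators in degree [n - 1], none in degree -1. With [dsh], the boundary into them, cycle
    conditions and homotopy formulas are written uniformly in [n]. *)
Definition shiftc (X : bcx) n : sset := match n with 0 => void_sset | m.+1 => X m end.

Definition dsh (X : bcx) n : X n -> seq (shiftc X n * int) :=
  match n with 0 => fun _ => [::] | m.+1 => @bd X m end.

Lemma dsh_good (X : bcx) n : goodop (@dsh X n).
Proof. by case: n => [|n]; [split|exact: bd_good]. Qed.

Lemma dsh_bd (X : bcx) n (x : X n.+1) : sv x -> zeq (zmap (@dsh X n) (bd x)) [::].
Proof.
case: n x => [|n] x vx; last exact: bd_bd.
move=> M g gi; rewrite ez_zmap ez_nil -[RHS](ez_zero (bd x)).
by apply: ez_ext => y; rewrite ?ez_nil.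
Qed.

Record bmorph (X Y : bcx) := Bmorph {
  bm :> forall n, X n -> Y n;
  bm_sv : forall n (x : X n), sv x -> sv (bm x);
  bm_se : forall n (x x' : X n), sv x -> sv x' -> se x x' -> se (bm x) (bm x');
  bm_bd : forall n (x : X n.+1), sv x -> zeq (bmapc (@bm n) (bd x)) (bd (bm x)) }.

Section Cone.
Variables (X Y : bcx) (phi : bmorph X Y).

(** The usual sign convention [d (x, y) = (- d x, phi x + d y)], with [x] one degree below [y]. *)
Definition cone_bd n (z : sum_sset (shiftc X n.+1) (Y n.+1)) :
    seq (sum_sset (shiftc X n) (Y n) * int) :=
  match z with
  | inl x => bmapc inl (zopp (@dsh X n x)) ++ [:: (inr (phi n x), 1)]
  | inr y => bmapc inr (bd y)
  end.

Lemma ez_cone_inl n (M : zmodType) (g : sum_sset (shiftc X n) (Y n) -> M) (x : X n) :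
  ez g (cone_bd (inl x)) = g (inr (phi n x)) - ez (g \o inl) (dsh x).
Proof. by rewrite ez_cat ez_map ez_opp ez1 addrC. Qed.

Lemma ez_cone_inr n (M : zmodType) (g : sum_sset (shiftc X n) (Y n) -> M) (y : Y n.+1) :
  ez g (cone_bd (inr y)) = ez (g \o inr) (bd y).
Proof. exact: ez_map. Qed.

Lemma cone_bd_good n : goodop (@cone_bd n).
Proof.
split.
  case=> [x|y] v.
    apply/on_terms_cat; split; last by split=> //=; exact: (@bm_sv _ _ phi).
    by apply: on_terms_bmapc; apply: on_terms_zopp; exact: (dsh_good X n).1.
  by apply: on_terms_bmapc; exact: (bd_good Y n).1.
case=> [x|y] [x'|y'] // v v' e M g /inv_sum[gl gr].
  rewrite !ez_cone_inl (goodop_inv (dsh_good X n) gl v v' e); congr (_ - _).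
  by apply: gr => //; [exact: (@bm_sv _ _ phi)|exact: (@bm_sv _ _ phi)|exact: (@bm_se _ _ phi)].
by rewrite !ez_cone_inr (goodop_inv (bd_good Y n) gr v v' e).
Qed.

Lemma cone_bd_bd n (z : sum_sset (shiftc X n.+2) (Y n.+2)) : sv z ->
  zeq (zmap (@cone_bd n) (cone_bd z)) [::].
Proof.
case: z => [x|y] v M g /inv_sum[gl gr]; rewrite ez_nil ez_zmap.
  rewrite ez_cone_inl ez_cone_inr.
  rewrite (ez_ext (g' := fun x => g (inr (phi n x)) - ez (g \o inl) (dsh x))) /=; last first.
    by move=> x'; exact: ez_cone_inl.
  rewrite ez_add ez_neg -[ez (fun x => ez (g \o inl) _) _]ez_zmap.
  rewrite (dsh_bd v gl) ez_nil subr0.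
  by rewrite -(@bm_bd _ _ phi n x v M _ gr) ez_map subrr.
rewrite ez_cone_inr; transitivity (ez (g \o inr) (zmap bd (bd y))).
  by rewrite ez_zmap; apply: ez_ext => y'; exact: ez_cone_inr.
by rewrite (bd_bd v gr) ez_nil.
Qed.

Definition cone : bcx :=
  @Bcx (fun n => sum_sset (shiftc X n) (Y n)) cone_bd cone_bd_good cone_bd_bd.

Definition abdry (Z : bcx) (A : zmodType) n (c : seq (Z n * A)) : Prop :=
  exists b : seq (Z n.+1 * A), on_terms sv b /\ aeq c (amap bd b).

Definition coboundary (Z : bcx) (A : zmodType) n : (Z n -> A) -> Prop :=
  match n with
  | 0 => fun f => forall x, sv x -> f x = 0
  | m.+1 => fun f => exists g : Z m -> A, einv g /\ forall x, sv x -> f x = ez g (bd x)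
  end.

Hypothesis ac : acyclic cone.
Variable A : zmodType.

(** Functionals on the cone that are zero on one summand split an identity in the cone into its two
    components. *)
Let sumf n (M : zmodType) (fl : shiftc X n -> A -> M) (fr : Y n -> A -> M)
  (z : cone n) (a : A) : M := match z with inl x => fl x a | inr y => fr y a end.

Let sumf_inv n (M : zmodType) (fl : shiftc X n -> A -> M) (fr : Y n -> A -> M) a :
  einv (fl^~ a) -> einv (fr^~ a) -> einv ((sumf fl fr)^~ a).
Proof. by move=> il ir; apply/inv_sum. Qed.

Let sumf_add n (M : zmodType) (fl : shiftc X n -> A -> M) (fr : Y n -> A -> M) :
  (forall x, {morph fl x : a b / a + b}) -> (forall x, {morph fr x : a b / a + b}) ->
  forall z, {morph (sumf fl fr) z : a b / a + b}.
Proof. by move=> dl dr [x|y] a b; [exact: dl|exact: dr]. Qed.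

Let ez_add_op (Z W : Type) (M : zmodType) (L : Z -> seq (W * int)) (f : W -> A -> M) :
  (forall x, {morph f x : a b / a + b}) ->
  forall z, {morph (fun a => ez (f^~ a) (L z)) : a b / a + b}.
Proof. by move=> fD z a b; rewrite -ez_add; apply: ez_ext => w; exact: fD. Qed.

Let ev_cone n (M : zmodType) (f : cone n -> A -> M) (b : seq (cone n.+1 * A)) :
  (forall x, {morph f x : a b / a + b}) ->
  ev f (amap bd b) = ev (f \o inr) (bmapc (phi n) (lefts b))
    - ev (f \o inl) (amap (@dsh X n) (lefts b)) + ev (f \o inr) (amap bd (rights b)).
Proof.
move=> fD; rewrite !ev_amap //; try by move=> y; exact: fD.
rewrite ev_sum ev_map; congr (_ + _).
  rewrite -ev_neg -ev_add; apply: ev_ext => x a; exact: ez_cone_inl.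
by apply: ev_ext => y a; exact: ez_cone_inr.
Qed.

Lemma acycleE (Z : bcx) n (c : seq (Z n * A)) :
  acycle c <-> aeq (amap (@dsh Z n) c) [::].
Proof.
case: n c => [|n] c //; split=> // _ M f fD fi.
by rewrite ev_amap // ev_nil -[RHS](ev_zero c); apply: ev_ext => x a; rewrite ez_nil.
Qed.

(** The pair [(0, z)] is a cycle of the cone, hence the boundary of some [(w, y)]. Its components
    read [d w = 0] and [z = phi w + d y], so that [phi w - z] is the boundary of [- y]. *)
Lemma cone_homology_surj n (z : seq (Y n * A)) : on_terms sv z -> acycle z ->
  exists w : seq (X n * A), on_terms sv w /\ acycle w /\ abdry (bmapc (phi n) w ++ chopp z).
Proof.
move=> vz cz; have [||b [vb hb]] := acyclic_coef ac (c := bmapc inr z : seq (cone n * A)).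
- exact: on_terms_bmapc.
- case: n z vz cz => [|n] z vz cz // M f fD fi.
  have [fl fr] : (forall a, einv ((f \o inl)^~ a)) /\ (forall a, einv ((f \o inr)^~ a)).
    by split=> a; have /inv_sum[] := fi a.
  have := cz _ (f \o inr) (fun x => fD _) fr; rewrite !ev_nil => <-.
  rewrite ev_amap // ev_amap; last by move=> y; exact: fD.
  rewrite ev_map; apply: ev_ext => y a; exact: ez_cone_inr.
exists (lefts b); split; first exact: on_terms_lefts vb.
have hb' M fl fr := hb M (sumf fl fr).
split.
  apply/acycleE => M f fD fi.
  have := hb' _ f (fun _ _ => 0) (sumf_add fD _) (fun a => sumf_inv (fi a) _).
  rewrite ev_cone; last by apply: sumf_add => // y a a'; rewrite addr0.
  rewrite !ev_map !ev_zero addr0 sub0r ev_nil => h.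
  by apply/eqP; rewrite -oppr_eq0 -h //; move=> y a a'; rewrite addr0.
exists (chopp (rights b)); split; first by apply: on_terms_chopp; exact: on_terms_rights vb.
move=> M f fD fi.
have := hb' _ (fun _ _ => 0) f (sumf_add _ fD) (fun a => sumf_inv _ (fi a)).
rewrite ev_cone; last by apply: sumf_add => // y a a'; rewrite addr0.
rewrite [ev _ (bmapc inr z)]ev_map ev_cat ev_opp // => -> //; last by move=> y a a'; rewrite addr0.
rewrite [ev (_ \o inl) _]ev_zero subr0 opprD addNKr [in RHS]ev_amap // ev_opp; last exact: ez_add_op.
by rewrite [ev (_ \o inr) (amap _ _)]ev_amap.
Qed.

(** If [phi w = d b], then [(w, - b)] is a cycle of the cone; the first component of a chain that it
    bounds gives, up to sign, a chain with boundary [w]. *)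
Lemma cone_homology_inj n (w : seq (X n * A)) : on_terms sv w -> acycle w ->
  abdry (bmapc (phi n) w) -> abdry w.
Proof.
move=> vw /acycleE cw [b [vb hb]].
have [||d [vd hd]] := acyclic_coef ac
  (c := bmapc inl w ++ chopp (bmapc inr b) : seq (cone n.+1 * A)).
- apply/on_terms_cat; split; first exact: on_terms_bmapc.
  by apply: on_terms_chopp; exact: on_terms_bmapc.
- move=> M f fD fi; rewrite ev_amap // ev_cat ev_opp; last exact: ez_add_op.
  have [fl fr] : (forall a, einv ((f \o inl)^~ a)) /\ (forall a, einv ((f \o inr)^~ a)).
    by split=> a; have /inv_sum[] := fi a.
  rewrite !ev_map ev_nil.
  rewrite (ev_ext (f' := fun x a => f (inr (phi n x)) a + - ez ((f \o inl)^~ a) (dsh x))); last first.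
    by move=> x a; exact: ez_cone_inl.
  rewrite ev_add ev_neg.
  have := cw _ (f \o inl) (fun x => fD _) fl; rewrite ev_amap; last by move=> x; exact: fD.
  rewrite ev_nil => ->; rewrite subr0; apply/eqP; rewrite subr_eq0; apply/eqP.
  have := hb _ (f \o inr) (fun x => fD _) fr; rewrite ev_map => ->.
  rewrite ev_amap; last by move=> x; exact: fD.
  by apply: ev_ext => y a; rewrite [RHS]ez_cone_inr.
exists (chopp (lefts d)); split; first by apply: on_terms_chopp; exact: on_terms_lefts vd.
move=> M f fD fi.
have := hd _ (@sumf n.+1 M f (fun _ _ => 0)) (@sumf_add n.+1 M f _ fD _) (fun a => @sumf_inv n.+1 M f _ a (fi a) _).
rewrite ev_cone; last by apply: sumf_add => // y a a'; rewrite addr0.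
rewrite ev_cat !ev_map ev_opp; last by apply: sumf_add => // y a a'; rewrite addr0.
rewrite !ev_map !ev_zero subr0 addr0 sub0r => -> //; last by move=> y a a'; rewrite addr0.
rewrite [RHS]ev_amap // ev_opp; last exact: ez_add_op.
by rewrite [in LHS]ev_amap.
Qed.

(** The cochain [(f, 0)] is a cocycle of the cone, so it factors through the boundary by some
    [(kl, kr)]. On [Y] this says that [kr] is a cocycle, on [X] that [f = kr phi - kl d]. *)
Lemma cone_cohomology_surj n (f : X n -> A) : einv f ->
  (forall x : X n.+1, sv x -> ez f (bd x) = 0) ->
  exists f' : Y n -> A, einv f' /\ (forall y : Y n.+1, sv y -> ez f' (bd y) = 0) /\
    @coboundary X A n (fun x => f' (phi n x) - f x).
Proof.
move=> fi fc.
pose F (z : cone n.+1) : A := match z with inl x => f x | inr y => 0 end.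
have [||k [/inv_sum[kl kr] kF]] := acyclic_cochainS ac (f := F).
- by apply/inv_sum.
- case=> [x|y] v; last by rewrite ez_cone_inr ez_zero.
  by rewrite ez_cone_inl sub0r fc ?oppr0.
exists (k \o inr); split=> //; split.
  by move=> y vy; rewrite -ez_cone_inr -(kF (inr y)).
have h (x : X n) : sv x -> k (inr (phi n x)) - f x = ez (k \o inl) (dsh x).
  by move=> vx; have /= -> := kF (inl x) vx; rewrite ez_cone_inl opprB addrC subrK.
case: (n) f fi fc F k kl kr kF h => [|m] f fi fc F k kl kr kF h /=.
  by move=> x vx; rewrite h // ez_nil.
by exists (k \o inl).
Qed.

(** If [f phi = g d], then [(g, f)] is a cocycle of the cone, and the [Y] component of a primitive
    of it is a primitive of [f]. In degree 0 the cocycle itself must be zero. *)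
Lemma cone_cohomology_inj n (f : Y n -> A) : einv f ->
  (forall y : Y n.+1, sv y -> ez f (bd y) = 0) ->
  coboundary (f \o phi n) -> coboundary f.
Proof.
case: n f => [|n] f fi fc /= fb.
  pose F (z : cone 0) : A := match z with inl x => 0 | inr y => f y end.
  move=> y vy; apply: (acyclic_cochain0 ac (f := F) _ _ (x := inr y)) => //.
    exact/inv_sum.
  case=> [x|y'] v; last by rewrite ez_cone_inr; exact: fc.
  by rewrite ez_cone_inl ez_nil subr0; exact: fb.
have [g [gi gf]] := fb.
pose F (z : cone n.+1) : A := match z with inl x => g x | inr y => f y end.
have [||k [/inv_sum[kl kr] kF]] := acyclic_cochainS ac (f := F).
- exact/inv_sum.
- case=> [x|y'] v; last by rewrite ez_cone_inr; exact: fc.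
  by rewrite ez_cone_inl -gf // subrr.
exists (k \o inr); split=> // y vy.
by rewrite -ez_cone_inr -(kF (inr y)).
Qed.

End Cone.

(** * Acyclicity from subdivision *)

Definition shop (X : bcx) (T : forall n, X n -> seq (X n.+1 * int)) n :
    shiftc X n -> seq (X n * int) :=
  match n with 0 => fun _ => [::] | m.+1 => T m end.

(* That [S] is a chain map follows from [sd_hom]: see [sd_chain]. *)
Record subdivision (X : bcx) := Subdivision {
  sdS : forall n, X n -> seq (X n * int);
  sdT : forall n, X n -> seq (X n.+1 * int);
  sdS_good : forall n, goodop (@sdS n);
  sdT_good : forall n, goodop (@sdT n);
  sd_hom : forall n (x : X n), sv x ->
    zeq (zmap bd (sdT x) ++ zmap (@shop X sdT n) (dsh x) ++ sdS x) [:: (x, 1)] }.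
Arguments sdS {X} s {n} _.
Arguments sdT {X} s {n} _.

Section Subdivision.
Variables (X : bcx) (S : subdivision X).

Lemma shop_good n : goodop (@shop X (@sdT X S) n).
Proof. by case: n => [|n]; [split|exact: sdT_good]. Qed.

Lemma sd_homc n (c : seq (X n * int)) (M : zmodType) (g : X n -> M) :
  on_terms sv c -> einv g ->
  ez g c = ez g (zmap bd (zmap (sdT S) c)) +
           ez g (zmap (@shop X (@sdT X S) n) (zmap (@dsh X n) c)) + ez g (zmap (sdS S) c).
Proof.
move=> vc gi; rewrite !ez_zmap -!ez_add; apply: ez_call vc _ => x vx.
by have := sd_hom S vx gi; rewrite !ez_cat !ez_zmap ez1 addrA => ->.
Qed.

Lemma zeq_shop n (c : seq (shiftc X n * int)) :
  zeq c [::] -> zeq (zmap (@shop X (@sdT X S) n) c) [::].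
Proof. by move=> /(zeq_zmap (@shop_good n)). Qed.

Lemma zeq_dsh_bd n (c : seq (X n.+1 * int)) : on_terms sv c -> zeq (zmap (@dsh X n) (zmap bd c)) [::].
Proof.
move=> vc M g gi; rewrite ez_zmap ez_zmap ez_nil -(ez_zero c); apply: ez_call vc _ => x vx.
by have := dsh_bd vx gi; rewrite ez_zmap ez_nil.
Qed.

Lemma sd_cycle n (c : seq (X n * int)) (M : zmodType) (g : X n -> M) :
  on_terms sv c -> einv g -> zeq (zmap (@dsh X n) c) [::] ->
  ez g c = ez g (zmap bd (zmap (sdT S) c)) + ez g (zmap (sdS S) c).
Proof.
by move=> vc gi cc; rewrite [LHS](sd_homc vc gi) (zeq_shop cc gi) ez_nil addr0.
Qed.

(** Taking the boundary of the homotopy formula for [c] gives [d c = d T d c + d S c]; the formula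
    for the cycle [d c] gives [d c = d T d c + S d c]. *)
Lemma sd_chain n (c : seq (X n.+1 * int)) : on_terms sv c ->
  zeq (zmap bd (zmap (sdS S) c)) (zmap (sdS S) (zmap bd c)).
Proof.
move=> vc M g gi.
have vb : on_terms sv (zmap bd c) by apply: on_terms_zmap vc _; exact: (bd_good X n).1.
have := sd_homc vc (goodop_inv (bd_good X n) gi); rewrite -!ez_zmap.
rewrite (sd_cycle vb gi (zeq_dsh_bd vc)).
suff -> : ez g (zmap bd (zmap bd (zmap (sdT S) c))) = 0 by rewrite add0r => /addrI ->.
have vt : on_terms sv (zmap (sdT S) c) by apply: on_terms_zmap vc _; exact: (sdT_good S n.+1).1.
rewrite ez_zmap ez_zmap -(ez_zero (zmap (sdT S) c)); apply: ez_call vt _ => y vy.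
by have := bd_bd vy gi; rewrite ez_zmap ez_nil.
Qed.

Lemma sdS_cycle n (c : seq (X n * int)) : on_terms sv c ->
  zeq (zmap (@dsh X n) c) [::] -> zeq (zmap (@dsh X n) (zmap (sdS S) c)) [::].
Proof.
case: n c => [|n] c vc cc M g gi; last first.
  by rewrite [LHS](sd_chain vc gi) (zeq_zmap (sdS_good S n) cc gi).
rewrite ez_zmap ez_nil -[RHS](ez_zero (zmap (sdS S) c)).
by apply: ez_ext => x; rewrite ?ez_nil.
Qed.

End Subdivision.

Section Acyclic.
Variables (X Y : bcx) (phi : bmorph X Y).
(** [SX k] stands for [k]-fold subdivision, and [tX], [tY] for having a global section. In the
    hypotheses below every threshold [k0] may depend on the simplex. *)
Variables (SX : nat -> subdivision X) (SY : nat -> subdivision Y).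
Variables (tX : forall n, X n -> Prop) (tY : forall n, Y n -> Prop).
Hypothesis S_phi : forall k n (x : X n), sv x ->
  zeq (bmapc (phi n) (sdS (SX k) x)) (sdS (SY k) (phi n x)).
Hypothesis T_phi : forall k n (x : X n), sv x ->
  zeq (bmapc (phi n.+1) (sdT (SX k) x)) (sdT (SY k) (phi n x)).
Hypothesis tX_small : forall n (x : X n), sv x ->
  exists k0, forall k, (k0 <= k)%N -> on_terms (@tX n) (sdS (SX k) x).
Hypothesis tY_small : forall n (y : Y n), sv y ->
  exists k0, forall k, (k0 <= k)%N -> on_terms (@tY n) (sdS (SY k) y).
Hypothesis tX_bd : forall n (x : X n.+1), sv x -> tX x -> on_terms (@tX n) (bd x).
Hypothesis t_lift : forall n (y : Y n), sv y -> tY y ->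
  exists x : X n, sv x /\ tX x /\ se (phi n x) y.
Hypothesis t_inj : forall n (x x' : X n), sv x -> sv x' -> tX x -> tX x' ->
  se (phi n x) (phi n x') ->
  exists k0, forall k, (k0 <= k)%N -> zeq (sdS (SX k) x) (sdS (SX k) x').

Let lift_chain n (d : seq (Y n * int)) : on_terms sv d -> on_terms (@tY n) d ->
  exists c : seq (X n * int), on_terms sv c /\ on_terms (@tX n) c /\ zeq (bmapc (phi n) c) d.
Proof.
elim: d => [|[y m] d IH] /=; first by exists [::].
move=> [vy vd] [ty td]; have [c [vc [tc hc]]] := IH vd td.
have [x [vx [tx xy]]] := t_lift vy ty.
exists ((x, m) :: c); split; [by split|split; first by split].
move=> M g gi; rewrite /= !ez_cons /= (hc _ _ gi) (gi _ _ _ _ xy) //.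
exact: (@bm_sv _ _ phi).
Qed.

(* Grouping the terms of [c] by the class of their image, only finitely many
   pairs with equal images occur, so one [k] identifies all of them. *)
Let kill n (c : seq (X n * int)) : on_terms sv c -> on_terms (@tX n) c ->
  zeq (bmapc (phi n) c) [::] -> exists k, zeq (zmap (sdS (SX k)) c) [::].
Proof.
move=> vc tc hc.
have [k hk] : exists k, forall p q, List.In p c -> List.In q c ->
    se (phi n p.1) (phi n q.1) -> zeq (sdS (SX k) p.1) (sdS (SX k) q.1).
  pose Q k p q := se (phi n p) (phi n q) -> zeq (sdS (SX k) p) (sdS (SX k) q).
  have [|k0 hk0] := @on_terms_eventually _ _ (fun k p => on_terms (Q k p) c) c.
    apply/on_terms_In => p pc.
    have [|k hk] := @on_terms_eventually _ _ (fun k q => Q k p.1 q) c.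
      apply/on_terms_In => q qc.
      have [e|ne] := asboolP (se (phi n p.1) (phi n q.1)); last by exists 0%N => k _ /ne.
      have [||||k0 hk] := @t_inj n p.1 q.1 _ _ _ _ e.
      - by move/on_terms_In: vc; apply.
      - by move/on_terms_In: vc; apply.
      - by move/on_terms_In: tc; apply.
      - by move/on_terms_In: tc; apply.
      by exists k0 => k /hk h _.
    by exists k.
  exists k0 => p q pc qc.
  have /on_terms_In/(_ p pc)/on_terms_In/(_ q qc) := hk0 k0 (leqnn _).
  exact.
exists k => M g gi; rewrite ez_zmap ez_nil.
pose V x := exists2 p, List.In p c & x = p.1.
apply: (@ev_coef0 _ _ _ V (fun x x' => se (phi n x) (phi n x'))).
- by move=> x; exact: se_refl.
- by move=> x y; exact: se_sym.
- by move=> x y z; exact: se_trans.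
- by move=> x a b; rewrite mulrzDr.
- by move=> _ _ a [p pc ->] [q qc ->] e; rewrite (hk p q pc qc e _ _ gi).
- by apply/on_terms_In => p pc; exists p.
- move=> _ [p pc ->].
  have := hc _ _ (inv_indic (A := int) (phi n p.1) 1).
  rewrite ez_nil ez_map => h; rewrite -[RHS]h big_mkcond; apply: eq_bigr => q _ /=.
  by case: ifP => _; rewrite ?mul0rz // intz.
Qed.

(** Let [(cx, cy)] be a cycle of the cone. Choose [k] such that the [k]-fold subdivisions [S cx] and
    [S cy] have only terms in [tX] and [tY], and lift [S cy] to [u]. Then [v = S cx + d u] is a
    cycle with terms in [tX], and [phi v = S (phi cx + d cy) = 0], so some further subdivision kills
    [v] and its homotopy [T'] gives [v = d T' v]. With [T] the homotopy for [k], the cycle is the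
    boundary of [(u - T' v - T cx, T cy)]. *)
Theorem cone_acyclic : acyclic (cone phi).
Proof.
have vS (Z : bcx) (S : subdivision Z) n (c : seq (Z n * int)) : on_terms sv c -> on_terms sv (zmap (sdS S) c).
  by move=> vc; apply: on_terms_zmap vc _; exact: (sdS_good S n).1.
have vT (Z : bcx) (S : subdivision Z) n (c : seq (Z n * int)) : on_terms sv c -> on_terms sv (zmap (sdT S) c).
  by move=> vc; apply: on_terms_zmap vc _; exact: (sdT_good S n).1.
have smallY n (d : seq (Y n * int)) : on_terms sv d ->
    exists k0, forall k, (k0 <= k)%N -> on_terms (@tY n) (zmap (sdS (SY k)) d).
  move=> vd; have := on_terms_eventually (on_terms_imp (@tY_small n) vd).
  by move=> [k0 hk]; exists k0 => k /hk h; exact: on_terms_zmap h _.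
have smallX n (d : seq (X n * int)) : on_terms sv d ->
    exists k0, forall k, (k0 <= k)%N -> on_terms (@tX n) (zmap (sdS (SX k)) d).
  move=> vd; have := on_terms_eventually (on_terms_imp (@tX_small n) vd).
  by move=> [k0 hk]; exists k0 => k /hk h; exact: on_terms_zmap h _.
case=> [|m] c vc cc; set cy := rights c.
  (* In degree 0 there is no [X] component and nothing to kill: [cy = phi u + d T cy]. *)
  have vy : on_terms sv cy := on_terms_rights vc.
  have [k hk] := smallY _ _ vy.
  have [u [vu [tu hu]]] := lift_chain (vS _ _ _ _ vy) (hk _ (leqnn k)).
  exists (bmapc inl u ++ bmapc inr (zmap (sdT (SY k)) cy)); split.
    by apply/on_terms_cat; split; apply: on_terms_bmapc => //; exact: vT.
  move=> M g /inv_sum[gl gr].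
  have := sd_cycle (SY k) vy gr; rewrite -(hu _ _ gr) => hy.
  rewrite [LHS]ev_sum (_ : lefts c = [::]); last by case: (lefts c) => // -[[]].
  rewrite ev_nil add0r -/(ez (g \o inr) cy) ez_zmap ez_cat !ez_map hy.
    rewrite ez_map addrC; congr (_ + _); last by rewrite ez_zmap; apply: ez_ext => y; rewrite [RHS]ez_cone_inr.
    by apply: ez_ext => x; rewrite [RHS]ez_cone_inl ez_nil subr0.
  by move=> N h _; rewrite ez_zmap ez_nil -[RHS](ez_zero cy); apply: ez_ext => x; rewrite ?ez_nil.
set cx : seq (X m * int) := lefts c.
have vx : on_terms sv cx := on_terms_lefts vc; have vy : on_terms sv cy := on_terms_rights vc.
have cyc1 : zeq (zmap (@dsh X m) cx) [::].
  move=> M g gi.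
  pose f (z : cone phi m) : M := match z with inl x => g x | inr y => 0 end.
  have fi : einv f by apply/inv_sum.
  have := cc _ f fi; rewrite ez_zmap [LHS]ev_sum -/(ez _ cx) -/(ez _ cy) !ez_nil.
  rewrite (@ez_ext _ _ _ (fun x => - ez g (dsh x)) cx); last first.
    by move=> x; rewrite [LHS]ez_cone_inl sub0r.
  rewrite (@ez_ext _ _ _ (fun=> 0) cy); last by move=> y; rewrite [LHS]ez_cone_inr ez_zero.
  by rewrite ez_neg ez_zero addr0 ez_zmap => /eqP; rewrite oppr_eq0 => /eqP.
have cyc2 (M : zmodType) (g : Y m -> M) : einv g ->
    ez g (bmapc (phi m) cx) + ez g (zmap bd cy) = 0.
  move=> gi.
  pose f (z : cone phi m) : M := match z with inl x => 0 | inr y => g y end.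
  have fi : einv f by apply/inv_sum.
  have := cc _ f fi; rewrite ez_zmap [LHS]ev_sum -/(ez _ cx) -/(ez _ cy) !ez_nil.
  rewrite (@ez_ext _ _ _ (g \o phi m) cx); last first.
    by move=> x; rewrite [LHS]ez_cone_inl ez_zero subr0.
  rewrite (@ez_ext _ _ _ (fun y => ez g (bd y)) cy); last by move=> y; rewrite [LHS]ez_cone_inr.
  by rewrite ez_map ez_zmap.
have [k1 hk1] := smallX _ _ vx; have [k2 hk2] := smallY _ _ vy.
pose k := maxn k1 k2.
have tx : on_terms (@tX m) (zmap (sdS (SX k)) cx) by apply: hk1; exact: leq_maxl.
have ty : on_terms (@tY m.+1) (zmap (sdS (SY k)) cy) by apply: hk2; exact: leq_maxr.
have [u [vu [tu hu]]] := lift_chain (vS _ _ _ _ vy) ty.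
pose v := zmap (sdS (SX k)) cx ++ zmap bd u.
have vb (Z : bcx) n (d : seq (Z n.+1 * int)) : on_terms sv d -> on_terms sv (zmap bd d).
  by move=> vd; apply: on_terms_zmap vd _; exact: (bd_good Z n).1.
have vv : on_terms sv v by apply/on_terms_cat; split; [exact: vS|exact: vb].
have tv : on_terms (@tX m) v.
  apply/on_terms_cat; split=> //; apply: on_terms_zmap (on_terms_and vu tu) _ => x [].
  exact: tX_bd.
have zv : zeq (zmap (@dsh X m) v) [::].
  move=> M g gi; rewrite ez_zmap ez_cat -!ez_zmap.
  by rewrite (sdS_cycle (SX k) vx cyc1 gi) (zeq_dsh_bd vu gi) !ez_nil addr0.
have phv : zeq (bmapc (phi m) v) [::].
  move=> M g gi; rewrite ez_map ez_cat ez_nil.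
  have hS : einv (fun y => ez g (sdS (SY k) y)) := goodop_inv (sdS_good _ _) gi.
  rewrite ez_zmap (ez_call (g' := fun x => ez g (sdS (SY k) (phi m x))) vx); last first.
    by move=> x wx; rewrite -(S_phi k wx gi) ez_map.
  rewrite ez_zmap (ez_call (g' := fun x => ez g (bd (phi m.+1 x))) vu); last first.
    by move=> x wx; rewrite -(@bm_bd _ _ phi _ _ wx _ _ gi) ez_map.
  have := hu _ _ (goodop_inv (bd_good Y m) gi); rewrite ez_map /= => ->.
  rewrite -[ez (fun x => ez g (bd x)) _]ez_zmap (sd_chain (SY k) vy gi) ez_zmap.
  by have := cyc2 _ _ hS; rewrite ez_map.
have [l hl] := kill vv tv phv.
(* First component: [- d a = - d u + v + (cx - S cx) = cx]. *)
pose a := u ++ zopp (zmap (sdT (SX l)) v) ++ zopp (zmap (sdT (SX k)) cx).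
exists (bmapc inl a ++ bmapc inr (zmap (sdT (SY k)) cy)); split.
  apply/on_terms_cat; split; apply: on_terms_bmapc; last exact: vT.
  apply/on_terms_cat; split=> //.
  by apply/on_terms_cat; split; apply: on_terms_zopp; exact: vT.
move=> M g /inv_sum[gl gr].
rewrite [LHS]ev_sum -/(ez _ cx) -/(ez _ cy) ez_zmap ez_cat !ez_map.
rewrite (@ez_ext _ _ _ (fun x => (g \o inr) (phi m.+1 x) + - ez (g \o inl) (bd x)) a); last first.
  by move=> x; rewrite [LHS]ez_cone_inl.
rewrite ez_add ez_neg -addrA addrCA; congr (_ + _).
  rewrite -ez_zmap ez_zmap /a !ez_cat !ez_opp -!ez_zmap.
  have e1 := sd_cycle (SX k) vx gl cyc1.
  have e2 := sd_cycle (SX l) vv gl zv.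
  rewrite (hl _ _ gl) ez_nil addr0 ez_cat in e2.
  by rewrite [LHS]e1 !opprD !opprK -e2 addrA (addrC (- _)) addrK addrC.
have e := sd_homc (SY k) vy gr.
rewrite [LHS]e -(hu _ _ gr) /=.
rewrite !ez_cat !ez_opp.
(* The homotopy commutes with [phi], and [phi v = 0]. *)
have -> : ez ((g \o inr) \o phi m.+1) (zmap (sdT (SX l)) v) = 0.
  rewrite ez_zmap (ez_call (g' := fun x => ez (g \o inr) (sdT (SY l) (phi m x))) vv); last first.
    by move=> x wx; rewrite -(T_phi l wx gr) ez_map.
  by have := phv _ _ (goodop_inv (sdT_good (SY l) m) gr); rewrite ez_map ez_nil.
(* Here [phi cx = - d cy]; the term obtained is the [T d cy] of the homotopy formula for [cy]. *)
have -> : ez ((g \o inr) \o phi m.+1) (zmap (sdT (SX k)) cx) = - ez (g \o inr) (zmap (sdT (SY k)) (zmap bd cy)).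
  rewrite ez_zmap (ez_call (g' := fun x => ez (g \o inr) (sdT (SY k) (phi m x))) vx); last first.
    by move=> x wx; rewrite -(T_phi k wx gr) ez_map.
  have := cyc2 _ _ (goodop_inv (sdT_good (SY k) m) gr); rewrite ez_map -ez_zmap => /eqP.
  by rewrite addr_eq0 => /eqP.
rewrite ez_map oppr0 opprK add0r addrC addrA addrAC; congr (_ + _ + _).
by rewrite ez_zmap; apply: ez_ext => y; rewrite /= ez_map.
Qed.

End Acyclic.

(** * Barycentric subdivision of linear chains *)

Section Linear.
Context {R : realType}.

Definition bary (V : lmodType R) (w : seq V) : V := (size w)%:R^-1 *: \sum_(v <- w) v.

(** The alternating sum of faces, see [ez_lbd], in the recursive form [d (v w) = w - v (d w)] suited
    to cones. A single vertex has boundary [[::]], so the complex is augmented. *)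
Fixpoint lbd (V : Type) (w : seq V) : seq (seq V * int) :=
  if w is v :: w' then (w', 1) :: bmapc (cons v) (zopp (lbd w')) else [::].

(** [S w = b (S (d w))], with the barycentre [b] as the leading vertex. Faces are not structural
    subterms, hence the fuel, which is always the length of [w]. *)
Fixpoint lsd_rec (V : lmodType R) n (w : seq V) : seq (seq V * int) :=
  if n is m.+1 then bmapc (cons (bary w)) (zmap (@lsd_rec V m) (lbd w)) else [:: (w, 1)].

(* T w = b (w - T (d w)), b the cone from the barycenter;
   the empty list plays the role of the augmentation. *)
Fixpoint lht_rec (V : lmodType R) n (w : seq V) : seq (seq V * int) :=
  if n is m.+1 then
    bmapc (cons (bary w)) ((w, 1) :: zopp (zmap (@lht_rec V m) (lbd w)))
  else [::].

Definition lsd (V : lmodType R) (w : seq V) := lsd_rec (size w) w.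
Definition lht (V : lmodType R) (w : seq V) := lht_rec (size w) w.

Fixpoint lsd_iter (V : lmodType R) k (w : seq V) : seq (seq V * int) :=
  if k is l.+1 then zmap (@lsd_iter V l) (lsd w) else [:: (w, 1)].

(** Telescoping: if [T] joins the identity to [S], and [T_k] joins it to the [k]-th power of [S],
    then [T + T_k S] joins it to the next power. *)
Fixpoint lht_iter (V : lmodType R) k (w : seq V) : seq (seq V * int) :=
  if k is l.+1 then lht w ++ zmap (@lht_iter V l) (lsd w) else [::].

Section Identities.
Variables (V : lmodType R) (M : zmodType).
Implicit Types (w : seq V) (c : seq (seq V * int)) (g : seq V -> M).

Lemma lbd_size w : on_terms (fun x => (size x).+1 = size w) (lbd w).
Proof.
elim: w => [|v w IH] //=; split=> //; apply: on_terms_bmapc; apply: on_terms_zopp.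
by apply: on_terms_imp IH => x /= ->.
Qed.

Lemma ez_lbd_cons g v w : ez g (lbd (v :: w)) = g w - ez (g \o cons v) (lbd w).
Proof. by rewrite ez_cons mulr1z ez_map ez_opp. Qed.

Lemma ez_lbd_cone g v c :
  ez g (zmap (@lbd V) (bmapc (cons v) c)) = ez g c - ez (g \o cons v) (zmap (@lbd V) c).
Proof.
rewrite ez_zmap ez_map ez_zmap -ez_neg -ez_add; apply: ez_ext => x; exact: ez_lbd_cons.
Qed.

Lemma ez_lbd_lbd w g : ez g (zmap (@lbd V) (lbd w)) = 0.
Proof.
elim: w g => [|v w IH] g; first exact: ez_nil.
rewrite ez_zmap ez_lbd_cons -[X in _ - X]ez_map -ez_zmap ez_lbd_cone IH.
by rewrite subr0 subrr.
Qed.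

(** By [d (b c) = c - b (d c)] it remains that [d S d w = 0], which by induction is [S d d w]. At
    the bottom [S d w] consists of empty lists, which have no boundary. *)
Lemma lsd_rec_chain n w g : size w = n.+1 ->
  ez g (zmap (@lbd V) (lsd_rec n.+1 w)) = ez g (zmap (@lsd_rec V n) (lbd w)).
Proof.
elim: n w g => [|n IH] w g sw; rewrite [lsd_rec _ _]/= ez_lbd_cone.
  rewrite [X in _ - X]ez_zmap -[RHS]subr0 -(ez_zero (zmap (@lsd_rec V 0) (lbd w))).
  congr (_ - _); apply: (ez_call (P := @nilp V)); last by move=> [|//] _; rewrite ez_nil.
  by apply: on_terms_zmap (lbd_size w) _ => x; rewrite sw => -[/size0nil ->].
suff e : ez (g \o cons (bary w)) (zmap (@lbd V) (zmap (@lsd_rec V n.+1) (lbd w))) = 0.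
  by rewrite [X in _ - X]e subr0.
rewrite 2!ez_zmap -(@ez_lbd_lbd w (fun y => ez (g \o cons (bary w)) (lsd_rec n y))) ez_zmap.
apply: ez_call (lbd_size w) _ => x; rewrite sw => -[sx].
by rewrite -ez_zmap IH // ez_zmap.
Qed.

(** By induction on the faces and [d d = 0], the chain [w - T d w] has boundary [S d w]. The cone
    formula then gives [d T w = w - T d w - b (S d w)], and the last term is [S w]. *)
Lemma lht_rec_hom n w g : size w = n ->
  ez g (zmap (@lbd V) (lht_rec n w)) + ez g (zmap (@lht_rec V n.-1) (lbd w))
    + ez g (lsd_rec n w) = g w.
Proof.
elim: n w g => [|n IH] w g sw.
  by move/size0nil: sw => ->; rewrite /= !ez_nil !add0r ez1.
rewrite [n.+1.-1]/=; set b := bary w; set T := zmap (@lht_rec V n) (lbd w); set S := zmap (@lsd_rec V n) (lbd w).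
have -> : lht_rec n.+1 w = bmapc (cons b) ([:: (w, 1)] ++ zopp T) by [].
have -> : lsd_rec n.+1 w = bmapc (cons b) S by [].
rewrite ez_lbd_cone ez_cat ez1 ez_opp [ez g (bmapc _ S)]ez_map.
suff -> : ez (g \o cons b) (zmap (@lbd V) ([:: (w, 1)] ++ zopp T)) = ez (g \o cons b) S.
  by rewrite addrAC !subrK.
rewrite ez_zmap ez_cat ez1 ez_opp -ez_zmap /T; apply/eqP; rewrite subr_eq; apply/eqP.
rewrite -[LHS]subr0 -(ez_lbd_lbd w (fun y => ez (g \o cons b) (lht_rec n.-1 y))) !ez_zmap.
rewrite -ez_neg -!ez_add; apply: ez_call (lbd_size w) _ => x; rewrite sw => -[sx].
by rewrite -(IH x _ sx) !ez_zmap addrAC addrK addrC.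
Qed.

End Identities.

Section Iteration.
Variable V : lmodType R.
Implicit Types (w : seq V) (c : seq (seq V * int)).

Lemma lsd_rec_size n w : size w = n -> on_terms (fun x => size x = n) (lsd_rec n w).
Proof.
elim: n w => [|n IH] w sw //; apply: on_terms_bmapc.
apply: on_terms_zmap (lbd_size w) _ => x; rewrite sw => -[/IH].
by apply: on_terms_imp => y /= ->.
Qed.

Lemma lsd_size w : on_terms (fun x => size x = size w) (lsd w).
Proof. exact: lsd_rec_size. Qed.

Lemma lht_size w : on_terms (fun x => size x = (size w).+1) (lht w).
Proof.
suff h n : size w = n -> on_terms (fun x => size x = n.+1) (lht_rec n w) by exact: h.
elim: n w => [|n IH] w sw //; apply: on_terms_bmapc => /=; rewrite sw; split=> //.
apply: on_terms_zopp; apply: on_terms_zmap (lbd_size w) _ => x; rewrite sw => -[sx].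
by have := IH x sx; apply: on_terms_imp => y /= ->.
Qed.

Lemma lsd_iter_size k w : on_terms (fun x => size x = size w) (lsd_iter k w).
Proof.
elim: k w => [|k IH] w //; apply: on_terms_zmap (lsd_size w) _ => x <-; exact: IH.
Qed.

Lemma lht_iter_size k w : on_terms (fun x => size x = (size w).+1) (lht_iter k w).
Proof.
elim: k w => [|k IH] w //; apply/on_terms_cat; split; first exact: lht_size.
by apply: on_terms_zmap (lsd_size w) _ => x <-; exact: IH.
Qed.

Variable M : zmodType.
Implicit Types (g : seq V -> M).

Lemma lsd_chain w g : ez g (zmap (@lbd V) (lsd w)) = ez g (zmap (@lsd V) (lbd w)).
Proof.
case: w => [|v w]; first by rewrite !ez_zmap ez1 !ez_nil.
rewrite /lsd lsd_rec_chain // !ez_zmap; apply: ez_call (lbd_size _) _ => x /= [sx].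
by rewrite /lsd sx.
Qed.

Lemma lht_hom w g : ez g (zmap (@lbd V) (lht w)) + ez g (zmap (@lht V) (lbd w)) + ez g (lsd w) = g w.
Proof.
rewrite -[RHS](lht_rec_hom g (erefl (size w))); congr (_ + _ + _).
rewrite !ez_zmap; apply: ez_call (lbd_size _) _ => x /= sx.
by rewrite /lht -sx.
Qed.

Lemma lht_iter_hom k w g :
  ez g (zmap (@lbd V) (lht_iter k w)) + ez g (zmap (@lht_iter V k) (lbd w)) + ez g (lsd_iter k w) = g w.
Proof.
elim: k w => [|k IH] w.
  rewrite ez_zmap ez_nil add0r ez1 ez_zmap -[RHS]add0r -(ez_zero (lbd w)).
  by congr (_ + _); apply: ez_ext => x; rewrite ?ez_nil.
have e1 : ez g (zmap (@lbd V) (lht_iter k.+1 w)) =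
    ez g (zmap (@lbd V) (lht w)) + ez g (zmap (@lbd V) (zmap (@lht_iter V k) (lsd w))).
  by rewrite ez_zmap ez_cat -!ez_zmap.
have e2 : ez g (zmap (@lht_iter V k.+1) (lbd w)) =
    ez g (zmap (@lht V) (lbd w)) + ez g (zmap (@lht_iter V k) (zmap (@lsd V) (lbd w))).
  rewrite !ez_zmap -ez_add; apply: ez_ext => x.
  by rewrite -ez_zmap -ez_cat.
have e3 : ez g (zmap (@lbd V) (zmap (@lht_iter V k) (lsd w)))
    + ez g (zmap (@lht_iter V k) (zmap (@lbd V) (lsd w))) + ez g (zmap (@lsd_iter V k) (lsd w)) = ez g (lsd w).
  by rewrite !ez_zmap -!ez_add; apply: ez_ext => x; rewrite -(IH x) !ez_zmap.
have e4 : ez g (zmap (@lht_iter V k) (zmap (@lbd V) (lsd w))) =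
    ez g (zmap (@lht_iter V k) (zmap (@lsd V) (lbd w))).
  by rewrite ez_zmap lsd_chain [RHS]ez_zmap.
rewrite e1 e2 -(lht_hom w g) -e3 e4 [ez g (lsd_iter _ _)]/=.
by rewrite addrACA -!addrA.
Qed.
End Iteration.

Section Naturality.
Variables (V W : lmodType R) (f : {linear V -> W}).
Implicit Types (w : seq V) (c : seq (seq V * int)).

Let fmap c := bmapc (map f) c.

Lemma bary_map w : bary (map f w) = f (bary w).
Proof. by rewrite /bary size_map big_map linearZZ (linear_sum f). Qed.

Lemma lbd_map w : lbd (map f w) = fmap (lbd w).
Proof.
elim: w => [|v w IH] //=; rewrite IH /fmap /bmapc /zopp /= -!map_comp.
by congr cons; apply: eq_map.
Qed.

Let zmap_map L (L' : seq W -> seq (seq W * int)) c :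
  (forall x, L' (map f x) = fmap (L x)) -> zmap L' (fmap c) = fmap (zmap L c).
Proof.
move=> h; rewrite /zmap; elim: c => [|p c IH] //=; rewrite IH h.
by rewrite /fmap /bmapc map_cat -!map_comp.
Qed.

Lemma lsd_rec_map n w : lsd_rec n (map f w) = fmap (lsd_rec n w).
Proof.
elim: n w => [|n IH] w //=.
rewrite lbd_map (zmap_map _ IH) bary_map /fmap /bmapc -!map_comp.
by apply: eq_map.
Qed.

Lemma lht_rec_map n w : lht_rec n (map f w) = fmap (lht_rec n w).
Proof.
elim: n w => [|n IH] w //=.
rewrite lbd_map (zmap_map _ IH) bary_map /fmap /bmapc /zopp /= -!map_comp.
by congr cons; apply: eq_map.
Qed.

Lemma lsd_map w : lsd (map f w) = fmap (lsd w).
Proof. by rewrite /lsd size_map lsd_rec_map. Qed.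

Lemma lht_map w : lht (map f w) = fmap (lht w).
Proof. by rewrite /lht size_map lht_rec_map. Qed.

Lemma lht_iter_map k w : lht_iter k (map f w) = bmapc (map f) (lht_iter k w).
Proof.
elim: k w => [|k IH] w //=; rewrite lsd_map (zmap_map _ IH) lht_map.
by rewrite /bmapc map_cat.
Qed.

End Naturality.

Section Hull.
(** Only closure under barycentres is asked of [C], so the same lemmas apply to [Delta] and to the
    balls of the mesh estimate. *)
Variables (V : lmodType R) (C : V -> Prop).
Hypothesis Cbary : forall w : seq V, w != [::] -> {in w, forall v, C v} -> C (bary w).

Let allC (w : seq V) := {in w, forall v, C v}.

Lemma lbd_sub (w : seq V) : on_terms (fun x => {subset x <= w}) (lbd w).
Proof.
elim: w => [|v w IH] //=; split; first by move=> u; rewrite inE orbC => ->.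
apply: on_terms_bmapc; apply: on_terms_zopp; apply: on_terms_imp IH => x xw u /=.
by rewrite !inE => /orP[->//|/xw ->]; rewrite orbT.
Qed.

Let allC_cons b x : C b -> allC x -> allC (b :: x).
Proof. by move=> Cb Cx v; rewrite inE => /predU1P[->//|]; exact: Cx. Qed.

Lemma lsd_rec_hull n w : size w = n -> allC w -> on_terms allC (lsd_rec n w).
Proof.
elim: n w => [|n IH] w sw Cw; first by split.
apply: on_terms_bmapc; apply: on_terms_zmap (on_terms_and (lbd_size w) (lbd_sub w)) _ => x [].
rewrite sw => -[sx] xw; have := IH x sx (fun v vx => Cw v (xw v vx)).
by apply: on_terms_imp => y; apply: allC_cons; apply: Cbary => //; case: (w) sw.
Qed.

Lemma lht_rec_hull n w : size w = n -> allC w -> on_terms allC (lht_rec n w).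
Proof.
elim: n w => [|n IH] w sw Cw //.
have Cb : C (bary w) by apply: Cbary => //; case: (w) sw.
apply: on_terms_bmapc; split; first exact: allC_cons.
apply: on_terms_zopp; apply: on_terms_zmap (on_terms_and (lbd_size w) (lbd_sub w)) _ => x [].
rewrite sw => -[sx] xw; have := IH x sx (fun v vx => Cw v (xw v vx)).
by apply: on_terms_imp => y; exact: allC_cons.
Qed.

Lemma lsd_iter_hull k w : allC w -> on_terms allC (lsd_iter k w).
Proof.
elim: k w => [|k IH] w Cw; first by split.
exact: on_terms_zmap (lsd_rec_hull erefl Cw) _.
Qed.

Lemma lht_iter_hull k w : allC w -> on_terms allC (lht_iter k w).
Proof.
elim: k w => [|k IH] w Cw //; apply/on_terms_cat; split; first exact: lht_rec_hull.
exact: on_terms_zmap (lsd_rec_hull erefl Cw) _.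
Qed.

End Hull.

(** * The mesh of iterated subdivisions tends to zero *)

Section Mesh.
Variable V : normedModType R.

Definition diam_le (D : R) (w : seq V) := {in w &, forall u v, `|u - v| <= D}.

Lemma bary_dist (w : seq V) (x : V) : w != [::] ->
  `|x - bary w| <= (size w)%:R^-1 * \sum_(v <- w) `|x - v|.
Proof.
move=> w0; have sw : (size w)%:R != 0 :> R by rewrite pnatr_eq0 size_eq0.
have -> : x - bary w = (size w)%:R^-1 *: \sum_(v <- w) (x - v).
  rewrite sumrB scalerBr big_const_seq count_predT iter_addr_0 -[x *+ _]scaler_nat.
  by rewrite scalerA mulVf // scale1r.
rewrite normrZ ger0_norm ?invr_ge0 ?ler0n //.
by apply: ler_wpM2l; rewrite ?invr_ge0 ?ler0n //; exact: ler_norm_sum.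
Qed.

(** Among the [n] differences averaged in [v - b] one is [v - v], so a vertex [v] lies within
    [(n-1)/n] of the diameter bound from the barycentre [b], and [n <= N+1]. Edges that do not meet
    [b] lie in a subdivided face and are covered by induction. *)
Lemma lsd_mesh (N : nat) (D : R) (w : seq V) : 0 <= D -> (size w <= N.+1)%N ->
  diam_le D w -> on_terms (diam_le (N%:R / N.+1%:R * D)) (lsd w).
Proof.
move=> D0 wN; set r : R := N%:R / N.+1%:R.
have r0 : 0 <= r by rewrite divr_ge0.
suff h n x : size x = n -> (n <= N.+1)%N -> diam_le D x ->
    on_terms (diam_le (r * D)) (lsd_rec n x) by exact: h.
elim: n x {w wN} => [|n IH] w sw wN Dw; first by move/size0nil: sw => ->; split.
apply: on_terms_bmapc; have w0 : w != [::] by case: (w) sw.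
set b := bary w.
have near v : v \in w -> `|v - b| <= r * D.
  move=> vw; apply: le_trans (bary_dist v w0) _.
  rewrite (perm_big _ (perm_to_rem vw)) big_cons /= subrr normr0 add0r.
  have : \sum_(u <- rem v w) `|v - u| <= \sum_(u <- rem v w) D.
    by rewrite big_seq [leRHS]big_seq; apply: ler_sum => u /mem_rem uw; exact: Dw.
  rewrite big_const_seq count_predT iter_addr_0 size_rem // sw /= => h.
  apply: le_trans (ler_wpM2l _ h) _; first by rewrite invr_ge0.
  rewrite -[D *+ _]mulr_natl mulrA; apply: ler_wpM2r => //.
  rewrite mulrC ler_pdivrMr // mulrAC ler_pdivlMr // -!natrM ler_nat.
  by rewrite mulnS mulnC mulnS leq_add2r.
apply: on_terms_zmap (on_terms_and (lbd_size w) (lbd_sub w)) _ => x [].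
rewrite sw => -[sx] xw.
have h1 := IH x sx (ltnW wN) (fun u v ux vx => Dw u v (xw u ux) (xw v vx)).
(* Closed balls about [b] contain the barycentres of their points, so the bound passes from the
   vertices of the face to all vertices of its subdivision. *)
have h2 : on_terms (fun y => {in y, forall v, `|v - b| <= r * D}) (lsd_rec n x).
  apply: lsd_rec_hull => //; last by move=> v /xw; exact: near.
  move=> y y0 hy; rewrite distrC; apply: le_trans (bary_dist b y0) _.
  rewrite mulrC ler_pdivrMr ?ltr0n ?lt0n ?size_eq0 // mulr_natr.
  rewrite -iter_addr_0 -(count_predT y) -big_const_seq.
  by rewrite big_seq [leRHS]big_seq; apply: ler_sum => u uy; rewrite distrC; exact: hy.
apply: on_terms_imp (on_terms_and h1 h2) => y [Dy by_] u v; rewrite !inE.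
move=> /predU1P[->|uy] /predU1P[->|vy]; rewrite ?subrr ?normr0 ?mulr_ge0 //.
- by rewrite distrC; exact: by_.
- exact: by_.
- exact: Dy.
Qed.

Lemma lsd_iter_mesh (N k : nat) (D : R) (w : seq V) : 0 <= D -> (size w <= N.+1)%N ->
  diam_le D w -> on_terms (diam_le ((N%:R / N.+1%:R) ^+ k * D)) (lsd_iter k w).
Proof.
move=> D0; elim: k D w D0 => [|k IH] D w D0 wN Dw; first by rewrite expr0 mul1r; split.
apply: on_terms_zmap (on_terms_and (lsd_size w) (lsd_mesh D0 wN Dw)) _ => x [sx Dx].
by rewrite exprSr -mulrA; apply: IH => //; rewrite ?sx ?mulr_ge0 ?divr_ge0.
Qed.

Lemma lsd_iter_small (w : seq V) (e : R) : 0 < e ->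
  exists k0, forall k, (k0 <= k)%N -> on_terms (diam_le e) (lsd_iter k w).
Proof.
(* Crude choices: the sum of all distances bounds the diameter, and [N = size w], one more than the
   dimension, also covers the empty list. *)
move=> e0; pose N := size w; pose D : R := \sum_(u <- w) \sum_(v <- w) `|u - v|.
have D0 : 0 <= D by apply: sumr_ge0 => u _; apply: sumr_ge0.
have DD : diam_le D w.
  move=> u v uw vw; rewrite /D (perm_big _ (perm_to_rem uw)) big_cons /=.
  rewrite [X in _ <= X + _](perm_big _ (perm_to_rem vw)) big_cons /= -addrA lerDl.
  by apply: addr_ge0; apply: sumr_ge0 => // x _; apply: sumr_ge0.
set r : R := N%:R / N.+1%:R.
have r01 : `|r| < 1.
  by rewrite ger0_norm ?divr_ge0 // ltr_pdivrMr // mul1r ltr_nat.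
have : (fun k => r ^+ k * D) @ \oo --> (0 * D : R) by apply: cvgMl; exact: cvg_expr.
rewrite mul0r => /cvgrPdist_lt/(_ e e0)[k0 _ hk0]; exists k0 => k kk0.
have := lsd_iter_mesh (N := N) k D0 (leqnSn _) DD; apply: on_terms_imp => x Dx u v ux vx.
apply: le_trans (Dx _ _ ux vx) _; apply: ltW.
by have := hk0 k kk0; rewrite /= sub0r normrN; apply: le_lt_trans; exact: ler_norm.
Qed.

End Mesh.
End Linear.

(** * Continuity on subsets *)

(** Phrased with open sets of the ambient space, so that domains can be restricted and composed
    without passing through subspace types. *)
Definition cont_on (S T : topologicalType) (A : set S) (f : S -> T) : Prop :=
  forall x, A x -> forall V : set T, open V -> V (f x) ->
  exists U : set S, open U /\ U x /\ forall y, U y -> A y -> V (f y).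

Lemma cont_onP (S T : topologicalType) (A : set S) (f : S -> T) :
  {within A, continuous f} <-> cont_on A f.
Proof.
rewrite subspace_continuousP; split=> h x Ax.
  move=> V oV Vf; have : nbhs (f x) V by apply: open_nbhs_nbhs.
  move=> /(h x Ax); rewrite nbhsE => -[U [oU Ux] UV].
  by exists U; split=> //; split.
move=> V; rewrite nbhsE => -[W [oW Wf] WV].
have [U [oU [Ux UW]]] := h x Ax W oW Wf.
rewrite /= nbhsE; exists U => // y Uy Ay; apply: WV; exact: UW.
Qed.

Section ContOn.
Context {S T U : topologicalType}.
Implicit Types (A : set S) (B : set T).

Lemma cont_on_continuous A (f : S -> T) : continuous f -> cont_on A f.
Proof. by move=> cf; apply/cont_onP; exact: continuous_subspaceT. Qed.

Lemma cont_on_comp A B (f : S -> T) (g : T -> U) :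
  cont_on A f -> cont_on B g -> (forall x, A x -> B (f x)) -> cont_on A (g \o f).
Proof.
move=> cf cg AB x Ax V oV Vx.
have [W [oW [Wx WV]]] := cg _ (AB _ Ax) V oV Vx.
have [Z [oZ [Zx ZW]]] := cf _ Ax W oW Wx.
by exists Z; split=> //; split=> // y Zy Ay; apply: WV; [exact: ZW|exact: AB].
Qed.

Lemma cont_on_sub A A' (f : S -> T) : A' `<=` A -> cont_on A f -> cont_on A' f.
Proof.
move=> AA cf x Ax V oV Vx; have [W [oW [Wx WV]]] := cf _ (AA _ Ax) V oV Vx.
by exists W; split=> //; split=> // y Wy /AA; exact: WV.
Qed.

Lemma cont_on_eq A (f g : S -> T) : (forall x, A x -> f x = g x) -> cont_on A f -> cont_on A g.
Proof.
move=> fg cf x Ax V oV; rewrite -fg // => Vx; have [W [oW [Wx WV]]] := cf _ Ax V oV Vx.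
by exists W; split=> //; split=> // y Wy Ay; rewrite -fg //; exact: WV.
Qed.

Lemma cont_on_id A : cont_on A id.
Proof. by move=> x _ V oV Vx; exists V; split=> //; split. Qed.

Lemma openX (A : set S) (B : set T) : open A -> open B -> open (A `*` B).
Proof.
move=> oA oB; rewrite openE => -[a b] [/= Aa Bb].
by exists (A, B) => //=; split; apply: open_nbhs_nbhs.
Qed.

Lemma openX_ex (V : set (S * T)) a b : open V -> V (a, b) ->
  exists A B, [/\ open A, open B, A a, B b & forall x y, A x -> B y -> V (x, y)].
Proof.
rewrite openE => oV /oV[[A B] /= [nA nB] AB].
move: nA nB; rewrite !nbhsE => -[A' [oA A'a] AA] [B' [oB B'b] BB].
by exists A', B'; split=> // x y /AA ? /BB ?; exact: (AB (x, y)).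
Qed.

End ContOn.

Lemma cont_on_pair (S T U : topologicalType) (A : set S) (f : S -> T) (g : S -> U) :
  cont_on A f -> cont_on A g -> cont_on A (fun x => (f x, g x)).
Proof.
move=> cf cg x Ax V oV Vx; have [V1 [V2 [oV1 oV2 V1f V2g VV]]] := openX_ex oV Vx.
have [U1 [oU1 [U1x UV1]]] := cf _ Ax V1 oV1 V1f.
have [U2 [oU2 [U2x UV2]]] := cg _ Ax V2 oV2 V2g.
exists (U1 `&` U2); split; first exact: openI.
by split=> // y [y1 y2] Ay; apply: VV; [exact: UV1|exact: UV2].
Qed.

Lemma cont_on_fst (S T : topologicalType) (A : set (S * T)) : cont_on A fst.
Proof. by apply: cont_on_continuous => -[x y]; exact: cvg_fst. Qed.

Lemma cont_on_snd (S T : topologicalType) (A : set (S * T)) : cont_on A snd.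
Proof. by apply: cont_on_continuous => -[x y]; exact: cvg_snd. Qed.

Lemma cont_on_fstc (S T U : topologicalType) (A : set S) (f : S -> T * U) :
  cont_on A f -> cont_on A (fun x => (f x).1).
Proof. by move=> cf; exact: (cont_on_comp cf (@cont_on_fst _ _ setT)). Qed.

Lemma cont_on_sndc (S T U : topologicalType) (A : set S) (f : S -> T * U) :
  cont_on A f -> cont_on A (fun x => (f x).2).
Proof. by move=> cf; exact: (cont_on_comp cf (@cont_on_snd _ _ setT)). Qed.

Lemma open_rel (S : topologicalType) (A B : set S) :
  (forall x, A x -> B x -> exists U : set S, open U /\ U x /\ (U `&` B `<=` A)) ->
  exists V, open V /\ A `&` B = V `&` B.
Proof.
move=> h; exists (\bigcup_(U in [set U : set S | open U /\ U `&` B `<=` A]) U); split.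
  by apply: bigcup_open => U [].
apply/seteqP; split=> x [] => [Ax Bx|[U [_ UA] Ux] Bx]; split=> //; last by apply: UA.
by have [U [oU [Ux UA]]] := h x Ax Bx; exists U.
Qed.

(** A surjection of [A] onto [B], open for the relative topologies. Unlike general quotient maps,
    these are stable under products; continuity of an action or a translation function on a quotient
    bundle depends on that. *)
Definition open_onto (S T : topologicalType) (f : S -> T) (A : set S) (B : set T) : Prop :=
  [/\ forall x, A x -> B (f x), forall y, B y -> exists2 x, A x & f x = y &
   forall x U, A x -> open U -> U x ->
     exists V : set T, open V /\ V (f x) /\
       forall y, V y -> B y -> exists x', [/\ U x', A x' & f x' = y]].

Lemma open_onto_cont (S T W : topologicalType) (f : S -> T) (A : set S) (B : set T) (g : T -> W) :
  open_onto f A B -> cont_on A (g \o f) -> cont_on B g.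
Proof.
move=> [fAB fs fo] cg y By V oV Vy; have [x Ax xy] := fs y By.
have [|U [oU [Ux UV]]] := cg x Ax V oV; first by rewrite /= xy.
have [N [oN [Nx NU]]] := fo x U Ax oU Ux.
exists N; split=> //; split; first by rewrite -xy.
by move=> y' Ny' By'; have [x' [Ux' Ax' <-]] := NU y' Ny' By'; exact: UV.
Qed.

Lemma open_onto_id (S : topologicalType) (A : set S) : open_onto id A A.
Proof.
split=> //; first by move=> y Ay; exists y.
by move=> x U Ax oU Ux; exists U; split=> //; split=> // y Uy Ay; exists y.
Qed.

Lemma open_onto_prod (S T S' T' : topologicalType) (f : S -> T) (f' : S' -> T') A B A' B' :
  open_onto f A B -> open_onto f' A' B' ->
  open_onto (fun z => (f z.1, f' z.2)) (A `*` A') (B `*` B').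
Proof.
move=> [h1 h2 h3] [h1' h2' h3']; split.
- by move=> x [/h1 ? /h1' ?].
- move=> [y y'] [/= /h2[x Ax <-] /h2'[x' Ax' <-]]; by exists (x, x').
- move=> [x x'] U [/= Ax Ax'] oU Ux.
  have [U1 [U2 [oU1 oU2 U1x U2x UU]]] := openX_ex oU Ux.
  have [V1 [oV1 [V1x VU1]]] := h3 x U1 Ax oU1 U1x.
  have [V2 [oV2 [V2x VU2]]] := h3' x' U2 Ax' oU2 U2x.
  exists (V1 `*` V2); split; first exact: openX.
  split=> // -[y y'] [/= Vy Vy'] [/= By By'].
  have [z [Uz Az <-]] := VU1 y Vy By; have [z' [Uz' Az' <-]] := VU2 y' Vy' By'.
  by exists (z, z'); split=> //; exact: UU.
Qed.

Lemma open_onto_sub (S T : topologicalType) (f : S -> T) (A A' : set S) (B B' : set T) :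
  open_onto f A B -> B' `<=` B -> (forall x, A' x <-> A x /\ B' (f x)) -> open_onto f A' B'.
Proof.
move=> [h1 h2 h3] BB AA; split.
- by move=> x /AA[].
- move=> y By; have [x Ax xy] := h2 y (BB _ By); exists x => //.
  by apply/AA; rewrite xy.
- move=> x U /AA[Ax Bx] oU Ux; have [V [oV [Vx VU]]] := h3 x U Ax oU Ux.
  exists V; split=> //; split=> // y Vy By.
  have [x' [Ux' Ax' xy]] := VU y Vy (BB _ By).
  by exists x'; split=> //; apply/AA; rewrite xy.
Qed.

(* Continuity and openness of [is_pbundle] in pointwise form; the inverse of the
   shear map is encoded by the translation function [d], with [d (e, e') . e' = e]. *)
Record pbun (G : topGpd) (X : topologicalType) (B : set X) (E : pbundle G X) : Prop := Pbun {
  pb_proj : cont_on (carr E) (bproj E);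
  pb_map : cont_on (carr E) (bmap E);
  pb_base : forall e, carr E e -> B (bmap E e);
  pb_act : forall g e, carr E e -> gdom G g = bproj E e ->
     carr E (bact E g e) /\ bproj E (bact E g e) = gcod G g /\ bmap E (bact E g e) = bmap E e;
  pb_id : forall e, carr E e -> bact E (gid G (bproj E e)) e = e;
  pb_comp : forall g h e, carr E e -> gdom G h = bproj E e -> gdom G g = gcod G h ->
     bact E (gcomp G g h) e = bact E g (bact E h e);
  pb_actc : cont_on (act_dom E) (fun q => bact E q.1 q.2);
  pb_onto : open_onto (bmap E) (carr E) B;
  pb_delta : exists d : tot E * tot E -> mor G,
    [/\ forall e e', carr E e -> carr E e' -> bmap E e = bmap E e' ->
          gdom G (d (e, e')) = bproj E e' /\ bact E (d (e, e')) e' = e,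
        forall g e, carr E e -> gdom G g = bproj E e -> d (bact E g e, e) = g &
        cont_on [set r | carr E r.1 /\ carr E r.2 /\ bmap E r.1 = bmap E r.2] d] }.

Lemma pbunP (G : topGpd) (X : topologicalType) (B : set X) (E : pbundle G X) :
  is_pbundle B E <-> pbun B E.
Proof.
split.
  case=> [/cont_onP h1 [/cont_onP h2 [h3 [h4 [h5 [h6 [/cont_onP h7 [h8 [h9 h10]]]]]]]]].
  split=> //.
    split=> //; first by move=> y /h8[e [? ?]]; exists e.
    move=> e U Ee oU Ue; have [V [oV UV]] := h9 U oU.
    have im x : (bmap E @` (U `&` carr E)) x <-> (V `&` B) x by rewrite UV.
    exists V; split=> //; split; first by have [] := (im (bmap E e)).1 (ex_intro2 _ _ e (conj Ue Ee) erefl).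
    by move=> y Vy By; have [e' [Ue' Ee'] <-] := (im y).2 (conj Vy By); exists e'.
  move: h10 => /= [t1 [_ [Psi [p1 [p2 [p3 /cont_onP p4]]]]]].
  exists (fst \o Psi); split.
  - move=> e e' Ee Ee' ee.
    have [/= _ p] := p1 (e, e') (conj Ee (conj Ee' ee)).
    have [q1 q2] := p3 (e, e') (conj Ee (conj Ee' ee)).
    by split=> /=; [rewrite p q2|rewrite -[X in bact E _ X]q2].
  - by move=> g e Ee ge /=; rewrite (p2 (g, e)).
  - exact: cont_on_fstc.
case=> h1 h2 h3 h4 h5 h6 h7 [h8 h9 h10] [d [d1 d2 d3]].
split; first exact/cont_onP; split; first exact/cont_onP.
do 5 (split=> //); first exact/cont_onP.
split; first by move=> x /h9[e ? ?]; exists e.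
split.
  move=> U oU; have [|V [oV hV]] := @open_rel X (bmap E @` (U `&` carr E)) B.
    move=> x [e [Ue Ee] <-] _; have [V [oV [Vx VU]]] := h10 e U Ee oU Ue.
    exists V; split=> //; split=> // y [Vy By]; have [e' [? ? <-]] := VU y Vy By.
    by exists e'.
  exists V; split=> //; rewrite -hV; apply/seteqP; split=> [x|x []//].
  by move=> [e [Ue Ee] <-]; split; [exists e|exact: h3].
split; first by move=> [g e] [/= Ee ge]; have [? [? ?]] := h4 g e Ee ge.
split; first by apply/cont_onP; apply: cont_on_pair => //; exact: cont_on_snd.
exists (fun r => (d r, r.2)); split.
  by move=> [e e'] [/= Ee [Ee' ee]]; split=> //; have [] := d1 e e' Ee Ee' ee.
split; first by move=> [g e] [/= Ee ge]; rewrite d2.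
split; first by move=> [e e'] [/= Ee [Ee' ee]]; rewrite (d1 e e' Ee Ee' ee).2.
by apply/cont_onP; apply: cont_on_pair => //; exact: cont_on_snd.
Qed.

(** * Principal bundles *)

Record gpd (G : topGpd) : Prop := Gpd {
  dom_id : forall x, gdom G (gid G x) = x;
  cod_id : forall x, gcod G (gid G x) = x;
  dom_comp : forall g h, gdom G g = gcod G h -> gdom G (gcomp G g h) = gdom G h;
  cod_comp : forall g h, gdom G g = gcod G h -> gcod G (gcomp G g h) = gcod G g;
  compA : forall f g h, gdom G f = gcod G g -> gdom G g = gcod G h ->
     gcomp G f (gcomp G g h) = gcomp G (gcomp G f g) h;
  comp_id : forall g, gcomp G g (gid G (gdom G g)) = g;
  id_comp : forall g, gcomp G (gid G (gcod G g)) g = g;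
  dom_inv : forall g, gdom G (ginv G g) = gcod G g;
  cod_inv : forall g, gcod G (ginv G g) = gdom G g;
  inv_comp : forall g, gcomp G (ginv G g) g = gid G (gdom G g);
  comp_inv : forall g, gcomp G g (ginv G g) = gid G (gcod G g);
  dom_cont : continuous (gdom G);
  cod_cont : continuous (gcod G);
  id_cont : continuous (gid G);
  inv_cont : continuous (ginv G);
  comp_cont : cont_on (composable G) (fun p => gcomp G p.1 p.2);
  dom_open : forall U : set (mor G), open U -> open (gdom G @` U) }.

Lemma gpdP (G : topGpd) : topological_groupoid G -> gpd G.
Proof.
case=> h1 [h2 [h3 [h4 [h5 [h6 [h7 [h8 [h9 [/cont_onP h10 h11]]]]]]]]].
split=> //.
- by move=> x; have [] := h1 x.
- by move=> x; have [] := h1 x.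
- by move=> g h /h2[].
- by move=> g h /h2[].
- by move=> g; have [] := h4 g.
- by move=> g; have [] := h4 g.
- by move=> g; have [] := h5 g.
- by move=> g; have [_ []] := h5 g.
- by move=> g; have [_ [_ []]] := h5 g.
- by move=> g; have [_ [_ []]] := h5 g.
Qed.

Section GpdTheory.
Variable G : topGpd.
Hypothesis hG : gpd G.

Lemma ginvK g : ginv G (ginv G g) = g.
Proof.
rewrite -[RHS](id_comp hG) -(dom_inv hG) -(inv_comp hG (ginv G g)).
rewrite -(compA hG) ?(dom_inv hG) ?(inv_comp hG) ?(cod_inv hG) //.
by rewrite -(cod_inv hG g) -(dom_inv hG (ginv G g)) (comp_id hG).
Qed.

Lemma gcompK g h : gdom G g = gcod G h -> gcomp G (ginv G g) (gcomp G g h) = h.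
Proof.
by move=> gh; rewrite (compA hG) ?(dom_inv hG) // (inv_comp hG) gh (id_comp hG).
Qed.

Lemma gcompKr g h : gdom G g = gcod G h -> gcomp G (gcomp G g h) (ginv G h) = g.
Proof.
by move=> gh; rewrite -(compA hG) ?(cod_inv hG) // (comp_inv hG) -gh (comp_id hG).
Qed.

Lemma gcompVKr g h : gdom G g = gdom G h -> gcomp G (gcomp G g (ginv G h)) h = g.
Proof. by move=> gh; rewrite -{2}(ginvK h) gcompKr // (cod_inv hG). Qed.

Lemma gcomp_injr g g' h : gdom G g = gcod G h -> gdom G g' = gcod G h ->
  gcomp G g h = gcomp G g' h -> g = g'.
Proof. by move=> gh gh' e; rewrite -(gcompKr gh) e gcompKr. Qed.

Lemma ginv_comp g h : gdom G g = gcod G h ->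
  ginv G (gcomp G g h) = gcomp G (ginv G h) (ginv G g).
Proof.
move=> gh; apply: (@gcomp_injr _ _ (gcomp G g h)); first by rewrite (dom_inv hG).
  by rewrite (dom_comp hG) ?(dom_inv hG) ?(cod_inv hG) // (cod_comp hG).
rewrite (inv_comp hG) (dom_comp hG) // -(compA hG) ?gcompK ?(inv_comp hG) //.
  by rewrite (dom_inv hG) (cod_inv hG).
by rewrite (dom_inv hG) (cod_comp hG).
Qed.

Lemma ginv_id x : ginv G (gid G x) = gid G x.
Proof.
rewrite -[LHS](comp_id hG) (dom_inv hG) (cod_id hG).
by rewrite -{3}(dom_id hG x) -(inv_comp hG).
Qed.

(** The inverse exchanges [gdom] and [gcod], so openness of one passes to the other. *)
Lemma cod_open g (U : set (mor G)) : open U -> U g ->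
  exists V, open V /\ V (gcod G g) /\ forall y, V y -> exists h, U h /\ gcod G h = y.
Proof.
move=> oU Ug; exists (gdom G @` (ginv G @^-1` U)); split.
  by apply: (dom_open hG); apply: open_comp => // x _; exact: (inv_cont hG).
split; first by exists (ginv G g); rewrite ?(dom_inv hG) //= ginvK.
by move=> y [h /= Uh <-]; exists (ginv G h); rewrite (cod_inv hG).
Qed.

Lemma cont_gcomp (S : topologicalType) (A : set S) (f g : S -> mor G) :
  cont_on A f -> cont_on A g -> (forall x, A x -> gdom G (f x) = gcod G (g x)) ->
  cont_on A (fun x => gcomp G (f x) (g x)).
Proof.
by move=> cf cg fg; exact: (cont_on_comp (cont_on_pair cf cg) (comp_cont hG)).
Qed.

Lemma cont_ginv (S : topologicalType) (A : set S) (f : S -> mor G) :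
  cont_on A f -> cont_on A (fun x => ginv G (f x)).
Proof. by move=> cf; exact: (cont_on_comp cf (cont_on_continuous (A := setT) (inv_cont hG))). Qed.

Lemma cont_gdom (S : topologicalType) (A : set S) (f : S -> mor G) :
  cont_on A f -> cont_on A (fun x => gdom G (f x)).
Proof. by move=> cf; exact: (cont_on_comp cf (cont_on_continuous (A := setT) (dom_cont hG))). Qed.

Lemma cont_gcod (S : topologicalType) (A : set S) (f : S -> mor G) :
  cont_on A f -> cont_on A (fun x => gcod G (f x)).
Proof. by move=> cf; exact: (cont_on_comp cf (cont_on_continuous (A := setT) (cod_cont hG))). Qed.

Lemma cont_gid (S : topologicalType) (A : set S) (f : S -> ob G) :
  cont_on A f -> cont_on A (fun x => gid G (f x)).
Proof. by move=> cf; exact: (cont_on_comp cf (cont_on_continuous (A := setT) (id_cont hG))). Qed.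

End GpdTheory.

Section Iso.
Variable G : topGpd.

Lemma pb_iso_refl (X : topologicalType) (E : pbundle G X) : pb_iso E E.
Proof. by exists id, id; do 4 (split=> //); split; [|split=> //]; apply/cont_onP; exact: cont_on_id. Qed.

Lemma pb_iso_sym (X : topologicalType) (B : set X) (E F : pbundle G X) : pbun B E -> pb_iso E F -> pb_iso F E.
Proof.
move=> hE [f [g [fc [gc [gf [fg [cf [cg [pr eq]]]]]]]]].
exists g, f; do 6 (split=> //); split.
  by move=> e Fe; have [] := pr (g e) (gc _ Fe); rewrite fg // => -> ->.
move=> h e Fe he; have Ege := gc _ Fe.
have [p w] := pr _ Ege; rewrite fg // in p w; rewrite p in he.
have [Eh _] := pb_act hE Ege he.
by rewrite -[RHS]gf // eq // fg.
Qed.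

Lemma pb_iso_trans (X : topologicalType) (E F K : pbundle G X) : pb_iso E F -> pb_iso F K -> pb_iso E K.
Proof.
move=> [f [g [fc [gc [gf [fg [/cont_onP cf [/cont_onP cg [pr eq]]]]]]]]].
move=> [f' [g' [fc' [gc' [gf' [fg' [/cont_onP cf' [/cont_onP cg' [pr' eq']]]]]]]]].
exists (f' \o f), (g \o g'); split; first by move=> e /fc/fc'.
split; first by move=> e /gc'/gc.
split; first by move=> e Ee /=; rewrite gf' ?gf //; exact: fc.
split; first by move=> e Ee /=; rewrite fg ?fg' //; exact: gc'.
split; first by apply/cont_onP; exact: cont_on_comp cf cf' fc.
split; first by apply/cont_onP; exact: cont_on_comp cg' cg gc'.
split; first by move=> e Ee /=; have [<- <-] := pr _ Ee; exact: pr' (fc _ Ee).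
move=> h e Ee he /=; rewrite eq // eq' //; first exact: fc.
by rewrite (pr _ Ee).1.
Qed.

Lemma act_free (X : topologicalType) (B : set X) (E : pbundle G X) g g' e : pbun B E -> carr E e ->
  gdom G g = bproj E e -> gdom G g' = bproj E e -> bact E g e = bact E g' e -> g = g'.
Proof.
by move=> hE Ee ge ge' gg; have [d [_ d2 _]] := pb_delta hE; rewrite -(d2 g e) // gg d2.
Qed.

Hypothesis hG : gpd G.

(** Freeness makes [f] injective. A preimage of [y] is [d (y, f e) . e] for any [e] over the same
    base point; by injectivity it does not depend on [e]. It is continuous in the pair [(y, e)], and
    the fibre product projects onto [F] by an open surjection, so it is continuous in [y]. *)
Lemma pbun_morph_iso (X : topologicalType) (B : set X) x0 (E F : pbundle G X) (f : tot E -> tot F) :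
  B x0 -> pbun B E -> pbun B F ->
  (forall e, carr E e -> carr F (f e)) -> cont_on (carr E) f ->
  (forall e, carr E e -> bproj F (f e) = bproj E e /\ bmap F (f e) = bmap E e) ->
  (forall h e, carr E e -> gdom G h = bproj E e -> f (bact E h e) = bact F h (f e)) ->
  pb_iso E F.
Proof.
move=> Bx0 hE hF fc cf pr eq.
have [d [d1 d2 d3]] := pb_delta hF.
have [wB ws wo] := pb_onto hE.
(* Supplies the default value of the choice below. *)
have [e0 Ee0 _] := ws _ Bx0.
have /choice[c cP] : forall y, exists e, carr F y -> carr E e /\ bmap E e = bmap F y.
  move=> y; have [Fy|] := pselect (carr F y); last by exists e0.
  by have [e Ee ey] := ws _ (pb_base hF Fy); exists e.
pose k (z : tot F * tot E) := bact E (d (z.1, f z.2)) z.2.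
pose D : set (tot F * tot E) := [set z | [/\ carr F z.1, carr E z.2 & bmap F z.1 = bmap E z.2]].
have dP z : D z -> gdom G (d (z.1, f z.2)) = bproj E z.2 /\ bact F (d (z.1, f z.2)) (f z.2) = z.1.
  move=> [Fz Ez wz]; have [p w] := pr _ Ez.
  have [] := d1 z.1 (f z.2) Fz (fc _ Ez); first by rewrite w.
  by rewrite p.
have kc z : D z -> carr E (k z) /\ f (k z) = z.1.
  move=> Dz; have [dz az] := dP _ Dz; have [Fz Ez _] := Dz.
  by split; [exact: (pb_act hE Ez dz).1|rewrite /k eq].
have finj e e' : carr E e -> carr E e' -> f e = f e' -> e = e'.
  move=> Ee Ee' ff.
  have ww : bmap E e = bmap E e' by rewrite -(pr _ Ee).2 ff (pr _ Ee').2.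
  have [dE [dE1 dE2 dE3]] := pb_delta hE; have [p a] := dE1 _ _ Ee Ee' ww.
  rewrite -a; move: ff; rewrite -{1}a eq // => ff.
  rewrite (_ : dE (e, e') = gid G (bproj E e')) ?(pb_id hE) //.
  apply: (act_free hF (fc _ Ee')); rewrite ?(dom_id hG) // ?(pr _ Ee').1 //.
  by rewrite ff -(pr _ Ee').1 (pb_id hF) //; exact: fc.
have Dc y : carr F y -> D (y, c y) by move=> Fy; have [] := cP _ Fy; split.
exists f, (fun y => k (y, c y)); split=> //.
split; first by move=> y /Dc/kc[].
split.
  by move=> e Ee; apply: finj => //; have [] := kc _ (Dc _ (fc _ Ee)).
split; first by move=> y /Dc/kc[].
split; first exact/cont_onP.
split; last by split.
have ck : cont_on D k.
  apply: (cont_on_comp (f := fun z => (d (z.1, f z.2), z.2)) _ (pb_actc hE)); last first.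
    by move=> z Dz; split; [case: Dz|case: (dP _ Dz)].
  apply: cont_on_pair; last exact: cont_on_snd.
  apply: cont_on_comp d3 _; last first.
    by move=> z [Fz Ez wz]; split=> //; split=> /=; [exact: fc|rewrite (pr _ Ez).2].
  apply: cont_on_pair; first exact: cont_on_fst.
  by apply: cont_on_comp (@cont_on_snd _ _ _) cf _ => z [].
(* The projection is open because [bmap E] is. *)
apply/cont_onP; apply: (@open_onto_cont _ _ _ fst D (carr F)).
  split; first by move=> z [].
    by move=> y /Dc Dy; exists (y, c y).
  move=> [y e] U [/= Fy Ee ye] oU Ue.
  have [U1 [U2 [oU1 oU2 U1x U2x UU]]] := openX_ex oU Ue.
  have [W [oW [We hW]]] := wo e U2 Ee oU2 U2x.
  have [|N [oN [Ny NW]]] := pb_map hF Fy oW; first by rewrite ye.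
  exists (N `&` U1); split; first exact: openI.
  split=> // y' [Ny' Uy'] Fy'.
  have [e' [Ue' Ee' ee']] := hW _ (NW _ Ny' Fy') (pb_base hF Fy').
  by exists (y', e'); split=> //; exact: UU.
apply: cont_on_eq ck => z Dz /=; have [Fz _ _] := Dz.
by apply: finj; [case: (kc _ Dz)|case: (kc _ (Dc _ Fz))|rewrite (kc _ Dz).2 (kc _ (Dc _ Fz)).2].
Qed.

Section Pullback.
Variables (X Y : topologicalType) (B : set X) (BY : set Y).
Implicit Types (E F : pbundle G X) (f : Y -> X).

Lemma pullback_pbun E f : pbun B E -> cont_on BY f -> (forall y, BY y -> B (f y)) ->
  pbun BY (pullback f BY E).
Proof.
move=> hE cf fB.
have c1 : cont_on (carr (pullback f BY E)) (fun z : tot E * Y => z.1) by exact: cont_on_fst.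
split.
- by apply: cont_on_comp c1 (pb_proj hE) _ => z [].
- exact: cont_on_snd.
- by move=> z [_ []].
- move=> g z [Ez [Yz wz]] gz; have [h1 [h2 h3]] := pb_act hE Ez gz.
  by split=> //; split=> //=; split=> //; rewrite h3.
- by move=> [e y] [Ez _] /=; rewrite (pb_id hE).
- by move=> g h [e y] [Ez _] /= hz gh; rewrite (pb_comp hE).
- apply: cont_on_pair; last exact: cont_on_sndc (@cont_on_snd _ _ _).
  apply: (cont_on_comp (f := fun q : mor G * (tot E * Y) => (q.1, q.2.1))) (pb_actc hE) _.
    by apply: cont_on_pair; [exact: cont_on_fst|exact: cont_on_fstc (@cont_on_snd _ _ _)].
  by move=> q [[Eq _] /= qE].
- have [_ ws wo] := pb_onto hE; split; first by move=> z [_ []].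
    by move=> y Yy; have [e Ee ey] := ws _ (fB _ Yy); exists (e, y).
  move=> [e y] U [/= Ee [Yy ey]] oU Ue.
  have [U1 [U2 [oU1 oU2 U1x U2x UU]]] := openX_ex oU Ue.
  have [W [oW [We hW]]] := wo e U1 Ee oU1 U1x.
  have [|N [oN [Ny NW]]] := cf y Yy W oW; first by rewrite -ey.
  exists (N `&` U2); split; first exact: openI.
  split=> // y' [Ny' Uy'] Yy'; have [e' [Ue' Ee' ee']] := hW _ (NW _ Ny' Yy') (fB _ Yy').
  by exists (e', y'); split=> //; exact: UU.
- have [d [d1 d2 d3]] := pb_delta hE.
  exists (fun r => d (r.1.1, r.2.1)); split.
  + move=> [e y] [e' y'] [/= Ee [Yy ey]] [/= Ee' [Yy' ey']] yy.
    by have [|h1 h2] := d1 e e' Ee Ee'; [rewrite ey yy|rewrite h2 yy].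
  + by move=> g [e y] [/= Ee _] ge /=; exact: d2.
  + apply: (cont_on_comp (f := fun r : (tot E * Y) * (tot E * Y) => (r.1.1, r.2.1))) d3 _.
      apply: cont_on_pair; first exact: cont_on_fstc (@cont_on_fst _ _ _).
      exact: cont_on_fstc (@cont_on_snd _ _ _).
    by move=> [z z'] [/= [Ez [_ ez]] [[Ez' [_ ez']] zz]]; split=> //; split=> //=; rewrite ez ez' zz.
Qed.

Lemma pullback_iso E F f : pb_iso E F -> pb_iso (pullback f BY E) (pullback f BY F).
Proof.
move=> [h [g [hc [gc [gh [hg [/cont_onP ch [/cont_onP cg [pr eq]]]]]]]]].
have pr' e : carr F e -> bmap E (g e) = bmap F e.
  by move=> Fe; have [_] := pr _ (gc _ Fe); rewrite hg.
exists (fun z => (h z.1, z.2)), (fun z => (g z.1, z.2)).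
split; first by move=> z [Ez [Yz wz]]; split=> /=; [exact: hc|split=> //; rewrite (pr _ Ez).2].
split; first by move=> z [Ez [Yz wz]]; split=> /=; [exact: gc|split=> //; rewrite pr'].
split; first by move=> [e y] [Ez _] /=; rewrite gh.
split; first by move=> [e y] [Ez _] /=; rewrite hg.
split.
  apply/cont_onP; apply: cont_on_pair; last exact: cont_on_snd.
  by apply: cont_on_comp (@cont_on_fst _ _ _) ch _ => z [].
split.
  apply/cont_onP; apply: cont_on_pair; last exact: cont_on_snd.
  by apply: cont_on_comp (@cont_on_fst _ _ _) cg _ => z [].
split; first by move=> z [Ez _] /=; rewrite (pr _ Ez).1.
by move=> k z [Ez _] kz /=; rewrite eq.
Qed.

Lemma pullback_ext E f f' : (forall y, BY y -> f y = f' y) ->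
  pb_iso (pullback f BY E) (pullback f' BY E).
Proof.
move=> ff; exists id, id.
split; first by move=> z [? [? ?]]; do 2 (split=> //); rewrite -ff.
split; first by move=> z [? [? ?]]; do 2 (split=> //); rewrite ff.
do 2 (split=> //).
by do 2 (split; first by apply/cont_onP; exact: cont_on_id).
Qed.

Lemma pullback_comp (Z : topologicalType) (BZ : set Z) E f (g : Z -> Y) :
  cont_on BZ g -> (forall z, BZ z -> BY (g z)) ->
  pb_iso (pullback g BZ (pullback f BY E)) (pullback (f \o g) BZ E).
Proof.
move=> cg gB; exists (fun z => (z.1.1, z.2)), (fun z => ((z.1, g z.2), z.2)).
split; first by move=> [[e y] z] [/= [Ee [Yy ey]] [Zz yz]]; split=> //=; rewrite -yz.
split; first by move=> [e z] [/= Ee [Zz ez]]; split=> //=; split=> //; split=> //; exact: gB.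
split; first by move=> [[e y] z] [/= [Ee [Yy ey]] [Zz yz]]; rewrite -yz.
split; first by move=> [e z].
split.
  apply/cont_onP; apply: cont_on_pair; last exact: cont_on_snd.
  exact: cont_on_fstc (@cont_on_fst _ _ _).
split; last by split.
apply/cont_onP; apply: cont_on_pair; last exact: cont_on_snd.
apply: cont_on_pair; first exact: cont_on_fst.
by apply: cont_on_comp (@cont_on_snd _ _ _) cg _ => z [_ []].
Qed.

End Pullback.

Lemma pullback_id (X : topologicalType) (B : set X) (E : pbundle G X) (f : X -> X) : pbun B E ->
  (forall x, B x -> f x = x) -> pb_iso (pullback f B E) E.
Proof.
move=> hE fx; exists fst, (fun e => (e, bmap E e)).
split; first by move=> z [].
split; first by move=> e Ee; have Be := pb_base hE Ee; split=> //=; rewrite fx.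
split; first by move=> [e x] [/= Ee [Bx ->]]; rewrite fx.
do 2 split=> //; first by apply/cont_onP; exact: cont_on_fst.
split; first by apply/cont_onP; apply: cont_on_pair; [exact: cont_on_id|exact: pb_map hE].
by split=> // z [Ez [Bz /= ->]]; rewrite fx.
Qed.

Definition section_on (X : topologicalType) (B : set X) (E : pbundle G X) (s : X -> tot E) : Prop :=
  cont_on B s /\ forall x, B x -> carr E (s x) /\ bmap E (s x) = x.

Definition trivial (X : topologicalType) (B : set X) (E : pbundle G X) : Prop := exists s : X -> tot E, section_on B s.

(** Write a point of [E] over [x] as [u . s x] by the translation function. Then [u . s x] is sent
    to [(u th(x)^-1) . t x], which is equivariant over the base, hence an isomorphism. *)
Lemma section_iso (X : topologicalType) (B : set X) x0 (E F : pbundle G X) (s : X -> tot E)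
    (t : X -> tot F) (th : X -> mor G) :
  B x0 -> pbun B E -> pbun B F -> section_on B s -> section_on B t ->
  cont_on B th ->
  (forall x, B x -> gdom G (th x) = bproj E (s x) /\ gcod G (th x) = bproj F (t x)) ->
  pb_iso E F.
Proof.
move=> Bx0 hE hF [cs sP] [ct tP] cth thP.
have [d [d1 d2 d3]] := pb_delta hE.
pose u e := d (e, s (bmap E e)).
pose g e := gcomp G (u e) (ginv G (th (bmap E e))).
have uP e : carr E e -> gdom G (u e) = bproj E (s (bmap E e)) /\ bact E (u e) (s (bmap E e)) = e.
  by move=> Ee; have [Es ws] := sP _ (pb_base hE Ee); apply: d1.
have ug e : carr E e -> gdom G (u e) = gcod G (ginv G (th (bmap E e))).
  move=> Ee; have [t1 _] := thP _ (pb_base hE Ee).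
  by rewrite (cod_inv hG) t1; case: (uP _ Ee).
have gP e : carr E e -> gdom G (g e) = bproj F (t (bmap E e)) /\ gcod G (g e) = bproj E e.
  move=> Ee; have [t1 t2] := thP _ (pb_base hE Ee); have [u1 u2] := uP _ Ee.
  rewrite /g (dom_comp hG) ?(cod_comp hG) ?ug // (dom_inv hG) t2; split=> //.
  have [Es _] := sP _ (pb_base hE Ee).
  by have [_ [<- _]] := pb_act hE Es u1; rewrite u2.
have tB e : carr E e -> carr F (t (bmap E e)) /\ bmap F (t (bmap E e)) = bmap E e.
  by move=> Ee; exact: tP (pb_base hE Ee).
have cw := pb_map hE.
apply: (pbun_morph_iso (f := fun e => bact F (g e) (t (bmap E e))) Bx0) => //.
- by move=> e Ee; have [] := pb_act hF (tB _ Ee).1 (gP _ Ee).1.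
- apply: (cont_on_comp (f := fun e => (g e, t (bmap E e)))) (pb_actc hF) _; last first.
    by move=> e Ee; split=> /=; [case: (tB _ Ee)|case: (gP _ Ee)].
  apply: cont_on_pair; last by apply: cont_on_comp cw ct _; exact: pb_base hE.
  apply: cont_gcomp => //; last first.
    by apply: cont_ginv => //; apply: cont_on_comp cw cth _; exact: pb_base hE.
  apply: cont_on_comp d3 _.
    apply: cont_on_pair; first exact: cont_on_id.
    by apply: cont_on_comp cw cs _; exact: pb_base hE.
  by move=> e Ee; have [? ?] := sP _ (pb_base hE Ee); split.
- move=> e Ee; have [_ [-> ->]] := pb_act hF (tB _ Ee).1 (gP _ Ee).1.
  by split; [case: (gP _ Ee)|case: (tB _ Ee)].
- move=> h e Ee he; have [Eh [ph wh]] := pb_act hE Ee he.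
  have [Es ws] := sP _ (pb_base hE Ee).
  have [u1 u2] := uP _ Ee.
  have hu : gdom G h = gcod G (u e) by have [_ [<- _]] := pb_act hE Es u1; rewrite u2.
  rewrite wh -(pb_comp hF) ?(gP _ Ee).1 ?(gP _ Ee).2 //; last exact: (tB _ Ee).1.
  congr (bact F _ _); rewrite /g wh (compA hG) ?ug //; congr gcomp.
  by rewrite /u wh -{1}u2 -(pb_comp hE) // d2 // (dom_comp hG).
Qed.

End Iso.

(** * Induced bundles *)

Section Induced.
Variables (H G : topGpd) (phi : gfunctor H G).
Hypotheses (hH : gpd H) (hG : gpd G) (hphi : continuous_functor phi).

Let obc : continuous (fob phi). Proof. by case: hphi. Qed.
Let morc : continuous (fmor phi). Proof. by case: hphi => _ []. Qed.
Let fdom h : gdom G (fmor phi h) = fob phi (gdom H h). Proof. by case: hphi => _ [_ []]. Qed.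
Let fcod h : gcod G (fmor phi h) = fob phi (gcod H h). Proof. by case: hphi => _ [_ [_ []]]. Qed.
Let fid x : fmor phi (gid H x) = gid G (fob phi x). Proof. by case: hphi => _ [_ [_ [_ []]]]. Qed.
Let fcomp g h : gdom H g = gcod H h ->
  fmor phi (gcomp H g h) = gcomp G (fmor phi g) (fmor phi h).
Proof. by case: hphi => _ [_ [_ [_ []]]]; auto. Qed.

Lemma cont_fob (S : topologicalType) (A : set S) (f : S -> ob H) :
  cont_on A f -> cont_on A (fun x => fob phi (f x)).
Proof. by move=> cf; exact: (cont_on_comp cf (cont_on_continuous (A := setT) obc)). Qed.

Lemma cont_fmor (S : topologicalType) (A : set S) (f : S -> mor H) :
  cont_on A f -> cont_on A (fun x => fmor phi (f x)).
Proof. by move=> cf; exact: (cont_on_comp cf (cont_on_continuous (A := setT) morc)). Qed.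

Section OneBundle.
Variables (X : topologicalType) (B : set X) (F : pbundle H X).
Hypothesis hF : pbun B F.
Implicit Types (x y : indP G F) (h k : mor H).

Let S := indS phi (F := F).
Let mk x := mkQ phi x.
Let E := induced phi F.

(** The right action of [H] whose orbits are the points of the induced bundle. *)
Definition ind_shift x h : indP G F :=
  ((gcomp G x.1.1 (fmor phi h), gdom H h), bact F (ginv H h) x.2).

Let xhS x h : S x -> gcod H h = x.1.2 -> S (ind_shift x h).
Proof.
move=> [x1 [x2 x3]] hx; have hp : gdom H (ginv H h) = bproj F x.2 by rewrite (dom_inv hH) hx.
split=> /=; first by rewrite (dom_comp hG) // fcod hx.
have [c [p _]] := pb_act hF x2 hp; split=> //.
by rewrite p (cod_inv hH).
Qed.

Let xh_comp x h k : S x -> gcod H h = x.1.2 -> gdom H h = gcod H k ->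
  ind_shift (ind_shift x h) k = ind_shift x (gcomp H h k).
Proof.
move=> [x1 [x2 x3]] hx hk; rewrite /ind_shift /= (dom_comp hH) //.
rewrite -(compA hG) ?fcomp ?fdom ?fcod ?hk //; last by rewrite hx.
rewrite (ginv_comp hH) // (pb_comp hF) //; first by rewrite (dom_inv hH) hx.
by rewrite (dom_inv hH) (cod_inv hH).
Qed.

Let xh_id x : S x -> ind_shift x (gid H x.1.2) = x.
Proof.
case: x => [[g b] f] [/= x1 [x2 x3]].
by rewrite /ind_shift /= fid -x1 (comp_id hG) (dom_id hH) (ginv_id hH) x3 (pb_id hF).
Qed.

Lemma indrelP x y : S x -> S y -> indcls phi x = indcls phi y <->
  exists h, gcod H h = x.1.2 /\ y = ind_shift x h.
Proof.
move=> Sx Sy; split=> [xy|[h [hx yE]]].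
  have : indcls phi y y by right.
  rewrite -xy => -[[_ [_ [h [hx ->]]]]|[_ ->]]; first by exists h.
  by exists (gid H x.1.2); rewrite (cod_id hH) xh_id.
have hy : gdom H h = y.1.2 by rewrite yE.
have yx : x = ind_shift y (ginv H h).
  by rewrite yE xh_comp ?(cod_inv hH) // (comp_inv hH) hx xh_id.
apply/seteqP; split=> z.
- case=> [[_ [Sz [k [kx ->]]]]|[_ ->]].
    left; split=> //; split; first exact: xhS.
    exists (gcomp H (ginv H h) k); rewrite (cod_comp hH) ?(dom_inv hH) ?hx // (cod_inv hH).
    by split=> //; rewrite -/(ind_shift x k) -/(ind_shift y _) -xh_comp ?(dom_inv hH) ?(cod_inv hH) ?hx // -yx.
  left; split=> //; split=> //; exists (ginv H h); rewrite (cod_inv hH); split=> //.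
- case=> [[_ [Sz [k [ky ->]]]]|[_ ->]].
    left; split=> //; split; first exact: xhS.
    exists (gcomp H h k); rewrite (cod_comp hH) ?hx ?hy //.
    by split=> //; rewrite -/(ind_shift y k) -/(ind_shift x _) -xh_comp ?hy // -yE.
  by left; split=> //; split=> //; exists h.
Qed.

Lemma mkQ_eq x y : S x -> S y -> mk x = mk y <->
  exists h, gcod H h = x.1.2 /\ y = ind_shift x h.
Proof.
move=> Sx Sy; rewrite -indrelP //; split=> [[]//|e].
exact: eq_exist.
Qed.

Lemma mkQ_shift x h : S x -> gcod H h = x.1.2 -> mk (ind_shift x h) = mk x.
Proof. by move=> Sx hx; symmetry; apply/mkQ_eq; [|exact: xhS|exists h]. Qed.

Lemma qrepP x : S x -> S (qrep (mk x)) /\ mk (qrep (mk x)) = mk x.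
Proof.
move=> Sx; rewrite /qrep; case: cid => r xr0 /=.
have xr : indcls phi x = indcls phi r by [].
have Sr : S r.
  have : indcls phi x x by right.
  by rewrite xr => -[[]|[]].
by split=> //; exact: eq_exist.
Qed.

(** The choice [qrep] need not be continuous. The structure maps of [induced] go through it, and
    this lemma replaces them by formulas in an arbitrary representative. *)
Let qrep_shift x : S x -> exists h, gcod H h = x.1.2 /\ qrep (mk x) = ind_shift x h.
Proof. by move=> Sx; have [Sr /esym] := qrepP Sx => /mkQ_eq; apply. Qed.

Lemma mkQ_cont : cont_on S mk.
Proof.
move=> x Sx V [U [oU UV]] Vx; exists U; split=> //; split.
  by have /seteqP[h _] := UV; have [] := h x (conj Sx Vx).
by move=> y Uy Sy; have /seteqP[_ h] := UV; have [] := h y (conj Uy Sy).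
Qed.

Let cont_xh : cont_on [set z : indP G F * mor H | S z.1 /\ gcod H z.2 = z.1.1.2]
  (fun z => ind_shift z.1 z.2).
Proof.
set D := [set z | _].
have c1 : cont_on D fst by exact: cont_on_fst.
have c2 : cont_on D snd by exact: cont_on_snd.
apply: cont_on_pair; first apply: cont_on_pair.
- apply: cont_gcomp => //; first exact: cont_on_fstc (cont_on_fstc c1).
    exact: cont_fmor.
  by move=> z [[z1 _] z2]; rewrite fcod z2.
- exact: cont_gdom.
- apply: (cont_on_comp (f := fun z : indP G F * mor H => (ginv H z.2, z.1.2)) _ (pb_actc hF)).
    by apply: cont_on_pair; [exact: cont_ginv|exact: cont_on_sndc].
  by move=> z [[z1 [z2 z3]] z4]; split=> //=; rewrite (dom_inv hH) z4.
Qed.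

(** Orbits of an open set fill an open set: if [x] shifted by [h] lies in [U], so does [z] shifted
    by [k] for [z] near [x] and [k] near [h], and openness of [gcod] provides such a [k] composable
    with [z]. *)
Lemma mkQ_onto : open_onto mk S (carr E).
Proof.
split; first by move=> x Sx; exists x.
  by move=> q [x Sx <-]; exists x.
move=> x0 U Sx0 oU Ux0.
pose V : set (qtot phi F) := mk @` (U `&` S).
exists V; split; last first.
  split; first by exists x0.
  by move=> q [x [Ux Sx] <-] _; exists x.
have [|W [oW hW]] := @open_rel _ [set x | V (mk x)] S.
  move=> x [y [Uy Sy] yx] Sx.
  have [h [hx yE]] : exists h, gcod H h = x.1.2 /\ y = ind_shift x h by apply/mkQ_eq.
  rewrite yE in Uy.
  have [N [oN [Nx NU]]] := cont_xh (x := (x, h)) (conj Sx hx) oU Uy.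
  have [N1 [N2 [oN1 oN2 N1x N2x NN]]] := openX_ex oN Nx.
  have [M [oM [Mh hM]]] := cod_open hH oN2 N2x.
  have c : cont_on S (fun x : indP G F => x.1.2) by apply: cont_on_sndc; exact: cont_on_fst.
  have [|N3 [oN3 [N3x N3M]]] := c _ Sx M oM; first by rewrite -hx.
  exists (N1 `&` N3); split; first exact: openI.
  split=> // z [[N1z N3z] Sz]; have [k [N2k kz]] := hM _ (N3M _ N3z Sz).
  exists (ind_shift z k); last exact: mkQ_shift.
  by split; [exact: (NU (z, k) (NN _ _ N1z N2k) (conj Sz kz))|exact: xhS].
by exists W; split=> //; rewrite -hW setIC; apply/seteqP; split=> z [].
Qed.

Lemma quot_cont (T : topologicalType) (f : qtot phi F -> T) :
  cont_on S (f \o mk) -> cont_on (carr E) f.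
Proof. exact: open_onto_cont mkQ_onto. Qed.

Lemma ind_proj_mk x : S x -> bproj E (mk x) = gcod G x.1.1.
Proof.
move=> Sx; have [h [hx e]] := qrep_shift Sx; rewrite /= e /= (cod_comp hG) // fcod hx.
by case: Sx.
Qed.

Lemma ind_map_mk x : S x -> bmap E (mk x) = bmap F x.2.
Proof.
move=> Sx; have [h [hx e]] := qrep_shift Sx; rewrite /= e /=.
have [_ [x2 x3]] := Sx.
by have [|_ [_ ->]] := pb_act hF (g := ginv H h) x2; rewrite // (dom_inv hH) hx.
Qed.

Lemma ind_mulS g x : S x -> gdom G g = gcod G x.1.1 -> S ((gcomp G g x.1.1, x.1.2), x.2).
Proof. by move=> [x1 x2] gx; split=> //=; rewrite (dom_comp hG). Qed.

Lemma ind_act_mk g x : S x -> gdom G g = gcod G x.1.1 ->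
  bact E g (mk x) = mk ((gcomp G g x.1.1, x.1.2), x.2).
Proof.
move=> Sx gx; have [h [hx e]] := qrep_shift Sx; rewrite /= e.
have [x1 _] := Sx.
symmetry; rewrite -(mkQ_shift (h := h)) //; last exact: ind_mulS.
by rewrite /ind_shift /= -(compA hG) // fcod hx.
Qed.

Lemma induced_pbun : pbun B E.
Proof.
have c11 : cont_on S (fun x : indP G F => x.1.1) by apply: cont_on_fstc; exact: cont_on_fst.
have c12 : cont_on S (fun x : indP G F => x.1.2) by apply: cont_on_sndc; exact: cont_on_fst.
have c2 : cont_on S (fun x : indP G F => x.2) by exact: cont_on_snd.
split.
- apply: quot_cont; apply: cont_on_eq (cont_gcod hG c11) => x Sx /=.
  by rewrite -[RHS]/(bproj E (mk x)) ind_proj_mk.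
- apply: quot_cont; apply: (cont_on_eq (f := fun x : indP G F => bmap F x.2)).
    by move=> x Sx /=; rewrite -[RHS]/(bmap E (mk x)) ind_map_mk.
  by apply: cont_on_comp c2 (pb_map hF) _ => x [_ []].
- by move=> q [x Sx <-]; rewrite ind_map_mk //; apply: (pb_base hF); case: Sx => _ [].
- move=> g q [x Sx <-]; rewrite (ind_proj_mk Sx) => gx; have Sgx := ind_mulS Sx gx.
  rewrite (ind_act_mk Sx gx) (ind_map_mk Sx) (ind_map_mk Sgx) (ind_proj_mk Sgx) /= (cod_comp hG) //.
  by split=> //; exists ((gcomp G g x.1.1, x.1.2), x.2).
- move=> q [x Sx <-]; rewrite ind_proj_mk // ind_act_mk ?(dom_id hG) // (id_comp hG).
  by case: x Sx => [[]].
- move=> g h q [x Sx <-]; rewrite ind_proj_mk // => hx gh.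
  rewrite ind_act_mk ?(dom_comp hG) // [bact E h _]ind_act_mk // ind_act_mk //=.
  + by rewrite (compA hG).
  + exact: ind_mulS.
  + by rewrite (cod_comp hG).
(* The product of the identity with the quotient map is an open surjection, so continuity of the
   action may be checked on representatives. *)
- have oq : open_onto (fun z : mor G * indP G F => (z.1, mk z.2))
      [set z | S z.2 /\ gdom G z.1 = gcod G z.2.1.1] (act_dom E).
    apply: open_onto_sub (open_onto_prod (open_onto_id setT) mkQ_onto) _ _.
      by move=> z [].
    move=> z; split=> [[Sz zz]|[[_ Sz] [_]]]; first split=> //.
      by split=> /=; [exists z.2|rewrite zz -ind_proj_mk].
    by rewrite ind_proj_mk.
  apply: (open_onto_cont oq).
  apply: (cont_on_eq (f := fun z : mor G * indP G F => mk ((gcomp G z.1 z.2.1.1, z.2.1.2), z.2.2))).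
    by move=> z [Sz zz]; exact: esym (ind_act_mk Sz zz).
  apply: cont_on_comp _ mkQ_cont _; last by move=> z [Sz zz]; exact: ind_mulS.
  have k : cont_on [set z : mor G * indP G F | S z.2 /\ gdom G z.1 = gcod G z.2.1.1] snd.
    exact: cont_on_snd.
  apply: cont_on_pair; last exact: cont_on_sndc.
  apply: cont_on_pair; last exact: cont_on_sndc (cont_on_fstc k).
  apply: cont_gcomp => //; first exact: cont_on_fst.
    exact: cont_on_fstc (cont_on_fstc k).
  by move=> z [].
- have [wB ws wo] := pb_onto hF; split.
  + by move=> q [x Sx <-]; rewrite ind_map_mk //; apply: wB; case: Sx => _ [].
  + move=> y /ws[f Ff fy].
    have Sx : S ((gid G (fob phi (bproj F f)), bproj F f), f) by split=> //=; rewrite (dom_id hG).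
    by exists (mk ((gid G (fob phi (bproj F f)), bproj F f), f)); [exists (gid G (fob phi (bproj F f)), bproj F f, f)|rewrite (ind_map_mk Sx)].
  (* Inside a box [U1 x U2 x U3] around a representative, openness of [gdom] lets [g] follow [f]
     without leaving [U1], so all nearby base points are reached. *)
  + move=> q V [x0 Sx0 <-] oV Vx0; have [U [oU [Ux0 UV]]] := mkQ_cont Sx0 oV Vx0.
    case: x0 Sx0 Vx0 Ux0 => [[g0 b0] f0] Sx0 Vx0 Ux0; have [/= g0b [Ff0 b0f]] := Sx0.
    have [U12 [U3 [oU12 oU3 U12x U3x UU]]] := openX_ex oU Ux0.
    have [U1 [U2 [oU1 oU2 U1x U2x UU']]] := openX_ex oU12 U12x.
    have [|N1 [oN1 [N1f hN1]]] := cont_fob (pb_proj hF) Ff0 (dom_open hG oU1).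
      by exists g0 => //; rewrite g0b b0f.
    have [|N2 [oN2 [N2f hN2]]] := pb_proj hF Ff0 oU2; first by rewrite -b0f.
    have [||W [oW [Wf hW]]] := wo f0 (U3 `&` (N1 `&` N2)) Ff0; first by do 2 apply: openI => //.
      by split.
    exists W; split=> //; split.
      by rewrite -[X in W X]/(bmap E (mk ((g0, b0), f0))) (ind_map_mk Sx0).
    move=> y Wy By; have [f [[U3f [N1f' N2f']] Ff fy]] := hW _ Wy By.
    have [g U1g gf] := hN1 _ N1f' Ff.
    have Sx : S ((g, bproj F f), f) by split.
    exists (mk ((g, bproj F f), f)); split; last by rewrite -[LHS]/(bmap E (mk ((g, bproj F f), f))) (ind_map_mk Sx).
      by apply: UV => //; apply: UU => //; apply: UU' => //; exact: hN2.
    by exists (g, bproj F f, f).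
- have [d [d1 d2 d3]] := pb_delta hF.
  (* If [f = h . f'], the class of [(g, f)] is that of [(g phi(h), f')], which differs from the
     class of [(g', f')] by [g phi(h) g'^-1]. *)
  pose d0 (z : indP G F * indP G F) :=
    gcomp G (gcomp G z.1.1.1 (fmor phi (d (z.1.2, z.2.2)))) (ginv G z.2.1.1).
  have d0P x x' : S x -> S x' -> bmap F x.2 = bmap F x'.2 ->
      [/\ gcod H (d (x.2, x'.2)) = x.1.2, gdom H (d (x.2, x'.2)) = x'.1.2,
        gdom G (d0 (x, x')) = gcod G x'.1.1 & bact E (d0 (x, x')) (mk x') = mk x].
    move=> Sx Sx' w; have [x1 [x2 x3]] := Sx; have [x1' [x2' x3']] := Sx'.
    have [p a] := d1 _ _ x2 x2' w.
    have cd : gcod H (d (x.2, x'.2)) = x.1.2.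
      by have [_ [<- _]] := pb_act hF x2' p; rewrite a x3.
    have e1 : gdom G x.1.1 = gcod G (fmor phi (d (x.2, x'.2))) by rewrite fcod cd.
    have e2 : gdom G (gcomp G x.1.1 (fmor phi (d (x.2, x'.2)))) = gdom G x'.1.1.
      by rewrite (dom_comp hG) // fdom p x1' x3'.
    have e3 : gdom G (d0 (x, x')) = gcod G x'.1.1.
      by rewrite /d0 /= (dom_comp hG) ?(dom_inv hG) // (cod_inv hG).
    split=> //; first by rewrite p x3'.
    rewrite ind_act_mk // /d0 /= gcompVKr //.
    have := mkQ_shift Sx cd; rewrite /ind_shift p -x3' => <-; congr (mk (_, _)).
    rewrite -{2}a -(pb_comp hF) //; last by rewrite (dom_inv hH).
    by rewrite (inv_comp hH) p (pb_id hF).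
  (* Two translates of [x] in one class are related by some [h] fixing the point of [F]; that [h] is
     a unit because [F] is principal. *)
  have free g g' x : S x -> gdom G g = gcod G x.1.1 -> gdom G g' = gcod G x.1.1 ->
      bact E g (mk x) = bact E g' (mk x) -> g = g'.
    move=> Sx gx gx'; rewrite !ind_act_mk // => /mkQ_eq[||h [hx]]; try exact: ind_mulS.
    have [_ [x2 x3]] := Sx.
    rewrite /ind_shift /= => -[e1 e2 e3].
    have hi : ginv H h = gid H (bproj F x.2).
      apply: (act_free hF x2); rewrite ?(dom_inv hH) ?(dom_id hH) ?hx //.
      by rewrite -e3 (pb_id hF).
    have hE : h = gid H (bproj F x.2) by rewrite -(ginvK hH h) hi (ginv_id hH).
    apply: (@gcomp_injr _ hG _ _ x.1.1) => //; rewrite e1 hE fid -x3.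
    have [x1 _] := Sx.
    by rewrite -x1 -(dom_comp hG gx) (comp_id hG).
  exists (fun r => d0 (qrep r.1, qrep r.2)).
  (* Freeness shows that [d0] does not depend on the representatives. *)
  have dE x x' : S x -> S x' -> bmap F x.2 = bmap F x'.2 ->
      d0 (qrep (mk x), qrep (mk x')) = d0 (x, x').
    move=> Sx Sx' w; have [Sr re] := qrepP Sx; have [Sr' re'] := qrepP Sx'.
    have wr : bmap F (qrep (mk x)).2 = bmap F (qrep (mk x')).2.
      by rewrite -(ind_map_mk Sr) re -(ind_map_mk Sr') re' !ind_map_mk.
    have [_ _ h1 h2] := d0P _ _ Sr Sr' wr; have [_ _ h3 h4] := d0P _ _ Sx Sx' w.
    apply: (free _ _ x' Sx') => //; last by rewrite h4; transitivity (mk (qrep (mk x))); rewrite // -h2 re'.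
    by rewrite h1 -!ind_proj_mk // re'.
  split.
  + move=> q q' [x Sx <-] [x' Sx' <-]; rewrite !ind_map_mk // => w.
    by rewrite dE // ind_proj_mk //; case: (d0P _ _ Sx Sx' w).
  + move=> g q [x Sx <-]; rewrite ind_proj_mk // => gx; rewrite ind_act_mk //.
    have Sgx := ind_mulS Sx gx.
    rewrite dE //; have [_ _ h1 h2] := d0P _ _ Sgx Sx erefl.
    by apply: (free _ _ x Sx) => //; rewrite h2 ind_act_mk.
  + have oq := open_onto_sub (open_onto_prod mkQ_onto mkQ_onto)
      (B' := [set r | carr E r.1 /\ carr E r.2 /\ bmap E r.1 = bmap E r.2])
      (A' := [set z | [/\ S z.1, S z.2 & bmap F z.1.2 = bmap F z.2.2]]).
    apply: (open_onto_cont (oq _ _)).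
    * by move=> r [? []].
    * move=> z; split=> [[z1 z2 zz]|[[z1 z2] [_ [_]]]].
        by split=> //; split; [exists z.1|split; [exists z.2|rewrite !ind_map_mk]].
      by rewrite !ind_map_mk.
    * set D := [set z | _].
      apply: (cont_on_eq (f := d0)); first by move=> z [z1 z2 zz] /=; rewrite dE //; case: z {z1 z2 zz}.
      have k1 : cont_on D (fun z => z.1) by exact: cont_on_fst.
      have k2 : cont_on D (fun z => z.2) by exact: cont_on_snd.
      apply: cont_gcomp => //; last first.
      - move=> z [z1 z2 zz]; have [cd dd _ _] := d0P _ _ z1 z2 zz.
        have [x1 _] := z1; have [x2 _] := z2.
        by rewrite (cod_inv hG) x2 -dd -fdom (dom_comp hG) // x1 -cd fcod.
      - by apply: cont_ginv => //; exact: cont_on_fstc (cont_on_fstc k2).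
      apply: cont_gcomp => //; first exact: cont_on_fstc (cont_on_fstc k1).
        apply: cont_fmor; apply: (cont_on_comp (f := fun z : indP G F * indP G F => (z.1.2, z.2.2))) d3 _.
          by apply: cont_on_pair; [exact: cont_on_sndc k1|exact: cont_on_sndc k2].
        by move=> z [[_ [z1 _]] [_ [z2 _]] zz].
      move=> z [z1 z2 zz]; have [c _ _ _] := d0P _ _ z1 z2 zz.
      by rewrite fcod c; case: z1.
Qed.

End OneBundle.
End Induced.

(** * Local sections and lifting *)

Section InducedMaps.
Variables (H G : topGpd) (phi : gfunctor H G).
Hypotheses (hH : gpd H) (hG : gpd G) (hphi : continuous_functor phi).

(** The universal property of the quotient: an equivariant map on representatives that is constant
    on orbits descends to a bundle map, and bundle maps are isomorphisms. *)
Lemma induced_iso_of_map (X : topologicalType) (B : set X) x0 (F : pbundle H X) (K : pbundle G X)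
    (m : indP G F -> tot K) :
  B x0 -> pbun B F -> pbun B K ->
  (forall x, indS phi x -> [/\ carr K (m x), bproj K (m x) = gcod G x.1.1 & bmap K (m x) = bmap F x.2]) ->
  cont_on (indS phi (F := F)) m ->
  (forall x h, indS phi x -> gcod H h = x.1.2 -> m (ind_shift phi x h) = m x) ->
  (forall g x, indS phi x -> gdom G g = gcod G x.1.1 ->
     m ((gcomp G g x.1.1, x.1.2), x.2) = bact K g (m x)) ->
  pb_iso (induced phi F) K.
Proof.
move=> Bx0 hF hK mP cm ms ma.
have mE x : indS phi x -> m (qrep (mkQ phi x)) = m x.
  move=> Sx; have [Sr re] := qrepP Sx.
  have [h [hx e]] := (mkQ_eq hH hG hphi hF Sx Sr).1 (esym re).
  by rewrite e ms.
have hE := induced_pbun hH hG hphi hF.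
apply: (pbun_morph_iso hG (E := induced phi F) (f := fun q => m (qrep q)) Bx0 hE hK).
- by move=> q [x Sx <-]; rewrite mE //; case: (mP _ Sx).
- apply: (open_onto_cont (mkQ_onto hH hG hphi hF)).
  by apply: cont_on_eq cm => x Sx /=; rewrite mE.
- move=> q [x Sx <-]; rewrite mE //; have [_ -> ->] := mP _ Sx.
  by rewrite (ind_proj_mk hH hG hphi hF Sx) (ind_map_mk hH hG hphi hF Sx).
- move=> g q [x Sx <-]; rewrite (ind_proj_mk hH hG hphi hF Sx) => gx.
  by rewrite (ind_act_mk hH hG hphi hF Sx gx) !mE ?ma //; exact: ind_mulS.
Qed.

Lemma induced_iso (X : topologicalType) (B : set X) x0 (E F : pbundle H X) :
  B x0 -> pbun B E -> pbun B F -> pb_iso E F -> pb_iso (induced phi E) (induced phi F).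
Proof.
move=> Bx0 hE hF [f [g [fc [gc [gf [fg [/cont_onP cf [cg [pr eq]]]]]]]]].
have Sf (x : indP G E) : indS phi x -> indS phi ((x.1, f x.2) : indP G F).
  by move=> [x1 [x2 x3]]; split=> //; split=> /=; [exact: fc|rewrite (pr _ x2).1].
have hI := induced_pbun hH hG hphi hF.
apply: (@induced_iso_of_map _ _ _ E (induced phi F) (fun x => mkQ phi ((x.1, f x.2) : indP G F)) Bx0 hE hI).
- move=> x Sx; rewrite (ind_proj_mk hH hG hphi hF (Sf _ Sx)) (ind_map_mk hH hG hphi hF (Sf _ Sx)).
  split=> //=; first by exists (x.1, f x.2) => //; exact: Sf.
  by case: Sx => _ [x2 _]; rewrite (pr _ x2).2.
- apply: cont_on_comp _ (@mkQ_cont _ _ phi _ F) _; last by move=> x /Sf.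
  apply: cont_on_pair; first exact: cont_on_fst.
  by apply: cont_on_comp (@cont_on_snd _ _ _) cf _ => x [_ []].
- move=> x h Sx hx; rewrite -(mkQ_shift hH hG hphi hF (Sf _ Sx) hx) /ind_shift /=.
  have [_ [x2 x3]] := Sx.
  by rewrite eq // (dom_inv hH) hx.
- by move=> k x Sx kx; rewrite (ind_act_mk hH hG hphi hF (Sf _ Sx)).
Qed.

Lemma induced_pullback (X Y : topologicalType) (B : set X) (BY : set Y) y0 (F : pbundle H X) (f : Y -> X) :
  BY y0 -> pbun B F -> cont_on BY f -> (forall y, BY y -> B (f y)) ->
  pb_iso (induced phi (pullback f BY F)) (pullback f BY (induced phi F)).
Proof.
move=> By0 hF cf fB; set P := pullback f BY F.
have hP : pbun BY P := pullback_pbun hF cf fB.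
have hE := induced_pbun hH hG hphi hF.
pose l (x : indP G P) : indP G F := (x.1, x.2.1).
have Sl x : indS phi x -> indS phi (l x) by move=> [x1 [[x2 _] x3]].
apply: (@induced_iso_of_map _ _ _ P (pullback f BY (induced phi F))
  (fun x => (mkQ phi (l x), x.2.2)) By0 hP (pullback_pbun hE cf fB)).
- move=> x Sx; have Slx := Sl _ Sx; have [_ [[_ [Yx wx]] _]] := Sx; split=> //=.
    split; first by exists (l x).
    by split=> //; rewrite -[LHS]/(bmap (induced phi F) (mkQ phi (l x))) (ind_map_mk hH hG hphi hF Slx).
  by rewrite -[LHS]/(bproj (induced phi F) (mkQ phi (l x))) (ind_proj_mk hH hG hphi hF Slx).
- have c2 : cont_on (indS phi (F := P)) (fun x : indP G P => x.2) by exact: cont_on_snd.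
  apply: cont_on_pair; last exact: cont_on_sndc c2.
  apply: (cont_on_comp _ (@mkQ_cont _ _ phi _ F)); last by move=> x /Sl; apply.
  by apply: cont_on_pair; [exact: cont_on_fst|exact: cont_on_fstc c2].
- by move=> x h Sx hx; rewrite -(mkQ_shift hH hG hphi hF (Sl _ Sx) hx).
- move=> k x Sx kx /=; congr (_, _).
  by rewrite -[RHS]/(bact (induced phi F) k (mkQ phi (l x))) (ind_act_mk hH hG hphi hF (Sl _ Sx)).
Qed.

End InducedMaps.

Section LocalSections.
Variable G : topGpd.
Hypotheses (hG : gpd G) (eG : local_homeomorphism (gdom G)).

(** Near the diagonal point [(e0, e0)] the translation [d (e, e')] stays in a set [W] around a unit
    on which [gdom] is injective. It has the same domain as the unit at [e'], so it is that unit and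
    [e = e']. Thus [bmap E] is injective near [e0], and as it is open its local inverse is
    continuous. *)
Lemma local_section (X : topologicalType) (B : set X) (E : pbundle G X) x0 :
  pbun B E -> B x0 ->
  exists U : set X, open U /\ U x0 /\
  exists s : X -> tot E, cont_on (U `&` B) s /\
    forall x, U x -> B x -> carr E (s x) /\ bmap E (s x) = x.
Proof.
move=> hE Bx0; have [_ ws wo] := pb_onto hE.
have [e0 Ee0 we0] := ws _ Bx0.
have [d [d1 d2 d3]] := pb_delta hE.
have did e : carr E e -> d (e, e) = gid G (bproj E e).
  by move=> Ee; rewrite -{1}(pb_id hE Ee) d2 // (dom_id hG).
have [W [oW [Wid [_ [Winj _]]]]] := eG.2 (gid G (bproj E e0)).
have [|N [oN [Ne hN]]] := d3 (e0, e0) (conj Ee0 (conj Ee0 erefl)) W oW; first by rewrite did.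
have [N1 [N2 [oN1 oN2 N1e N2e NN]]] := openX_ex oN Ne.
have [N3 [oN3 [N3e hN3]]] := cont_gid hG (pb_proj hE) Ee0 oW Wid.
pose M := N1 `&` (N2 `&` N3).
have oM : open M by do 2 apply: openI => //.
have inj e e' : M e -> M e' -> carr E e -> carr E e' -> bmap E e = bmap E e' -> e = e'.
  move=> [N1e' _] [_ [N2e' N3e']] Ee Ee' ee.
  have [p a] := d1 _ _ Ee Ee' ee.
  rewrite -a (Winj (d (e, e')) (gid G (bproj E e'))) ?(pb_id hE) //.
  - by apply: hN; [exact: NN|].
  - exact: hN3.
  - by rewrite p (dom_id hG).
have [|U [oU [Ue hU]]] := wo e0 M Ee0 oM; first by split=> //; split.
exists U; rewrite -{1}we0; split=> //; split=> //.
have /choice[s sP] : forall x, exists e, U x -> B x -> [/\ M e, carr E e & bmap E e = x].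
  move=> x; have [Ux|] := pselect (U x); last by exists e0.
  have [Bx|] := pselect (B x); last by exists e0.
  by have [e eP] := hU _ Ux Bx; exists e.
exists s; split; last by move=> x Ux Bx; have [] := sP _ Ux Bx.
move=> x [Ux Bx] V oV Vs; have [Ms Es ws'] := sP _ Ux Bx.
have [||Z [oZ [Zx hZ]]] := wo (s x) (V `&` M) Es; first exact: openI.
  by split.
exists Z; split=> //; split; first by rewrite -ws'.
move=> y Zy [Uy By]; have [e [[Ve Me] Ee ey]] := hZ _ Zy By.
have [Ms' Es' ws''] := sP _ Uy By.
by rewrite (inj (s y) e) // ws''.
Qed.

Lemma trivial_pullback (X Y : topologicalType) (U B : set X) (BY : set Y) (E : pbundle G X)
    (f : Y -> X) (s : X -> tot E) :
  cont_on (U `&` B) s -> (forall x, U x -> B x -> carr E (s x) /\ bmap E (s x) = x) ->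
  cont_on BY f -> (forall y, BY y -> U (f y) /\ B (f y)) -> trivial BY (pullback f BY E).
Proof.
move=> cs sP cf fU; exists (fun y => (s (f y), y)); split.
  by apply: cont_on_pair; [exact: cont_on_comp cf cs fU|exact: cont_on_id].
by move=> y By; have [Uy BBy] := fU _ By; have [? ?] := sP _ Uy BBy.
Qed.

(** The pullback along [u] of the bundle [gdom : mor G -> ob G], on which [G] acts by composition;
    the units give its canonical section. *)
Definition unit_bundle (X : topologicalType) (B : set X) (u : X -> ob G) : pbundle G X :=
  @PBundle G X (mor G * X)%type [set z | gdom G z.1 = u z.2 /\ B z.2]
    (fun z => gcod G z.1) snd (fun g z => (gcomp G g z.1, z.2)).

Lemma unit_pbun (X : topologicalType) (B : set X) (u : X -> ob G) :
  cont_on B u -> pbun B (unit_bundle B u).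
Proof.
move=> cu; set D := carr (unit_bundle B u).
have c1 : cont_on D (fun z : mor G * X => z.1) by exact: cont_on_fst.
split.
- exact: cont_gcod.
- exact: cont_on_snd.
- by move=> z [].
- by move=> g z [z1 z2] gz; rewrite /= (dom_comp hG) // (cod_comp hG).
- by move=> [g x] _ /=; rewrite (id_comp hG).
- by move=> g h [k x] _ /= hk gh; rewrite (compA hG).
- have c2 : cont_on (act_dom (unit_bundle B u)) (fun q : mor G * (mor G * X) => q.2) by exact: cont_on_snd.
  apply: cont_on_pair; last exact: cont_on_sndc.
  apply: cont_gcomp => //; first exact: cont_on_fst.
    exact: cont_on_fstc.
  by move=> q [].
- split; first by move=> z [].
    by move=> x Bx; exists (gid G (u x), x) => //; split=> //=; rewrite (dom_id hG).
  move=> [g x] U [/= gu Bx] oU Ux.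
  have [U1 [U2 [oU1 oU2 U1x U2x UU]]] := openX_ex oU Ux.
  have [|N [oN [Nx hN]]] := cu _ Bx _ (dom_open hG oU1); first by exists g.
  exists (N `&` U2); split; first exact: openI.
  split=> // y [Ny Uy] By; have [h Uh hy] := hN _ Ny By.
  by exists (h, y); split=> //; exact: UU.
- exists (fun r : (mor G * X) * (mor G * X) => gcomp G r.1.1 (ginv G r.2.1)); split.
  + move=> [g x] [g' x'] [/= gx Bx] [/= gx' Bx'] xx; subst x'.
    by rewrite (dom_comp hG) ?(cod_inv hG) ?gx // (dom_inv hG) gcompVKr // gx gx'.
  + by move=> g [h x] [/= hx Bx] gh; rewrite gcompKr.
  + set D2 := [set r | _].
    have k1 : cont_on D2 (fun r => r.1) by exact: cont_on_fst.
    have k2 : cont_on D2 (fun r => r.2) by exact: cont_on_snd.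
    apply: cont_gcomp => //; first exact: cont_on_fstc k1.
      by apply: cont_ginv => //; exact: cont_on_fstc k2.
    move=> [[g x] [g' x']] [/= [/= gx _] [[/= gx' _] xx]].
    by rewrite (cod_inv hG) gx gx' xx.
Qed.

End LocalSections.

Section Lifting.
Variables (H G : topGpd) (phi : gfunctor H G).
Hypotheses (hH : gpd H) (hG : gpd G) (hphi : continuous_functor phi).
Hypotheses (eH : local_homeomorphism (gdom H)) (eG : local_homeomorphism (gdom G)).
Hypotheses (hob : homeomorphism (fob phi)) (hsurj : forall g, exists h, fmor phi h = g).

Variables (X : topologicalType) (B : set X) (x0 : X).
Hypothesis Bx0 : B x0.

Let fdom h : gdom G (fmor phi h) = fob phi (gdom H h). Proof. by case: hphi => _ [_ []]. Qed.
Let fcod h : gcod G (fmor phi h) = fob phi (gcod H h). Proof. by case: hphi => _ [_ [_ []]]. Qed.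

(** Moving the anchor of [s] through the homeomorphism of objects gives a map to [ob H]. The
    canonical section of its unit bundle induces a section lying over the same objects of [G] as
    [s], so identities compare the two. *)
Lemma trivial_lift (E : pbundle G X) : pbun B E -> trivial B E ->
  exists F : pbundle H X, pbun B F /\ trivial B F /\ pb_iso (induced phi F) E.
Proof.
move=> hE [s [cs sP]]; have [cphi [psi [phK [psK cpsi]]]] := hob.
pose u x := psi (bproj E (s x)).
have cu : cont_on B u.
  apply: (cont_on_comp _ (cont_on_continuous (A := setT) cpsi)) => //.
  by apply: cont_on_comp cs (pb_proj hE) _ => x /sP[].
have hF := unit_pbun hH cu; set F := unit_bundle B u in hF *.
pose t x : tot F := (gid H (u x), x).
have ct : cont_on B t by apply: cont_on_pair; [exact: cont_gid|exact: cont_on_id].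
exists F; split=> //; split.
  by exists t; split=> // x Bx; split=> //; split=> //=; rewrite (dom_id hH).
pose l x : indP G F := ((gid G (fob phi (u x)), u x), t x).
have Sl x : B x -> indS phi (l x).
  move=> Bx; split=> /=; first by rewrite (dom_id hG).
  by split; [split=> //=; rewrite (dom_id hH)|rewrite (cod_id hH)].
have hI := induced_pbun hH hG hphi hF.
have up x : fob phi (u x) = bproj E (s x) by rewrite /u psK.
apply: (section_iso hG (E := induced phi F) (s := fun x => mkQ phi (l x)) (t := s)
  (th := fun x => gid G (bproj E (s x))) Bx0 hI hE) => //.
- split; last by move=> x Bx; rewrite (ind_map_mk hH hG hphi hF (Sl _ Bx)); split=> //; exists (l x) => //; exact: Sl.
  apply: cont_on_comp _ (@mkQ_cont _ _ phi _ F) _; last by move=> x /Sl.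
  apply: cont_on_pair => //; apply: cont_on_pair => //.
  by apply: cont_gid => //; exact: cont_fob.
- by apply: cont_gid => //; apply: cont_on_comp cs (pb_proj hE) _ => x /sP[].
- move=> x Bx; rewrite (ind_proj_mk hH hG hphi hF (Sl _ Bx)) /=.
  by rewrite (dom_id hG) !(cod_id hG) up.
Qed.

(* An isomorphism of the induced bundles is a map into the morphisms of [G];
   locally it lifts to [H], because [fmor phi] commutes with the local
   homeomorphisms [gdom] and is onto. *)
Lemma local_iso (E F : pbundle H X) (s : X -> tot E) (t : X -> tot F) x :
  pbun B E -> pbun B F -> section_on B s -> section_on B t ->
  pb_iso (induced phi E) (induced phi F) -> B x ->
  exists U : set X, open U /\ U x /\ exists th : X -> mor H, cont_on (U `&` B) th /\
    forall y, U y -> B y -> gdom H (th y) = bproj E (s y) /\ gcod H (th y) = bproj F (t y).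
Proof.
move=> hE hF [cs sP] [ct tP] [f [_ [fc [_ [_ [_ [/cont_onP cf [_ [pr _]]]]]]]]] Bx.
have [_ [psi [phK [_ _]]]] := hob.
have hI := induced_pbun hH hG hphi hE; have hJ := induced_pbun hH hG hphi hF.
(* A section [r] of [K] induces the section of [induced phi K] given by the classes of
   [(id, r y)]. *)
have lP (K : pbundle H X) (r : X -> tot K) : pbun B K -> section_on B r ->
   exists l : X -> tot (induced phi K), cont_on B l /\ forall y, B y ->
     [/\ carr (induced phi K) (l y), bproj (induced phi K) (l y) = fob phi (bproj K (r y)) &
         bmap (induced phi K) (l y) = y].
  move=> hK [cr rP].
  have cp : cont_on B (fun y => bproj K (r y)) by apply: cont_on_comp cr (pb_proj hK) _ => y /rP[].
  pose l y : indP G K := ((gid G (fob phi (bproj K (r y))), bproj K (r y)), r y).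
  have Sl y : B y -> indS phi (l y).
    by move=> By; split=> /=; rewrite ?(dom_id hG) //; split=> //; case: (rP _ By).
  exists (fun y => mkQ phi (l y)); split.
    apply: cont_on_comp _ (@mkQ_cont _ _ phi _ K) _; last by move=> y /Sl.
    apply: cont_on_pair => //; apply: cont_on_pair => //.
    by apply: cont_gid => //; exact: cont_fob.
  move=> y By; rewrite (ind_proj_mk hH hG hphi hK (Sl _ By)) (ind_map_mk hH hG hphi hK (Sl _ By)).
  by rewrite /= (cod_id hG); split=> //; [exists (l y) => //; exact: Sl|case: (rP _ By)].
have [ls [cls lsP]] := lP E s hE (conj cs sP); have [lt [clt ltP]] := lP F t hF (conj ct tP).
have [d [d1 d2 d3]] := pb_delta hJ.
pose th y := d (lt y, f (ls y)).
have thP y : B y -> gdom G (th y) = fob phi (bproj E (s y)) /\ gcod G (th y) = fob phi (bproj F (t y)).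
  move=> By; have [c1 p1 w1] := lsP _ By; have [c2 p2 w2] := ltP _ By.
  have [pf wf] := pr _ c1.
  have [|e1 e2] := d1 (lt y) (f (ls y)) c2 (fc _ c1); first by rewrite wf w1.
  split; first by rewrite e1 pf.
  by have [_ [<- _]] := pb_act hJ (fc _ c1) e1; rewrite e2.
have cth : cont_on B th.
  apply: (cont_on_comp (f := fun y => (lt y, f (ls y))) _ d3).
    by apply: cont_on_pair => //; apply: cont_on_comp cls cf _ => y /lsP[].
  move=> y By; have [c1 p1 w1] := lsP _ By; have [c2 p2 w2] := ltP _ By.
  by split=> //; split; [exact: fc|exact: etrans w2 (esym (etrans (pr _ c1).2 w1))].
have [h0 h0E] := hsurj (th x).
(* Injectivity on objects forces a lift of [th x] to start at the anchor of [s x]. *)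
have h0d : gdom H h0 = bproj E (s x).
  by apply: (can_inj phK); rewrite -fdom h0E (thP _ Bx).1.
have [U [oU [Uh [_ [Uinj Uo]]]]] := eH.2 h0.
have [W [oW [Wth [_ [Winj _]]]]] := eG.2 (th x).
pose U' := U `&` (fmor phi @^-1` W).
have oU' : open U'.
  apply: openI => //; apply: open_comp => // y _.
  by case: hphi => _ [cm _]; exact: cm.
have oD : open (gdom H @` U') by apply: Uo => //; exact: subIsetl.
have cp : cont_on B (fun y => bproj E (s y)) by apply: cont_on_comp cs (pb_proj hE) _ => y /sP[].
have [|N1 [oN1 [N1x hN1]]] := cp _ Bx _ oD.
  by exists h0 => //; split=> //=; rewrite h0E.
have [N2 [oN2 [N2x hN2]]] := cth _ Bx _ oW Wth.
(* In [U'] there is one arrow with domain the anchor of [s y]. It maps to [th y], since both lie in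
   [W] and have the same domain; injectivity on [U] makes the choice continuous. *)
have /choice[sg sgP] : forall y, exists h, N1 y -> B y -> U' h /\ gdom H h = bproj E (s y).
  move=> y; have [Ny|] := pselect (N1 y); last by exists h0.
  have [By|] := pselect (B y); last by exists h0.
  by have [h Uh' hy] := hN1 _ Ny By; exists h.
exists (N1 `&` N2); split; first exact: openI.
split=> //; exists sg; split; last first.
  move=> y [Ny1 Ny2] By; have [[_ /= Wsg] sgd] := sgP _ Ny1 By; split=> //.
  apply: (can_inj phK); rewrite -fcod -(thP _ By).2; congr gcod.
  by apply: Winj => //; [exact: hN2|rewrite fdom sgd (thP _ By).1].
move=> y [[Ny1 Ny2] By] V oV Vsg; have [[Usg _] sgd] := sgP _ Ny1 By.
have oVU : open (gdom H @` (V `&` U)) by apply: Uo; [exact: openI|exact: subIsetr].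
have [|N3 [oN3 [N3y hN3]]] := cp _ By _ oVU; first by exists (sg y).
exists N3; split=> //; split=> // z N3z [[Nz1 Nz2] Bz].
have [h [Vh Uh'] hz] := hN3 _ N3z Bz.
have [[Usz _] szd] := sgP _ Nz1 Bz.
by rewrite (Uinj (sg z) h) // szd.
Qed.

End Lifting.

(** * Affine simplices *)

Section Simplex.
Context {R : realType}.
Implicit Types (m n : nat).

(** Linear on the whole ambient space, of which the vertices of the standard simplex are the basis;
    on [Delta] it is the affine simplex with vertices [w]. *)
Definition aff n (V : lmodType R) (w : seq V) (x : simp R n) : V :=
  \sum_(i < n.+1) x ord0 i *: w`_i.

Lemma aff_is_linear n (V : lmodType R) (w : seq V) : linear (@aff n V w).
Proof.
move=> a x y; rewrite /aff scaler_sumr -big_split; apply: eq_bigr => i _.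
by rewrite /= !mxE scalerDl scalerA.
Qed.
HB.instance Definition _ n (V : lmodType R) (w : seq V) :=
  GRing.isLinear.Build R (simp R n) V *:%R (@aff n V w) (@aff_is_linear n V w).

Lemma aff_map n (V W : lmodType R) (f : {linear V -> W}) (w : seq V) (x : simp R n) :
  size w = n.+1 -> aff (map f w) x = f (aff w x).
Proof.
move=> sw; rewrite /aff linear_sum; apply: eq_bigr => i _.
by rewrite (nth_map 0) ?sw // linearZ.
Qed.

Definition vertices n : seq (simp R n) := [seq delta_mx ord0 i | i <- enum 'I_n.+1].

Lemma size_vertices n : size (vertices n) = n.+1.
Proof. by rewrite size_map size_enum_ord. Qed.

Lemma nth_vertices n (i : 'I_n.+1) : (vertices n)`_i = delta_mx ord0 i.
Proof. by rewrite (nth_map ord0) ?size_enum_ord // nth_ord_enum. Qed.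

Lemma aff_vertices n (x : simp R n) : aff (vertices n) x = x.
Proof.
rewrite [RHS]row_sum_delta; apply: eq_bigr => i _; by rewrite nth_vertices.
Qed.

Lemma map_aff_vertices n (V : lmodType R) (w : seq V) : size w = n.+1 ->
  map (@aff n V w) (vertices n) = w.
Proof.
move=> sw; apply: (@eq_from_nth _ 0); first by rewrite size_map size_vertices sw.
move=> i; rewrite size_map size_vertices => ni.
rewrite (nth_map 0) ?size_vertices // (nth_vertices (Ordinal ni)) /aff.
rewrite (bigD1 (Ordinal ni)) //= mxE !eqxx scale1r big1 ?addr0 // => j ji.
by rewrite mxE eqxx (negbTE ji) scale0r.
Qed.

Definition drop_at (T : Type) i (w : seq T) := take i w ++ drop i.+1 w.

Lemma drop_at_map (T T' : Type) (f : T -> T') i w : drop_at i (map f w) = map f (drop_at i w).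
Proof. by rewrite /drop_at map_cat map_take map_drop. Qed.

Lemma size_drop_at (T : Type) i n (w : seq T) : (i <= n)%N -> size w = n.+1 -> size (drop_at i w) = n.
Proof.
by move=> ni sw; rewrite size_cat size_drop size_take sw ltnS ni subSS subnKC.
Qed.

Lemma nth_drop_at (T : Type) (x : T) i j (w : seq T) : (i < size w)%N ->
  nth x (drop_at i w) j = nth x w (bump i j).
Proof.
move=> iw; rewrite nth_cat size_take iw /bump.
case: ltnP => ij; first by rewrite nth_take.
by rewrite nth_drop add1n addSn subnKC.
Qed.

Lemma ez_lbd (V : Type) (M : zmodType) (g : seq V -> M) (w : seq V) :
  ez g (lbd w) = \sum_(i < size w) g (drop_at i w) *~ (-1) ^+ i.
Proof.
elim: w g => [|v w IH] g; first by rewrite ez_nil big_ord0.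
rewrite ez_cons mulr1z ez_map ez_opp IH big_ord_recl /= expr0 mulr1z /drop_at /= drop0.
rewrite -sumrN; congr (_ + _); apply: eq_bigr => i _.
by rewrite /= /bump /= add1n exprS mulN1r mulrNz.
Qed.

Lemma face_aff n (i : 'I_n.+2) (x : simp R n) : face i x = aff (drop_at i (vertices n.+1)) x.
Proof.
apply/rowP => j; rewrite mxE /aff summxE.
under eq_bigr => k _.
  rewrite nth_drop_at ?size_vertices // (nth_vertices (lift i k)) !mxE eqxx /=.
over.
case: unliftP => [k ->|->]; last first.
  by rewrite big1 // => k _; rewrite (negbTE (neq_lift _ _)) mulr0.
rewrite (bigD1 k) //= eqxx mulr1 big1 ?addr0 // => l lk.
by rewrite (inj_eq lift_inj) eq_sym (negbTE lk) mulr0.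
Qed.

Lemma aff_face n (V : lmodType R) (w : seq V) (i : 'I_n.+2) (x : simp R n) : size w = n.+2 ->
  aff w (face i x) = aff (drop_at i w) x.
Proof.
move=> sw; rewrite face_aff -aff_map; last first.
  by apply: size_drop_at; rewrite ?size_vertices // -ltnS.
by rewrite -drop_at_map map_aff_vertices.
Qed.

Lemma Delta_bary m (w : seq (simp R m)) : w != [::] -> {in w, forall v, Delta R m v} ->
  Delta R m (bary w).
Proof.
move=> w0 wD; have sw : (size w)%:R != 0 :> R by rewrite pnatr_eq0 size_eq0.
split=> [i|]; rewrite /bary.
  rewrite mxE mulr_ge0 ?invr_ge0 // summxE big_seq sumr_ge0 // => v /wD[] //.
under eq_bigr => i _ do rewrite mxE summxE.
rewrite -mulr_sumr exchange_big /= big_seq.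
rewrite (eq_bigr (fun=> 1)); last by move=> v /wD[].
by rewrite -big_seq big_const_seq count_predT iter_addr_0 mulVf.
Qed.

Definition good_simplex m n (w : seq (simp R m)) :=
  size w = n.+1 /\ {in w, forall v, Delta R m v}.

Lemma aff_Delta m n (w : seq (simp R m)) (x : simp R n) :
  good_simplex n w -> Delta R n x -> Delta R m (aff w x).
Proof.
move=> [sw wD] [x0 x1].
have wi (i : 'I_n.+1) : Delta R m w`_i by apply: wD; rewrite mem_nth // sw.
split=> [j|]; rewrite /aff.
  by rewrite summxE sumr_ge0 // => i _; rewrite mxE mulr_ge0 //; case: (wi i).
under eq_bigr => j _ do rewrite summxE.
rewrite exchange_big /= -x1; apply: eq_bigr => i _.
under eq_bigr => j _ do rewrite mxE.
by rewrite -mulr_sumr; have [_ ->] := wi i; rewrite mulr1.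
Qed.

Lemma vertices_good n : good_simplex n (vertices n).
Proof.
split=> [|v /mapP[i _ ->]]; first exact: size_vertices.
split=> [j|]; first by rewrite mxE ler0n.
by rewrite (bigD1 i) //= mxE !eqxx big1 ?addr0 // => j ji; rewrite mxE eqxx (negbTE ji).
Qed.

Lemma drop_at_good m n i (w : seq (simp R m)) : (i < n.+2)%N ->
  good_simplex n.+1 w -> good_simplex n (drop_at i w).
Proof.
move=> ni [sw wD]; split; first exact: size_drop_at.
by move=> v; rewrite mem_cat => /orP[/mem_take|/mem_drop]; exact: wD.
Qed.

Lemma map_aff_good m n p (t : seq (simp R m)) (r : seq (simp R n)) :
  good_simplex n t -> good_simplex p r -> good_simplex p (map (aff t) r).
Proof.
move=> gt [sr rD]; split; first by rewrite size_map.
by move=> v /mapP[x /rD xD ->]; exact: aff_Delta.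
Qed.

Lemma lbd_good m n (w : seq (simp R m)) : good_simplex n.+1 w -> on_terms (@good_simplex m n) (lbd w).
Proof.
move=> [sw wD]; apply: on_terms_imp (on_terms_and (lbd_size w) (lbd_sub w)) => x [].
by rewrite sw => -[sx] xw; split=> // v /xw; exact: wD.
Qed.

Lemma lsd_iter_good m n k (w : seq (simp R m)) : good_simplex n w -> on_terms (@good_simplex m n) (lsd_iter k w).
Proof.
move=> [sw wD]; apply: on_terms_imp (on_terms_and (lsd_iter_size k w) (lsd_iter_hull (@Delta_bary m) k wD)).
by move=> x [sx xD]; split=> //; rewrite sx.
Qed.

Lemma lht_iter_good m n k (w : seq (simp R m)) : good_simplex n w -> on_terms (@good_simplex m n.+1) (lht_iter k w).
Proof.
move=> [sw wD]; apply: on_terms_imp (on_terms_and (lht_iter_size k w) (lht_iter_hull (@Delta_bary m) k wD)).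
by move=> x [sx xD]; split=> //; rewrite sx sw.
Qed.

Lemma aff_cont m n (w : seq (simp R m)) (A : set (simp R n)) : cont_on A (@aff n _ w).
Proof.
apply: cont_on_continuous.
have h i : continuous (fun x : 'rV[R]_n.+1 => x ord0 i *: (w`_i : 'rV[R]_m.+1)).
  move=> y; apply: (@continuous_comp _ R^o _ (fun x : 'rV[R]_n.+1 => x ord0 i) (fun a : R => a *: w`_i)).
    exact: coord_continuous.
  exact: (@scalel_continuous R 'rV[R]_m.+1).
have := @continuous_big 'rV[R]_m.+1 'I_n.+1 +%R 0 xpredT (@add_continuous 'rV[R]_m.+1)
  'rV[R]_n.+1 (index_enum 'I_n.+1) (fun i x => x ord0 i *: w`_i) (fun i _ => h i).
exact.
Qed.

Lemma Delta_compact m : compact (Delta R m).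
Proof.
have cube : compact [set v : 'rV[R]_m.+1 | forall i, v ord0 i \in `[0, 1] ].
  apply: (@rV_compact R^o m.+1 (fun=> `[(0 : R), 1]%classic)) => _; exact: segment_compact.
have cs : continuous (fun x : simp R m => \sum_i x ord0 i).
  apply: (@continuous_big R^o 'I_m.+1 +%R 0 xpredT (@add_continuous R^o) (simp R m)
    (index_enum 'I_m.+1) (fun i x => x ord0 i)).
  by move=> i _ y; exact: coord_continuous.
apply: (subclosed_compact _ cube); last first.
  move=> x [x0 x1] i; rewrite /= in_itv /= x0 -x1 (bigD1 i) //= lerDl.
  by apply: sumr_ge0 => j _; exact: x0.
have -> : Delta R m = (\bigcap_(i in [set: 'I_m.+1]) [set x : simp R m | 0 <= x ord0 i]) `&`
    [set x : simp R m | \sum_i x ord0 i = 1].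
  apply/seteqP; split=> x [x0 x1]; split=> //; first by move=> i _; exact: x0.
  by move=> i; exact: x0.
apply: closedI.
  apply: closed_bigI => i _.
  apply: (@preimage_closed _ _ (fun x : simp R m => x ord0 i) [set a | 0 <= a]); last exact: closed_ge.
  by move=> x _; exact: coord_continuous.
apply: (@preimage_closed _ _ (fun x : simp R m => \sum_i x ord0 i) [set a | a = 1]); last exact: closed_eq.
by move=> x _; exact: cs.
Qed.

(** A Lebesgue number. If the ball of radius [d] about [x] lies in [U], points within [d/2] of [x]
    admit every radius below [d/2], and compactness makes the radius uniform. *)
Lemma Delta_lebesgue m (P : set (simp R m) -> Prop) :
  (forall x, Delta R m x -> exists U, open U /\ U x /\ P U) ->
  exists2 e : R, 0 < e & forall x, Delta R m x -> exists U, P U /\ ball x e `<=` U.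
Proof.
move=> hP.
have /compact_near_coveringP nc := @Delta_compact m.
have {}nc : \forall e \near (0 : R)^'+, Delta R m `<=` (fun x => exists U, P U /\ ball x e `<=` U).
  apply: nc => x Dx.
  have [U [oU [Ux PU]]] := hP x Dx.
  have /nbhs_ballP[d /= d0 dU] : nbhs x U by exact: open_nbhs_nbhs.
  exists (ball x (d / 2), [set e | e < d / 2]) => /=.
    split; first by apply: nbhsx_ballx; rewrite divr_gt0.
    by apply: nbhs_right_lt; rewrite divr_gt0.
  move=> [y e] [/= xy ed]; exists U; split=> // z yz; apply: dU.
  rewrite (splitr d); apply: ball_triangle xy _.
  exact: le_ball (ltW ed) _ yz.
have [e [he e0]] := filter_ex (filterI nc (nbhs_right_gt (0 : R))).
by exists e => // x; exact: he.
Qed.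

(** A simplex of mesh at most [e/2] lies in the open ball of radius [e] about its first vertex,
    because a point differs from that vertex by a convex combination of edges. Halving turns the
    weak bound of the mesh into a strict one. *)
Lemma lsd_iter_cover m n (P : set (simp R m) -> Prop) (w : seq (simp R m)) :
  good_simplex n w ->
  (forall x, Delta R m x -> exists U, open U /\ U x /\ P U) ->
  exists k0, forall k, (k0 <= k)%N ->
    on_terms (fun t => exists2 U, P U & forall y, Delta R n y -> U (aff t y)) (lsd_iter k w).
Proof.
move=> gw /Delta_lebesgue[e e0 he].
have [|k0 hk] := @lsd_iter_small R 'rV[R]_m.+1 w (e / 2); first by rewrite divr_gt0.
exists k0 => k /hk ck; apply: on_terms_imp (on_terms_and ck (lsd_iter_good k gw)) => t [dt [st tD]].
have t0 : t`_0 \in t by rewrite mem_nth // st.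
have [U [PU bU]] := he _ (tD _ t0); exists U => // y [y0 y1]; apply: bU.
rewrite -ball_normE /=; apply: le_lt_trans (_ : e / 2 < e); last first.
  by rewrite ltr_pdivrMr // ltr_pMr // ltrDl.
have -> : t`_0 - aff t y = \sum_(i < n.+1) y ord0 i *: (t`_0 - t`_i).
  under eq_bigr do rewrite scalerBr.
  by rewrite sumrB -scaler_suml y1 scale1r.
apply: le_trans (ler_norm_sum _ _ _) _.
rewrite -[leRHS]mul1r -[X in X * _]y1 mulr_suml; apply: ler_sum => i _.
rewrite normrZ ger0_norm //; apply: ler_wpM2l => //.
have ti : t`_i \in t by rewrite mem_nth // st.
exact: dt t0 ti.
Qed.

End Simplex.

(** * The complex of bundles over simplices *)

Section Bundles.
Variables (R : realType) (G : topGpd).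
Hypothesis hG : gpd G.
Implicit Types (m n : nat).

Lemma Delta_vertex n : Delta R n (vertices n)`_0.
Proof. by have [sv h] := vertices_good (R := R) n; apply: h; rewrite mem_nth // sv. Qed.

(* [pb_iso] alone is symmetric only on valid bundles. *)
Definition bundle_sset n : sset.
Proof.
refine (@SSet (pbundle G (simp R n)) (is_pbundle (Delta R n))
  (fun E F => pb_iso E F /\ pb_iso F E) _ _ _).
- by move=> E; split; exact: pb_iso_refl.
- by move=> E F [].
- by move=> E F K [h1 h2] [h3 h4]; split; exact: pb_iso_trans h3 || exact: pb_iso_trans h4 h2.
Defined.

Lemma bundle_seE n (E F : bundle_sset n) : sv E -> pb_iso E F -> se E F.
Proof. by move=> /pbunP vE h; split=> //; exact: pb_iso_sym vE h. Qed.

(** Restriction of a bundle to an affine simplex: it carries linear chains in [Delta] to chains of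
    bundles, and with them the linear identities. *)
Definition pull m n (E : bundle_sset m) (w : seq (simp R m)) : bundle_sset n :=
  pullback (@aff R n _ w) (Delta R n) E.

Lemma pull_sv m n (E : bundle_sset m) (w : seq (simp R m)) :
  sv E -> good_simplex n w -> sv (pull n E w).
Proof.
move=> /pbunP vE gw; apply/pbunP; apply: pullback_pbun vE _ _; first exact: aff_cont.
by move=> y; exact: aff_Delta.
Qed.

Lemma pull_se m n (E F : bundle_sset m) (w : seq (simp R m)) :
  se E F -> se (pull n E w) (pull n F w).
Proof. by move=> [h1 h2]; split; exact: pullback_iso. Qed.

Lemma pull_pull m n p (E : bundle_sset m) (w : seq (simp R m)) (v : seq (simp R n)) :
  sv E -> good_simplex n w -> good_simplex p v ->
  se (pull p (pull n E w) v) (pull p E (map (@aff R n _ w) v)).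
Proof.
move=> vE gw gv; apply: bundle_seE; first by apply: pull_sv => //; exact: pull_sv.
apply: (pb_iso_trans (F := pullback (@aff R n _ w \o @aff R p _ v) (Delta R p) E)).
  apply: pullback_comp; first exact: aff_cont.
  by move=> y; exact: aff_Delta.
by apply: pullback_ext => y _ /=; rewrite aff_map //; case: gv.
Qed.

Definition face_of n (i : 'I_n.+2) (E : bundle_sset n.+1) : bundle_sset n :=
  pullback (@face R n i) (Delta R n) E.

Lemma face_cont n (i : 'I_n.+2) (A : set (simp R n)) : cont_on A (@face R n i).
Proof.
apply: (cont_on_eq (f := @aff R n _ (drop_at i (vertices n.+1)))); last exact: aff_cont.
by move=> x _; rewrite face_aff.
Qed.

Lemma face_Delta n (i : 'I_n.+2) (x : simp R n) : Delta R n x -> Delta R n.+1 (face i x).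
Proof.
move=> Dx; rewrite face_aff; apply: aff_Delta => //; apply: drop_at_good => //.
exact: vertices_good.
Qed.

Lemma face_sv n (i : 'I_n.+2) (E : bundle_sset n.+1) : sv E -> sv (face_of i E).
Proof.
move=> /pbunP vE; apply/pbunP; apply: pullback_pbun vE (@face_cont _ _ _) _ => x.
exact: face_Delta.
Qed.

Lemma face_se n (i : 'I_n.+2) (E F : bundle_sset n.+1) : se E F -> se (face_of i E) (face_of i F).
Proof. by move=> [h1 h2]; split; exact: pullback_iso. Qed.

Lemma pull_face m n (E : bundle_sset m) (w : seq (simp R m)) (i : 'I_n.+2) :
  sv E -> good_simplex n.+1 w -> se (face_of i (pull n.+1 E w)) (pull n E (drop_at i w)).
Proof.
move=> vE gw; apply: bundle_seE; first by apply: face_sv; exact: pull_sv.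
apply: (pb_iso_trans (F := pullback (@aff R n.+1 _ w \o @face R n i) (Delta R n) E)).
  by apply: pullback_comp; [exact: face_cont|move=> y; exact: face_Delta].
by apply: pullback_ext => y _ /=; rewrite aff_face //; case: gw.
Qed.

Lemma pull_vertices n (E : bundle_sset n) : sv E -> se (pull n E (vertices n)) E.
Proof.
move=> vE; apply: bundle_seE; first by apply: pull_sv => //; exact: vertices_good.
by apply: (pullback_id (proj1 (pbunP _ _) vE)) => x _; exact: aff_vertices.
Qed.

Definition face_bd n (E : bundle_sset n.+1) : seq (bundle_sset n * int) :=
  [seq (face_of i E, (-1) ^+ (i : nat)) | i <- enum 'I_n.+2].

Lemma ez_face_bd n (M : zmodType) (g : bundle_sset n -> M) (E : bundle_sset n.+1) :
  ez g (face_bd E) = \sum_(i < n.+2) g (face_of i E) *~ (-1) ^+ i.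
Proof. by rewrite /ez /ev big_map big_enum. Qed.

Lemma face_bd_good n : goodop (@face_bd n).
Proof.
split=> [E vE|E F vE vF EF M g gi].
  by rewrite /face_bd; elim: (enum _) => //= i s IH; split=> //; exact: face_sv.
rewrite !ez_face_bd; apply: eq_bigr => i _; congr (_ *~ _).
by apply: gi; [exact: face_sv|exact: face_sv|exact: face_se].
Qed.

(** Restriction to affine simplices is a chain map. *)
Lemma face_bd_pull m n (E : bundle_sset m) (w : seq (simp R m)) : sv E -> good_simplex n.+1 w ->
  zeq (face_bd (pull n.+1 E w)) (bmapc (pull n E) (lbd w)).
Proof.
move=> vE gw M g gi; rewrite ez_face_bd ez_map ez_lbd; have [sw _] := gw; rewrite sw.
apply: eq_bigr => i _; congr (_ *~ _); apply: gi; last exact: pull_face.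
  by apply: face_sv; exact: pull_sv.
by apply: pull_sv => //; exact: drop_at_good.
Qed.

Lemma face_bd_vertices n (E : bundle_sset n.+1) : sv E ->
  zeq (face_bd E) (bmapc (pull n E) (lbd (vertices n.+1))).
Proof.
move=> vE M g gi; rewrite -(face_bd_pull vE (vertices_good _) gi).
apply: (face_bd_good n).2 => //; first by apply: pull_sv => //; exact: vertices_good.
by apply: se_sym; exact: pull_vertices.
Qed.

Lemma face_bd_bd n (E : bundle_sset n.+2) : sv E -> zeq (zmap (@face_bd n) (face_bd E)) [::].
Proof.
move=> vE M g gi; rewrite ez_zmap (face_bd_vertices vE (goodop_inv (face_bd_good n) gi)).
rewrite ez_nil ez_map -(ez_lbd_lbd (vertices n.+2) (g \o pull n E)) ez_zmap.
apply: ez_call (lbd_good (vertices_good _)) _ => w gw /=.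
by rewrite (face_bd_pull vE gw gi) ez_map.
Qed.

Definition bundle_bcx : bcx := @Bcx bundle_sset face_bd face_bd_good face_bd_bd.

Definition bundle_sd k n (E : bundle_bcx n) : seq (bundle_bcx n * int) :=
  bmapc (pull n E) (lsd_iter k (vertices n)).

Definition bundle_ht k n (E : bundle_bcx n) : seq (bundle_bcx n.+1 * int) :=
  bmapc (pull n.+1 E) (lht_iter k (vertices n)).

Lemma pull_chain_good n p (c : seq (seq (simp R n) * int)) : on_terms (@good_simplex R n p) c ->
  goodop (fun E : bundle_sset n => bmapc (pull p E) c).
Proof.
move=> gc; split=> [E vE|E F vE vF EF M g gi].
  by apply: on_terms_bmapc; apply: on_terms_imp gc => w; exact: pull_sv.
rewrite !ez_map; apply: ez_call gc _ => w gw; apply: gi; [exact: pull_sv|exact: pull_sv|exact: pull_se].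
Qed.

Lemma pull_chain_pull m n p (E : bundle_sset m) (w : seq (simp R m)) (c : seq (seq (simp R n) * int)) :
  sv E -> good_simplex n w -> on_terms (@good_simplex R n p) c ->
  zeq (bmapc (pull p (pull n E w)) c) (bmapc (pull p E) (bmapc (map (@aff R n _ w)) c)).
Proof.
move=> vE gw gc M g gi; rewrite !ez_map; apply: ez_call gc _ => v gv /=; apply: gi.
- by apply: pull_sv => //; exact: pull_sv.
- by apply: pull_sv => //; exact: map_aff_good.
- exact: pull_pull.
Qed.

Lemma bundle_sd_good k n : goodop (@bundle_sd k n).
Proof. by apply: pull_chain_good; apply: lsd_iter_good; exact: vertices_good. Qed.

Lemma bundle_ht_good k n : goodop (@bundle_ht k n).
Proof. by apply: pull_chain_good; apply: lht_iter_good; exact: vertices_good. Qed.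

Lemma bundle_ht_pull k m n (E : bundle_sset m) (w : seq (simp R m)) : sv E -> good_simplex n w ->
  zeq (bundle_ht k (pull n E w)) (bmapc (pull n.+1 E) (lht_iter k w)).
Proof.
move=> vE gw M g gi; have gv : good_simplex n (vertices (R := R) n) := vertices_good n.
rewrite (pull_chain_pull vE gw (lht_iter_good k gv) gi).
by rewrite -(lht_iter_map (@aff R n _ w)) map_aff_vertices //; case: gw.
Qed.

(** Used in degree 0, where a vertex has linear boundary [[::]] while a bundle has none. *)
Lemma lht_iter_nil k (V : lmodType R) : lht_iter k ([::] : seq V) = [::].
Proof. by elim: k => //= k IH; rewrite /lsd /= /zmap /= IH. Qed.

(** The linear homotopy formula on the standard simplex, carried over by [pull]. Naturality of the
    linear homotopy under affine maps identifies its value on a face with the homotopy of the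
    restricted bundle. *)
Lemma bd_hom k n (E : bundle_bcx n) : sv E ->
  zeq (zmap (@bd bundle_bcx n) (bundle_ht k E) ++ zmap (@shop bundle_bcx (@bundle_ht k) n) (dsh E) ++ bundle_sd k E)
    [:: (E, 1)].
Proof.
move=> vE M g gi; have gv : good_simplex n (vertices (R := R) n) := vertices_good n.
have e : (g \o pull n E) (vertices n) = g E by apply: gi => //; [exact: pull_sv|exact: pull_vertices].
rewrite ez1 -e -(lht_iter_hom k (vertices n) (g \o pull n E)) !ez_cat addrA.
have -> : ez g (zmap (@bd bundle_bcx n) (bundle_ht k E)) = ez (g \o pull n E) (zmap (@lbd _) (lht_iter k (vertices n))).
  rewrite !ez_zmap ez_map; apply: ez_call (lht_iter_good k gv) _ => w gw.
  by rewrite /= (face_bd_pull vE gw gi) ez_map.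
rewrite [ez g (bundle_sd k E)]ez_map; congr (_ + _ + _).
case: n E vE g gi gv e => [|n] E vE g gi gv e.
  rewrite [LHS]ez_nil ez_zmap.
  rewrite (_ : lbd (vertices 0) = [:: ([::], 1)]); first by rewrite ez1 lht_iter_nil ez_nil.
  have := size_vertices (R := R) 0; case: (vertices 0) => [|v [|]] //.
rewrite [LHS]ez_zmap [LHS](face_bd_vertices vE (goodop_inv (bundle_ht_good k n) gi)) ez_map ez_zmap.
apply: ez_call (lbd_good gv) _ => w gw /=.
by rewrite (bundle_ht_pull k vE gw gi) ez_map.
Qed.

Definition bundle_subdivision k : subdivision bundle_bcx :=
  Subdivision (@bundle_sd_good k) (@bundle_ht_good k) (@bd_hom k).

Definition triv n (E : bundle_sset n) := trivial (Delta R n) E.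

Lemma triv_bd n (E : bundle_sset n.+1) : sv E -> triv E -> on_terms (@triv n) (face_bd E).
Proof.
move=> vE [s [cs sP]]; rewrite /face_bd; elim: (enum _) => //= i r IH; split=> //.
apply: (@trivial_pullback _ _ _ setT (Delta R n.+1) _ _ _ s).
- by apply: cont_on_sub cs => x [].
- by move=> x _ /sP.
- exact: face_cont.
- by move=> y Dy; split=> //; exact: face_Delta.
Qed.

Hypothesis eG : local_homeomorphism (gdom G).

Lemma triv_small n (E : bundle_sset n) : sv E ->
  exists k0, forall k, (k0 <= k)%N -> on_terms (@triv n) (bundle_sd k E).
Proof.
move=> /pbunP vE.
pose P (U : set (simp R n)) : Prop := exists s : simp R n -> tot E, cont_on (U `&` Delta R n) s /\ forall x, U x -> Delta R n x -> carr E (s x) /\ bmap E (s x) = x.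
have [|k0 hk] := lsd_iter_cover (P := P) (vertices_good n).
  move=> x Dx; have [U [oU [Ux sP]]] := local_section hG eG vE Dx.
  by exists U.
exists k0 => k kk; apply: on_terms_bmapc.
apply: on_terms_imp (on_terms_and (hk k kk) (lsd_iter_good k (vertices_good n))) => w [[U [s [cs sP]] hU] gw].
apply: (@trivial_pullback _ _ _ U (Delta R n) _ _ _ s) => //; first exact: aff_cont.
by move=> y Dy; split; [exact: hU|exact: aff_Delta].
Qed.

End Bundles.

(** * Comparison of the two complexes *)

Section InducedMorphism.
Variables (R : realType) (H G : topGpd) (phi : gfunctor H G).
Hypotheses (hH : gpd H) (hG : gpd G) (hphi : continuous_functor phi).

Let ind n (F : bundle_bcx R H n) : bundle_bcx R G n := induced phi F.

Lemma ind_sv n (F : bundle_bcx R H n) : sv F -> sv (ind F).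
Proof. by move=> /pbunP vF; apply/pbunP; exact: induced_pbun. Qed.

Lemma ind_se n (E F : bundle_bcx R H n) : sv E -> sv F -> se E F -> se (ind E) (ind F).
Proof.
move=> vE /pbunP vF [h1 _]; apply: bundle_seE; first exact: ind_sv.
move/pbunP: vE => vE; exact (induced_iso hH hG hphi (Delta_vertex R n) vE vF h1).
Qed.

Lemma ind_pullback n m (F : bundle_bcx R H n) (f : simp R m -> simp R n) :
  sv F -> cont_on (Delta R m) f -> (forall y, Delta R m y -> Delta R n (f y)) ->
  se (induced phi (pullback f (Delta R m) F) : bundle_bcx R G m)
     (pullback f (Delta R m) (ind F)).
Proof.
move=> /pbunP vF cf fD; apply: bundle_seE.
  by apply/pbunP; apply: induced_pbun => //; exact: pullback_pbun vF cf fD.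
exact (induced_pullback hH hG hphi (Delta_vertex R m) vF cf fD).
Qed.

Lemma ind_bd n (F : bundle_bcx R H n.+1) : sv F ->
  zeq (bmapc (@ind n) (bd F)) (@bd (bundle_bcx R G) n (ind F)).
Proof.
move=> vF M g gi; rewrite ez_map !ez_face_bd; apply: eq_bigr => i _; congr (_ *~ _).
apply: gi; last by apply: ind_pullback => //; [exact: face_cont|exact: face_Delta].
  by apply: ind_sv; exact: face_sv.
by apply: face_sv; exact: ind_sv.
Qed.

Definition induced_bmorph : bmorph (bundle_bcx R H) (bundle_bcx R G) :=
  Bmorph ind_sv ind_se ind_bd.

Lemma ind_pull n p (F : bundle_bcx R H n) (c : seq (seq (simp R n) * int)) : sv F ->
  on_terms (@good_simplex R n p) c ->
  zeq (bmapc (@ind p) (bmapc (pull p F) c)) (bmapc (pull p (ind F)) c).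
Proof.
move=> vF gc M g gi; rewrite !ez_map; apply: ez_call gc _ => w gw /=; apply: gi.
- by apply: ind_sv; exact: pull_sv.
- by apply: pull_sv => //; exact: ind_sv.
- by apply: ind_pullback => //; [exact: aff_cont|move=> y; exact: aff_Delta].
Qed.

Hypotheses (eH : local_homeomorphism (gdom H)) (eG : local_homeomorphism (gdom G)).
Hypotheses (hob : homeomorphism (fob phi)) (hsurj : forall g, exists h, fmor phi h = g).

Lemma triv_lift n (E : bundle_bcx R G n) : sv E -> triv E ->
  exists F : bundle_bcx R H n, sv F /\ triv F /\ se (ind F) E.
Proof.
move=> /pbunP vE tE.
have [F [vF [tF FE]]] := trivial_lift hH hG hphi hob (Delta_vertex R n) vE tE.
exists F; split; first exact/pbunP.
by split=> //; apply: bundle_seE FE; apply: ind_sv; exact/pbunP.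
Qed.

(** Both subdivisions run over the same simplices and can be compared term by term: for large [k]
    each simplex lies in an open set where [local_iso] gives a comparing family of arrows, and
    [section_iso] applies over it. *)
Lemma triv_inj n (E F : bundle_bcx R H n) : sv E -> sv F -> triv E -> triv F ->
  se (ind E) (ind F) -> exists k0, forall k, (k0 <= k)%N ->
  zeq (bundle_sd k E) (bundle_sd k F).
Proof.
move=> vE vF [s hs] [t ht] [EF _].
have pE : pbun (Delta R n) E by exact/pbunP.
have pF : pbun (Delta R n) F by exact/pbunP.
pose P (U : set (simp R n)) : Prop := exists th : simp R n -> mor H,
  cont_on (U `&` Delta R n) th /\ forall y, U y -> Delta R n y ->
    gdom H (th y) = bproj E (s y) /\ gcod H (th y) = bproj F (t y).
have [|k0 hk] := lsd_iter_cover (P := P) (vertices_good n).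
  move=> x Dx; have [U [oU [Ux PU]]] :=
    local_iso hH hG hphi eH eG hob hsurj pE pF hs ht EF Dx.
  by exists U.
exists k0 => k /hk ck M g gi; rewrite !ez_map.
apply: ez_call (on_terms_and ck (lsd_iter_good k (vertices_good n))) _ => w [[U [th [cth thP]] hU] gw].
have vEw : sv (pull n E w) by exact: pull_sv.
have vFw : sv (pull n F w) by exact: pull_sv.
apply: gi => //; apply: bundle_seE => //.
have aD y : Delta R n y -> Delta R n (aff w y) by exact: aff_Delta.
have ac : cont_on (Delta R n) (@aff R n _ w) by exact: aff_cont.
have secw (K : bundle_bcx R H n) (r : simp R n -> tot K) : section_on (Delta R n) r ->
    section_on (E := pull n K w) (Delta R n) (fun y => (r (aff w y), y)).
  move=> [cr rP]; split; first by apply: cont_on_pair; [exact: cont_on_comp ac cr aD|exact: cont_on_id].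
  by move=> y Dy; have [? ?] := rP _ (aD _ Dy).
apply: (section_iso hH (E := pull n E w) (F := pull n F w) (th := fun y => th (aff w y))
  (Delta_vertex R n) _ _ (secw E s hs) (secw F t ht)).
- exact/pbunP.
- exact/pbunP.
- by apply: cont_on_comp ac cth _ => y Dy; split; [exact: hU|exact: aD].
- by move=> y Dy; exact: thP (hU _ Dy) (aD _ Dy).
Qed.

Lemma induced_cone_acyclic : acyclic (cone induced_bmorph).
Proof.
apply: (cone_acyclic (SX := fun k => bundle_subdivision R H k)
  (SY := fun k => bundle_subdivision R G k) (tX := @triv R H) (tY := @triv R G)).
- by move=> k n F vF; apply: ind_pull => //; apply: lsd_iter_good; exact: vertices_good.
- by move=> k n F vF; apply: ind_pull => //; apply: lht_iter_good; exact: vertices_good.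
- by move=> n F; exact: triv_small.
- by move=> n F; exact: triv_small.
- by move=> n F; exact: triv_bd.
- by move=> n E; exact: triv_lift.
- by move=> n E F; exact: triv_inj.
Qed.

End InducedMorphism.

(** * Translation to the chains and cochains of the statement *)

Section Translation.
Variables (R : realType) (A : zmodType) (G : topGpd).

Lemma chain_coefE n (c : chain R A G n) (E : bundle_bcx R G n) :
  valid_chain c -> sv E -> chain_coef c E = coef (X := bundle_bcx R G n) c E.
Proof.
move=> vc vE; rewrite /chain_coef /coef.
elim: c vc => [|p c IH]; first by rewrite !big_nil.
move=> [vp vc]; rewrite !big_cons IH //; congr (if _ then _ else _).
by apply/asboolP/asboolP => [|[]//]; exact: bundle_seE.
Qed.

Lemma chain_eqE n (c d : chain R A G n) : valid_chain c -> valid_chain d ->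
  chain_eq c d <-> aeq (X := bundle_bcx R G n) c d.
Proof.
move=> vc vd; rewrite -coef_aeq //; split=> h E vE.
  by rewrite -!chain_coefE //; exact: h.
by rewrite !chain_coefE //; exact: h.
Qed.

Lemma bdryE n (c : chain R A G n.+1) : bdry c = amap (@bd (bundle_bcx R G) n) c.
Proof.
rewrite /bdry /amap; congr flatten; apply: eq_map => p /=.
by rewrite [in RHS]/face_bd -[RHS]map_comp.
Qed.

Lemma bdry_valid n (c : chain R A G n.+1) : valid_chain c -> valid_chain (bdry c).
Proof.
by move=> vc; rewrite bdryE; apply: (on_terms_amap vc); exact: (bd_good (bundle_bcx R G) n).1.
Qed.

Lemma is_cycleE n (c : chain R A G n) : valid_chain c -> is_cycle c <-> acycle (Z := bundle_bcx R G) c.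
Proof.
case: n c => [|n] c vc //=; rewrite -bdryE; apply: chain_eqE => //.
exact: bdry_valid.
Qed.

Lemma is_boundaryE n (c : chain R A G n) : valid_chain c ->
  is_boundary c <-> abdry (Z := bundle_bcx R G) c.
Proof.
move=> vc; split=> -[b [vb cb]]; exists b; split=> //.
  by rewrite -bdryE; apply/chain_eqE => //; exact: bdry_valid.
by apply/chain_eqE => //; [exact: bdry_valid|rewrite bdryE].
Qed.

Lemma valid_cochainE n (f : cochain R A G n) : valid_cochain f <-> einv (X := bundle_bcx R G n) f.
Proof.
split=> h E F vE vF; first by case=> EF _; exact: h.
by move=> EF; apply: h => //; exact: bundle_seE.
Qed.

Lemma cobdryE n (f : cochain R A G n) (E : bundle_bcx R G n.+1) :
  cobdry f E = ez f (@bd (bundle_bcx R G) n E).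
Proof. by rewrite ez_face_bd. Qed.

Lemma is_cocycleE n (f : cochain R A G n) :
  is_cocycle f <-> (forall E : bundle_bcx R G n.+1, sv E -> ez f (bd E) = 0).
Proof. by split=> h E vE; have := h E vE; rewrite cobdryE. Qed.

Lemma is_coboundaryE n (f : cochain R A G n) :
  is_coboundary f <-> coboundary (Z := bundle_bcx R G) f.
Proof.
case: n f => [|n] f //=; split=> -[g [/valid_cochainE vg fg]]; exists g; split=> //.
  by move=> E vE; rewrite -cobdryE; exact: fg.
by move=> E vE; rewrite cobdryE; exact: fg.
Qed.

End Translation.

Theorem theorem5p15 (R : realType) (H G : topGpd) (phi : gfunctor H G) :
  etale_groupoid H -> etale_groupoid G -> continuous_functor phi ->
  homeomorphism (fob phi) -> (forall g : mor G, exists h : mor H, fmor phi h = g) ->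
  forall (A : zmodType) (n : nat),
    homology_iso R A phi n /\ cohomology_iso R A phi n.
Proof.
move=> [/gpdP hH eH] [/gpdP hG eG] hphi hob hsurj A n.
have ac := @induced_cone_acyclic R H G phi hH hG hphi eH eG hob hsurj.
have vind (w : chain R A H n) : valid_chain w -> valid_chain (chain_ind phi w).
  move=> vw; apply: on_terms_bmapc; apply: on_terms_imp vw => F; exact: (ind_sv hH hG hphi).
split; split.
- move=> z vz /(is_cycleE vz) cz.
  have [w [vw [/(is_cycleE vw) cw bw]]] := cone_homology_surj ac vz cz.
  exists w; split=> //; split=> //; apply/is_boundaryE => //.
  by apply/on_terms_cat; split; [exact: vind|exact: on_terms_chopp].
- move=> w vw /(is_cycleE vw) cw /(is_boundaryE (vind _ vw)) bw.
  by apply/is_boundaryE => //; exact: (cone_homology_inj ac vw cw bw).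
- move=> f /valid_cochainE vf /is_cocycleE cf.
  have [f' [vf' [cf' bf']]] := cone_cohomology_surj ac vf cf.
  exists f'; split; first exact/valid_cochainE.
  by split; [exact/is_cocycleE|exact/is_coboundaryE].
- move=> f /valid_cochainE vf /is_cocycleE cf /is_coboundaryE bf.
  by apply/is_coboundaryE; exact: (cone_cohomology_inj ac vf cf bf).
Qed.
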